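(* Let $H\in\,]1/2,1[$, $\sigma\in\mathbb R\setminus\{0\}$, and let $B$ be a fractional Brownian motion of Hurst index $H$. Let $b\in\mathrm{Lip}_b^{\infty}(\mathbb R)$ be such that there is a constant $M>0$ with $b'(y)\leqslant -M$ for every $y\in\mathbb R$. Let $K:\mathbb R\to\mathbb R_+$ be continuously differentiable, with $K$ and $K'$ bounded, $\mathrm{supp}(K)=[-1,1]$ and $\int_{\mathbb R}K=1$. For $y\in\mathbb R$ let $X_y$ be the solution of $X_y(t)=y+\int_0^tb(X_y(s))ds+\sigma B(t)$; fix $x_0,x\in\mathbb R$. Let $h:[t_0,\infty[\,\to\,]0,1[$ ($t_0\in\mathbb R_+$) be a decreasing function with $\lim_{T\to\infty}h(T)=0$ and $\lim_{T\to\infty}Th(T)=\infty$, and let $\varepsilon(T)>0$ with $\lim_{T\to\infty}\varepsilon(T)=0$. Assume that there exists $l(x)\in\,]0,\infty]$ such that $$\widehat f_{T,h(T)}(x)=\frac1{Th(T)}\int_0^TK\left(\frac{X_{x_0}(s)-x}{h(T)}\right)ds$$ converges to $l(x)$ in probability as $T\to\infty$. Let $\beta\in\,]0,1-H[$ be such that $T^{-\beta}=o(h(T)^2)$ as $T\to\infty$. Then, with $\widehat b_{T,h,\varepsilon}(x)$ as defined in the context: (1) If $\varepsilon(T)=o(h(T)^{-2}T^{2H-2})$ as $T\to\infty$, then $\widehat b_{T,h(T),\varepsilon(T)}(x)\to b(x)$ in probability as $T\to\infty$. (2) For every $\gamma\in\,]0,\beta[$ such that, as $T\to\infty$, $h(T)=o(T^{-\gamma})$,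 $T^{H-1+\gamma}=o(h(T)^2)$ and $\varepsilon(T)=o(h(T)^{-2}T^{2H-2+\gamma})$, $$T^{\gamma}|\widehat b_{T,h(T),\varepsilon(T)}(x)-b(x)|\xrightarrow[T\to\infty]{}0\quad\text{in probability}.$$
   Context: $\mathrm{Lip}_b^m(\mathbb R)$ is the set of Lipschitz $\varphi\in C^m(\mathbb R)$ with $\|\varphi^{(k)}\|_\infty<\infty$ for $1\leqslant k\leqslant m$; $\mathrm{Lip}_b^\infty(\mathbb R)=\bigcap_{m\geqslant1}\mathrm{Lip}_b^m(\mathbb R)$. $\int_0^TY(s)dX(s)$ denotes the pathwise Young integral (the limit of left-point Riemann sums as the mesh of the partition tends to $0$). The solutions $X_y$, $y\in\mathbb R$, are all driven by the same $B$. Put $\alpha_H=H(2H-1)$. For $T,h,\varepsilon>0$, $$\widehat b_{T,h,\varepsilon}(x)=\frac{\int_0^TK\left(\frac{X_{x_0}(s)-x}{h}\right)dX_{x_0}(s)-\alpha_H\sigma^2\frac1h\int_0^T\int_0^uK'\left(\frac{X_{x_0}(u)-x}{h}\right)\frac{X_{x_0+\varepsilon}(u)-X_{x_0}(u)}{X_{x_0+\varepsilon}(v)-X_{x_0}(v)}|u-v|^{2H-2}dvdu}{\int_0^TK\left(\frac{X_{x_0}(s)-x}{h}\right)ds},$$ considered on the event where the denominator is positive (its value elsewhere is irrelevant). *)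

(* Defs.v *)
From HB Require Import structures.
From mathcomp Require Import all_boot all_order all_algebra.
From mathcomp Require Import all_classical all_reals all_analysis.

Set Implicit Arguments.
Unset Strict Implicit.
Unset Printing Implicit Defensive.

Import Order.TTheory GRing.Theory Num.Theory.
Import numFieldNormedType.Exports.

Local Open Scope classical_set_scope.
Local Open Scope ring_scope.

(* With this and the next declaration, the Landau notation f =o_pinfty g applies at +oo. *)
Notation pinfty := (pinfty_nbhs _).
Canonical pinfty_nbhs_filter_on (R : numFieldType) :=
  FilterType (pinfty_nbhs R) _.

Section deterministic.
Context {R : realType}.
Implicit Types (phi K f g : R -> R) (a c t : R).

Local Notation mu := (@lebesgue_measure R).

Definition Lip_b (m : nat) phi : Prop :=
  [/\ lipschitz phi,
      forall k : nat, (k < m)%N -> forall z, derivable (derive1n k phi) z 1,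
      continuous (derive1n m phi) &
      forall k : nat, (1 <= k <= m)%N -> bounded_fun (derive1n k phi)].

Definition Lip_b_infty phi : Prop := forall m : nat, (1 <= m)%N -> Lip_b m phi.

Definition kernel_assumption K : Prop :=
  [/\ forall z, 0 <= K z,
      (forall z, derivable K z 1) /\ continuous (derive1 K),
      bounded_fun K /\ bounded_fun (derive1 K),
      closure [set z | K z != 0] = `[-1, 1]%classic &
      (\int[mu]_z (K z)%:E)%E = 1%E].

(* The partition with points a < s_0 < ... < s_(n-1) = c is the sequence s. *)
Definition left_riemann_sum a f g (s : seq R) : R :=
  \sum_(0 <= i < size s)
    f (nth a (a :: s) i) * (g (nth a (a :: s) i.+1) - g (nth a (a :: s) i)).

Definition mesh_lt a (s : seq R) (delta : R) : Prop :=
  forall i : nat, (i < size s)%N ->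
    nth a (a :: s) i.+1 - nth a (a :: s) i < delta.

Definition is_young_integral a c f g (I : R) : Prop :=
  forall e : R, 0 < e -> exists2 delta : R, 0 < delta &
    forall s : seq R, itv_partition a c s -> mesh_lt a s delta ->
      `|left_riemann_sum a f g s - I| < e.

(* An unspecified real when the Riemann sums do not converge. *)
Definition young_integral a c f g : R :=
  get [set I : R | is_young_integral a c f g I].

Definition alpha_H (H : R) : R := H * (2 * H - 1).

(* xi and xi_eps stand for the paths of X_(x0) and X_(x0 + eps). *)

Definition f_hat K (T h x : R) (xi : R -> R) : R :=
  1 / (T * h) * \int[mu]_(s in `[0, T]) K ((xi s - x) / h).

(* Division by 0 yields 0, so b_hat is 0 where its denominator vanishes. *)
Definition b_hat (H sigma : R) K (T h x : R) (xi xi_eps : R -> R) : R :=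
  (young_integral 0 T (fun s => K ((xi s - x) / h)) xi
   - alpha_H H * sigma ^+ 2 * (1 / h) *
     \int[mu]_(u in `[0, T]) \int[mu]_(v in `[0, u])
       (derive1 K ((xi u - x) / h) *
        ((xi_eps u - xi u) / (xi_eps v - xi v)) *
        `|u - v| `^ (2 * H - 2)))
  / \int[mu]_(s in `[0, T]) K ((xi s - x) / h).

End deterministic.

Section probabilistic.
Context {d : measure_display} {Omega : measurableType d} {R : realType}.
Variable P : probability Omega R.

Local Notation mu := (@lebesgue_measure R).

(* normal_prob m 0 is a uniform law in the library, hence the case split. *)
Definition gaussian_law (m s : R) (A : set R) : \bar R :=
  if s == 0 then \d_m A else normal_prob m s A.

Definition gaussian_process (B : R -> {RV P >-> R}) : Prop :=
  forall (n : nat) (t c : 'I_n -> R), (forall i, 0 <= t i) ->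
    exists m s : R, forall A : set R, measurable A ->
      P ((fun w => \sum_(i < n) c i * B (t i) w) @^-1` A) = gaussian_law m s A.

(* Processes are indexed by R; only times t >= 0 matter. *)
Definition fractional_brownian_motion (H : R) (B : R -> {RV P >-> R}) : Prop :=
  [/\ gaussian_process B,
      forall t, 0 <= t -> ('E_P[B t] = 0)%E,
      forall s t, 0 <= s -> 0 <= t ->
        covariance P (B s) (B t) =
        ((s `^ (2 * H) + t `^ (2 * H) - `|t - s| `^ (2 * H)) / 2)%:E &
      \forall w \ae P, {within `[0, +oo[, continuous (fun t => B t w)}].

Definition sde_solution (b : R -> R) (sigma : R) (B : R -> {RV P >-> R})
    (y : R) (X : R -> {RV P >-> R}) : Prop :=
  \forall w \ae P,
    {within `[0, +oo[, continuous (fun t => X t w)} /\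
    forall t, 0 <= t ->
      X t w = y + \int[mu]_(s in `[0, t]) b (X s w) + sigma * B t w.

(* The outer measure mu_ext P agrees with P on measurable sets; it is used
   because a pathwise integral, being specified only almost surely, need not
   be measurable when P is not complete. *)
Definition cvg_in_probability (Z : R -> Omega -> R) (l : \bar R) : Prop :=
  match l with
  | r%:E => forall e : R, 0 < e ->
      mu_ext P [set w | e <= `|Z T w - r|] @[T --> +oo] --> 0%E
  | +oo%E => forall A : R,
      mu_ext P [set w | Z T w <= A] @[T --> +oo] --> 0%E
  | -oo%E => forall A : R,
      mu_ext P [set w | A <= Z T w] @[T --> +oo] --> 0%E
  end.

End probabilistic.

(* Main.v *)
Require Import Defs.
From HB Require Import structures.
From mathcomp Require Import all_boot all_order all_algebra.
From mathcomp Require Import all_classical all_reals all_analysis.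
From mathcomp Require Import measurable_realfun.
From mathcomp Require Import ring lra.

Set Implicit Arguments.
Unset Strict Implicit.
Unset Printing Implicit Defensive.

Import Order.TTheory GRing.Theory Num.Theory.
Import numFieldNormedType.Exports.

Local Open Scope classical_set_scope.
Local Open Scope ring_scope.

(* The Young integral of K((X - x)/h) against X is F(X_T) - F(X_0) with F a
   primitive of K((. - x)/h).  Subtracting from it the integral of K b(X) and
   the trace term with the exact kernel p(u)/p(v), p(u) = exp of the integral
   of b'(X) over [0, u], leaves a Skorokhod integral (times sigma).  Its tail
   P(|.| > a) <= C T^(2H) / (h a)^2 is obtained without Malliavin calculus: in
   the Euler scheme of step T/n it is a finite sum of Y_k G_k minus an explicit
   derivative of Y_k, where the G_k are the Gaussian increments, and such a sum
   is the derivative at s = 0 of exponentially tilted shifts.  The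
   Cameron-Martin formula in finite dimension gives the second moments of the
   difference quotients, the contraction b' <= -M bounds the sensitivities, and
   Fatou's lemma on sets lets s -> 0 and n -> oo; the Euler sums converge
   pathwise since (B_t - B_s)^2 = o(t - s) uniformly on compacts.  Replacing the
   exact kernel by the one of X_(x0 + eps) costs O(eps exp(-M u)), because
   ln (X_(x0 + eps) - X_(x0)) - ln p has derivative O(eps exp(-M u)).  Hence
   |b_hat - b(x)| <= C h + (|Skorokhod part| + C eps T / h) / (T h f_hat), and
   f_hat stays away from 0 in probability. *)

(** * Equality of weighted image measures *)

Section weighted.
Import HBNNSimple.

(** The increments are known only through the laws of their linear combinations, and their
    covariance may be singular, so no joint density is there to be shifted. The Cameron-Martin
    formula is therefore reduced to dimension one: the combination G that defines the tilt is
    independent of the residuals of the increments after regression on G, because the cosine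
    transform of the pair factors, and only the law of G is tilted. For this, cosines must determine
    a bounded signed density on the line, which is shown by approximating indicators of half-lines
    by polynomials in a sine of low frequency.

    The second moment obtained has the shape of the Skorokhod isometry: covariances plus products of
    crossed sensitivities. The covariances of all pairs add up to T^(2H), the variance of B_T. For
    the crossed products to be of the same order, the contraction is used twice: one factor is
    O(Delta) uniformly in the horizon, the other sums along its row to O(T^(2H-1)), and there are T
    / Delta rows. The sensitivity of K((. - x) / h) to the path costs a factor 1 / h, squared. *)

Lemma integral_nnsfun_limn d d' (T : measurableType d) (S : measurableType d')
  (R : realType) (m : {measure set T -> \bar R})
  (X : T -> S) (w : T -> R) (f : S -> \bar R) (mf : measurable_fun setT f) :
  measurable_fun setT X -> measurable_fun setT w -> (forall x, 0 <= w x) ->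
  (forall y, (0 <= f y)%E) ->
  let g := nnsfun_approx measurableT mf in
  (\int[m]_x (f (X x) * (w x)%:E) =
    limn (fun n => \sum_(k \in range (g n))
      k%:E * \int[m]_x (\1_(g n @^-1` [set k]) (X x) * w x)%:E))%E.
Proof.
move=> mX mw w0 f0 g.
have mgX n : measurable_fun setT (fun x => ((g n (X x)) * w x)%:E).
  apply/measurable_EFinP/measurable_funM => //.
  exact: (measurableT_comp (measurable_funPT _) mX).
transitivity (\int[m]_x limn (fun n => ((g n (X x)) * w x)%:E))%E.
  apply: eq_integral => x _; apply/esym/cvg_lim => //.
  under eq_fun do rewrite EFinM.
  apply: cvgeZr => //.
  exact: (@cvg_nnsfun_approx _ _ _ _ measurableT _ mf (fun y _ => f0 y)).
rewrite monotone_convergence//; last 2 first.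
- by move=> n x _; rewrite lee_fin mulr_ge0.
- move=> x _ a b ab; rewrite lee_fin ler_wpM2r//.
  by have /lefP := @nd_nnsfun_approx _ _ _ _ measurableT _ mf _ _ ab; exact.
congr (limn _); apply/funext => n.
transitivity (\int[m]_x (\sum_(k \in range (g n))
  k%:E * (\1_(g n @^-1` [set k]) (X x) * w x)%:E))%E.
  apply: eq_integral => x _; rewrite EFinM fimfunE -fsumEFin//.
  rewrite ge0_mule_fsuml; last first.
    by move=> k; rewrite EFinM; exact: nnfun_muleindic_ge0.
  by apply: eq_fsbigr => k _; rewrite -!EFinM mulrA.
have mk (k : R) : measurable_fun setT (fun x => (\1_(g n @^-1` [set k]) (X x) * w x)%:E).
  apply/measurable_EFinP/measurable_funM => //.
  exact: (measurableT_comp (measurable_indic (measurable_funPTI _ (measurable_set1 _))) mX).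
rewrite ge0_integral_fsum//.
- apply: eq_fsbigr => k /[!inE] -[y _ <-].
  rewrite ge0_integralZl//; first by move=> x _; rewrite lee_fin mulr_ge0.
  by rewrite lee_fin.
- by move=> k; apply: measurable_funeM.
- move=> k x _; rewrite EFinM muleA mule_ge0 ?lee_fin//.
  exact: nnfun_muleindic_ge0.
Qed.

(** Agreement on indicators passes to simple functions and then, by monotone convergence along
    [nnsfun_approx], to every nonnegative f. The weights let a change of density be treated like an
    equality of laws. *)
Lemma eq_integral_weighted d1 d2 d3 (T1 : measurableType d1)
  (T2 : measurableType d2) (S : measurableType d3) (R : realType)
  (m1 : {measure set T1 -> \bar R}) (m2 : {measure set T2 -> \bar R})
  (X1 : T1 -> S) (X2 : T2 -> S) (w1 : T1 -> R) (w2 : T2 -> R) :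
  measurable_fun setT X1 -> measurable_fun setT X2 ->
  measurable_fun setT w1 -> measurable_fun setT w2 ->
  (forall x, 0 <= w1 x) -> (forall x, 0 <= w2 x) ->
  (forall A, measurable A ->
    \int[m1]_x (\1_A (X1 x) * w1 x)%:E = \int[m2]_x (\1_A (X2 x) * w2 x)%:E)%E ->
  forall f : S -> \bar R, measurable_fun setT f -> (forall x, 0 <= f x)%E ->
  (\int[m1]_x (f (X1 x) * (w1 x)%:E) = \int[m2]_x (f (X2 x) * (w2 x)%:E))%E.
Proof.
move=> mX1 mX2 mw1 mw2 w10 w20 H f mf f0.
rewrite (integral_nnsfun_limn m1 mf)// (integral_nnsfun_limn m2 mf)//.
congr (limn _); apply/funext => n; apply: eq_fsbigr => k _.
by rewrite H.
Qed.

End weighted.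

(** * Expectations of real random variables *)

Section bounded_expectation.
Context d (T : measurableType d) (R : realType) (P : probability T R).

Definition Ex (f : T -> R) : R := \int[P]_w f w.
Definition intg (f : T -> R) : Prop := P.-integrable setT (EFin \o f).

Lemma probability_integral_cst (c : \bar R) : (\int[P]_w c = c)%E.
Proof.
rewrite integral_cst//; transitivity (c * 1)%E; last by rewrite mule1.
by congr (_ * _)%E; exact: probability_setT.
Qed.

Lemma bounded_intg (f : T -> R) (M : R) : measurable_fun setT f ->
  (forall w, `|f w| <= M) -> intg f.
Proof.
move=> mf fM; apply: measurable_bounded_integrable => //.
  by rewrite -ge0_fin_numE// fin_num_measure.
exists M; split; first exact: num_real.
by move=> y My w _ /=; exact: (le_trans (fM w) (ltW My)).
Qed.

Lemma intgM (f : T -> R) : intg f -> measurable_fun setT f.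
Proof. by move=> /integrableP[/measurable_EFinP]. Qed.

Lemma intg_fin (f : T -> R) : intg f -> (\int[P]_w (f w)%:E)%E \is a fin_num.
Proof. exact: integrable_fin_num. Qed.

Lemma ExE (f : T -> R) : intg f -> (\int[P]_w (f w)%:E)%E = (Ex f)%:E.
Proof. by move=> /intg_fin/fineK <-. Qed.

Lemma intgD (f g : T -> R) : intg f -> intg g -> intg (fun w => f w + g w).
Proof. by move=> fi gi; apply: (integrableD measurableT fi gi). Qed.

Lemma intgB (f g : T -> R) : intg f -> intg g -> intg (fun w => f w - g w).
Proof. by move=> fi gi; apply: (integrableB measurableT fi gi). Qed.

Lemma intgZ (k : R) (f : T -> R) : intg f -> intg (fun w => k * f w).
Proof. by move=> fi; apply: (integrableZl measurableT k fi). Qed.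

Lemma intgS (n : nat) (F : nat -> T -> R) : (forall i, (i < n)%N -> intg (F i)) ->
  intg (fun w => \sum_(i < n) F i w).
Proof.
move=> Fi; rewrite /intg; have -> : EFin \o (fun w => \sum_(i < n) F i w) =
    fun w => (\sum_(i < n) (F i w)%:E)%E.
  by apply/funext => w /=; rewrite sumEFin.
by apply: integrable_sum => // i _; exact: Fi.
Qed.

Lemma ExD (f g : T -> R) : intg f -> intg g -> Ex (fun w => f w + g w) = Ex f + Ex g.
Proof. exact: RintegralD. Qed.

Lemma ExB (f g : T -> R) : intg f -> intg g -> Ex (fun w => f w - g w) = Ex f - Ex g.
Proof. exact: RintegralB. Qed.

Lemma ExZ (k : R) (f : T -> R) : intg f -> Ex (fun w => k * f w) = k * Ex f.
Proof. exact: RintegralZl. Qed.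

Lemma Ex_cst (c : R) : Ex (fun=> c) = c.
Proof. rewrite /Ex Rintegral_cst// (_ : fine _ = 1) ?mulr1//.
transitivity (fine (1%E : \bar R)) => //; congr fine; exact: probability_setT. Qed.

Lemma ExS (n : nat) (F : nat -> T -> R) : (forall i, (i < n)%N -> intg (F i)) ->
  Ex (fun w => \sum_(i < n) F i w) = \sum_(i < n) Ex (F i).
Proof.
elim: n => [|n IH] Fi.
  by rewrite big_ord0 -[RHS](Ex_cst 0); congr Ex; apply/funext => w; rewrite big_ord0.
rewrite big_ord_recr/= -IH; last by move=> i ni; apply: Fi; rewrite ltnS ltnW.
rewrite -ExD; last 2 first.
- by apply: intgS => i ni; apply: Fi; rewrite ltnS ltnW.
- exact: Fi.
by congr Ex; apply/funext => w; rewrite big_ord_recr.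
Qed.

Lemma le_Ex (f g : T -> R) : intg f -> intg g -> (forall w, f w <= g w) -> Ex f <= Ex g.
Proof. by move=> fi gi fg; apply: le_Rintegral => // w _; exact: fg. Qed.

Lemma norm_Ex_le (f g : T -> R) : intg f -> intg g -> (forall w, `|f w| <= g w) ->
  `|Ex f| <= Ex g.
Proof.
move=> fi gi fg; apply: (le_trans (le_normr_Rintegral measurableT fi)).
have fi' : intg (fun w => `|f w|) by exact: (integrable_abse fi).
exact: le_Ex fi' gi fg.
Qed.

Lemma Ex_bounded_cvg (f_ : nat -> T -> R) (f : T -> R) (M : R) :
  (forall n, measurable_fun setT (f_ n)) -> measurable_fun setT f ->
  (forall n w, `|f_ n w| <= M) -> (forall w, f_ n w @[n --> \oo] --> f w) ->
  Ex (f_ n) @[n --> \oo] --> Ex f.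
Proof.
move=> mf_ mf fM f_f.
have [] := @dominated_convergence _ T R P setT measurableT
  (fun n w => (f_ n w)%:E) (EFin \o f) (cst M%:E).
- by move=> n; exact/measurable_EFinP.
- exact/measurable_EFinP.
- by apply/aeW => w _; apply: cvg_EFin; [exact: nearW|exact: f_f].
- exact: (@bounded_intg (cst M) `|M|).
- by apply/aeW => w n _; rewrite /= lee_fin fM.
move=> fi _; rewrite -[X in _ --> X -> _](fineK (intg_fin fi)).
exact: fine_cvg.
Qed.

End bounded_expectation.
Arguments bounded_intg {d T R P f} M.

(** * Polynomials converging to a step function *)

Section step_polynomials.
Context {R : realType}.
Implicit Types (x y r : R) (n k : nat).

Lemma bernoulli_le y k : 0 <= y <= 1 -> 1 - k%:R * y <= (1 - y) ^+ k.
Proof.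
move=> /andP[y0 y1]; elim: k => [|k IH]; first by rewrite expr0; lra.
rewrite exprS; have : (1 - y) * (1 - k%:R * y) <= (1 - y) * (1 - y) ^+ k.
  by apply: ler_wpM2l => //; lra.
apply: le_trans; rewrite -natr1; have : 0 <= k%:R * y * y by rewrite !mulr_ge0.
by lra.
Qed.

(** Serves where k y is large: it forces (1 - y)^k to 0 at the rate 1 / (1 + k y). *)
Lemma bernoulli_ge y k : 0 <= y <= 1 -> (1 - y) ^+ k * (1 + k%:R * y) <= 1.
Proof.
move=> /andP[y0 y1]; elim: k => [|k IH]; first by rewrite expr0; lra.
apply: le_trans IH; rewrite exprSr -mulrA ler_wpM2l ?exprn_ge0//; first by lra.
by rewrite -natr1; have : 0 <= k%:R * y * y by [rewrite !mulr_ge0]; nra.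
Qed.

(** After division by 1 - r this compares n r^n with the geometric sum 1 + ... + r^(n-1), whose
    terms are all at least r^n. *)
Lemma nexpr_le r n : 0 <= r <= 1 -> n%:R * (1 - r) * r ^+ n <= 1 - r ^+ n.
Proof.
move=> /andP[r0 r1]; elim: n => [|n IH]; first by rewrite expr0 !mul0r subrr.
have H0 : 0 <= r ^+ n by rewrite exprn_ge0.
have H1 : r ^+ n <= 1 by rewrite exprn_ile1.
rewrite exprS -natr1; move: IH; set a := n%:R; set e := r ^+ n => IH.
have : r * (a * (1 - r) * e) <= r * (1 - e) by rewrite ler_wpM2l.
have : 0 <= (1 - r) * (1 - r * e) by rewrite mulr_ge0 ?subr_ge0 ?mulr_ile1.
by nra.
Qed.

(** As in elementary proofs of the Stone-Weierstrass theorem, the two exponents are tuned so that n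
    4^n x^(2n) = n (2x)^(2n) tends to 0 below 1/2 and to infinity from 1/2 on; Bernoulli's
    inequalities then give the limits 1 and 0. *)
Definition step_seq n x : R := (1 - x ^+ n.*2) ^+ (n * 4 ^ n).

Lemma step_seq_itv n x : 0 <= x <= 1 -> 0 <= step_seq n x <= 1.
Proof.
move=> /andP[x0 x1]; have H1 : x ^+ n.*2 <= 1 by rewrite exprn_ile1.
have H0 : 0 <= x ^+ n.*2 by rewrite exprn_ge0.
by rewrite /step_seq exprn_ge0 ?exprn_ile1//; lra.
Qed.

Lemma step_seq_arg n x :
  (n * 4 ^ n)%:R * x ^+ n.*2 = n%:R * ((2 * x) ^+ n * (2 * x) ^+ n).
Proof.
rewrite natrM natrX -mul2n exprM -mulrA -!exprMn; congr (_ * _ ^+ _).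
by rewrite expr2; ring.
Qed.

Lemma step_seq_cvg1 x : 0 <= x < 1 / 2 -> step_seq n x @[n --> \oo] --> (1 : R).
Proof.
move=> /andP[x0 x1]; pose r := 2 * x.
have r0 : 0 <= r by rewrite /r; lra.
have r1 : r < 1 by rewrite /r; lra.
apply: (@squeeze_cvgr _ _ _ _ (fun n => 1 - (1 - r)^-1 * r ^+ n) (fun=> 1)).
- apply: nearW => n; have x01 : 0 <= x <= 1 by lra.
  rewrite (andP (step_seq_itv n x01)).2 andbT.
  apply: le_trans (bernoulli_le _ _); last first.
    by rewrite exprn_ge0//= exprn_ile1//; lra.
  rewrite lerD2l lerN2 step_seq_arg -/r mulrA ler_wpM2r ?exprn_ge0//.
  rewrite -[leRHS]mul1r ler_pdivlMr ?subr_gt0// mulrAC.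
  apply: (le_trans (@nexpr_le r n _)); first by rewrite r0 ltW.
  by rewrite lerBlDl lerDr exprn_ge0.
- rewrite -[X in _ --> X]subr0 -[X in _ --> _ - X](mulr0 (1 - r)^-1).
  apply: cvgB; first exact: cvg_cst.
  by apply: cvgMl_tmp; apply: cvg_expr; rewrite ger0_norm.
- exact: cvg_cst.
Qed.

(** At x = 1/2 the quantity n (2x)^(2n) equals n, so the threshold itself is sent to 0. This is why
    the strict inequalities sin < t and Z < l come out below. *)
Lemma step_seq_cvg0 x : 1 / 2 <= x <= 1 -> step_seq n x @[n --> \oo] --> (0 : R).
Proof.
move=> /andP[x0 x1].
apply: (@squeeze_cvgr _ _ _ _ (fun=> 0) (fun n => (1 + n%:R)^-1)).
- apply: nearW => n; have x01 : 0 <= x <= 1 by lra.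
  rewrite (andP (step_seq_itv n x01)).1 /=.
  rewrite -[leRHS]mul1r ler_pdivlMr; last by rewrite ltr_pwDl.
  apply: le_trans (@bernoulli_ge (x ^+ n.*2) (n * 4 ^ n) _); last first.
    by rewrite exprn_ge0/= ?exprn_ile1//; lra.
  rewrite ler_wpM2l//; first by rewrite (andP (step_seq_itv n x01)).1.
  rewrite lerD2l step_seq_arg ler_peMr// mulr_ege1// exprn_ege1//; lra.
- exact: cvg_cst.
- under eq_fun do rewrite addrC natr1.
  exact: cvg_harmonic.
Qed.

End step_polynomials.

Lemma cos_prod (R : realType) (x y : R) :
  cos x * cos y = (1 / 2) * (cos (x + y) + cos (x - y)).
Proof. by rewrite cosD cosB; field. Qed.

(** Controlling df on the symmetric interval lets one bound serve for both signs of z and be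
    iterated from one Taylor remainder to the next. *)
Lemma le_norm_MVT (R : realType) (f df : R -> R) (C z : R) :
  (forall y : R, is_derive y (1 : R) f (df y)) ->
  (forall y, `|y| <= `|z| -> `|df y| <= C) -> `|f z - f 0| <= C * `|z|.
Proof.
move=> fdf dfC; have cf (a b : R) : {within `[a, b], continuous f}.
  by apply: derivable_within_continuous => y _; have [] := fdf y.
have [z0|z0] := leP 0 z.
  have [c /[!in_itv]/= /andP[c0 cz] ->] :=
    @MVT_segment _ f df 0 z z0 (fun y _ => fdf y) (cf _ _).
  by rewrite subr0 normrM ler_wpM2r// dfC// !ger0_norm.
have [c /[!in_itv]/= /andP[c0 cz] E] :=
  @MVT_segment _ f df z 0 (ltW z0) (fun y _ => fdf y) (cf _ _).
rewrite distrC E sub0r normrM normrN ler_wpM2r// dfC// !ler0_norm// ?lerN2//.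
exact: ltW.
Qed.

Lemma sin_approx (R : realType) (x : R) : `|sin x - x| <= x ^+ 2.
Proof.
have cosB1 (y : R) : `|cos y - 1| <= `|y|.
  rewrite -[X in _ - X]cos0 -[leRHS]mul1r.
  apply: (le_norm_MVT (df := fun y => - sin y)) => z _.
  by rewrite normrN sin_max.
have dsin (y : R) : is_derive y (1 : R) (fun y => sin y - y) (cos y - 1).
  exact: is_deriveB.
have := le_norm_MVT (C := `|x|) (z := x) dsin.
rewrite sin0 !subr0 -normrM -expr2 (ger0_norm (sqr_ge0 _)); apply.
by move=> y yx; rewrite (le_trans (cosB1 y)).
Qed.

(** * Uniqueness of the cosine transform on the line *)

Section fourier.
Context d (T : measurableType d) (R : realType) (P : probability T R).
Context (Z rho : T -> R) (M : R).
Hypotheses (mZ : measurable_fun setT Z) (mrho : measurable_fun setT rho).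
Hypothesis rhoM : forall w, `|rho w| <= M.
Hypothesis H : forall th a, Ex P (fun w => cos (th + a * Z w) * rho w) = 0.

Local Notation Ex := (Ex P).
Local Notation intg := (intg P).

Let mcosZ th a : measurable_fun setT (fun w => cos (th + a * Z w)).
Proof.
apply: (measurableT_comp (continuous_measurable_fun (@continuous_cos R))).
by apply: measurable_funD => //; exact: measurable_funM.
Qed.

Let intgrho (f : T -> R) (C : R) : measurable_fun setT f ->
  (forall w, `|f w| <= C) -> intg (fun w => f w * rho w).
Proof.
move=> mf fC; apply: (bounded_intg (C * M)).
- exact: measurable_funM.
- by move=> w; rewrite normrM ler_pM.
Qed.

(** A product of two cosines is half a sum of cosines with other phases and frequencies, so the
    induction on k keeps th and a general. *)
Lemma fourier_cos_pow th a ph b k :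
  Ex (fun w => cos (th + a * Z w) * cos (ph + b * Z w) ^+ k * rho w) = 0.
Proof.
elim: k th a => [|k IH] th a.
  by rewrite -[RHS](H th a); congr Ex; apply/funext => w; rewrite expr0 mulr1.
have I th' a' : intg (fun w => cos (th' + a' * Z w) * cos (ph + b * Z w) ^+ k * rho w).
  apply: (@intgrho _ 1).
    by apply: measurable_funM => //; exact: measurable_funX.
  by move=> w; rewrite normrM normrX mulr_ile1 ?exprn_ile1 ?exprn_ge0 ?cos_max.
transitivity (Ex (fun w => (1 / 2) *
  (cos ((th + ph) + (a + b) * Z w) * cos (ph + b * Z w) ^+ k * rho w +
   cos ((th - ph) + (a - b) * Z w) * cos (ph + b * Z w) ^+ k * rho w))).
  congr Ex; apply/funext => w; rewrite exprS mulrA cos_prod.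
  have -> : th + a * Z w + (ph + b * Z w) = th + ph + (a + b) * Z w by ring.
  have -> : th + a * Z w - (ph + b * Z w) = th - ph + (a - b) * Z w by ring.
  by ring.
by rewrite ExZ ?ExD ?IH ?addr0 ?mulr0//; exact: intgD.
Qed.

Lemma fourier_poly (p : {poly R}) ph b :
  Ex (fun w => p.[cos (ph + b * Z w)] * rho w) = 0.
Proof.
transitivity (Ex (fun w => \sum_(i < size p)
    p`_i * (cos (0 + 0 * Z w) * cos (ph + b * Z w) ^+ i * rho w))).
  congr Ex; apply/funext => w; rewrite horner_coef big_distrl/=.
  by apply: eq_bigr => i _; rewrite add0r mul0r cos0 mul1r mulrA.
have I i : intg (fun w => cos (0 + 0 * Z w) * cos (ph + b * Z w) ^+ i * rho w).
  apply: (@intgrho _ 1).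
    by apply: measurable_funM => //; exact: measurable_funX.
  by move=> w; rewrite normrM normrX mulr_ile1 ?exprn_ile1 ?exprn_ge0 ?cos_max.
rewrite (@ExS _ _ _ P _ (fun i w => p`_i *
  (cos (0 + 0 * Z w) * cos (ph + b * Z w) ^+ i * rho w))).
  by rewrite big1// => i _; rewrite ExZ// fourier_cos_pow mulr0.
by move=> i _; exact: intgZ.
Qed.

Lemma fourier_sin_lt (b t : R) : `|t| <= 1 ->
  Ex (fun w => (sin (b * Z w) < t)%R%:R * rho w) = 0.
Proof.
(* The affine map q sends t to 1/2 and [-1, 1] into [0, 1]: as |sin - t| <= 2, the slope 1/4
   suffices. The sine is obtained as a cosine with phase - pi / 2. *)
move=> t1; pose q : {poly R} := (1 / 2 - t / 4)%:P + (1 / 4) *: 'X.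
pose p n : {poly R} := (1 - q ^+ n.*2) ^+ (n * 4 ^ n).
have msin : measurable_fun setT (fun w => sin (b * Z w)).
  apply: (measurableT_comp (continuous_measurable_fun (@continuous_sin R))).
  exact: measurable_funM.
have pE n w : (p n).[cos (- (pi / 2) + b * Z w)] = step_seq n (1 / 2 + (sin (b * Z w) - t) / 4).
  by rewrite /p /step_seq [- (pi / 2) + _]addrC cosBpihalf !hornerE/=; congr ((1 - _ ^+ _) ^+ _); field.
have arg01 w : 0 <= 1 / 2 + (sin (b * Z w) - t) / 4 <= 1.
  have := sin_le1 (b * Z w); have := sin_geN1 (b * Z w).
  by move: t1; rewrite ler_norml => /andP[]; lra.
have mstep n : measurable_fun setT (fun w => step_seq n (1 / 2 + (sin (b * Z w) - t) / 4)).
  apply: measurable_funX; apply: measurable_funB => //; apply: measurable_funX.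
  apply: measurable_funD => //; apply: measurable_funM => //.
  exact: measurable_funB.
have mlt : measurable_fun setT (fun w => (sin (b * Z w) < t)%R%:R : R).
  have -> : (fun w => (sin (b * Z w) < t)%R%:R : R) = \1_(`]-oo, t[) \o (fun w => sin (b * Z w)).
    by apply/funext => w /=; rewrite indicE mem_setE in_itv.
  exact: (measurableT_comp (measurable_indic _)).
have : Ex (fun w => (p n).[cos (- (pi / 2) + b * Z w)] * rho w) @[n --> \oo] -->
    Ex (fun w => (sin (b * Z w) < t)%R%:R * rho w).
  apply: (@Ex_bounded_cvg _ _ _ _ _ _ M).
  - by move=> n; apply: measurable_funM => //; rewrite (funext (pE n)); exact: mstep.
  - exact: measurable_funM.
  - move=> n w; rewrite pE normrM -[leRHS]mul1r ler_pM//.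
    by have /andP[? ?] := step_seq_itv n (arg01 w); rewrite ger0_norm.
  - move=> w; apply: cvgMr_tmp; under eq_fun do rewrite pE.
    have [lt|ge] := ltP (sin (b * Z w)) t.
      by apply: step_seq_cvg1; have := arg01 w; lra.
    by apply: step_seq_cvg0; have := arg01 w; lra.
under eq_fun do rewrite fourier_poly.
by move=> /(cvg_unique (@norm_hausdorff _ _)); apply; exact: cvg_cst.
Qed.

(** A half-line is seen through sin (b Z) < t with frequency b tending to 0, since for small b the
    sine is nearly linear at the given value of Z. *)
Lemma fourier_lt (l : R) : Ex (fun w => (Z w < l)%R%:R * rho w) = 0.
Proof.
(* With N = 1 / (n + 1), the sine differs from b Z by at most b N^2 Z^2, while t lies b N below b l:
   this margin eventually exceeds the error, also when Z w = l. *)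
pose b (n : nat) : R := (n.+1%:R ^+ 2)^-1.
pose t (n : nat) : R := b n * (l - n.+1%:R^-1).
have b0 n : 0 < b n by rewrite invr_gt0 exprn_gt0.
have mlt (f : T -> R) (c : R) : measurable_fun setT f ->
    measurable_fun setT (fun w => (f w < c)%R%:R : R).
  move=> mf.
  have -> : (fun w => (f w < c)%R%:R : R) = \1_(`]-oo, c[) \o f.
    by apply/funext => w /=; rewrite indicE mem_setE in_itv.
  exact: (measurableT_comp (measurable_indic _)).
have : Ex (fun w => (sin (b n * Z w) < t n)%R%:R * rho w) @[n --> \oo] -->
    Ex (fun w => (Z w < l)%R%:R * rho w).
  apply: (@Ex_bounded_cvg _ _ _ _ _ _ M).
  - move=> n; apply: measurable_funM => //; apply: mlt.
    apply: (measurableT_comp (continuous_measurable_fun (@continuous_sin R))).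
    exact: measurable_funM.
  - by apply: measurable_funM => //; exact: mlt.
  - by move=> n w; rewrite normrM -[leRHS]mul1r ler_pM//; case: (_ < _); rewrite ?normr1 ?normr0.
  - move=> w; apply: cvgMr_tmp; apply: cvg_near_cst.
    have small (e : R) : 0 < e -> \forall n \near \oo, (Z w ^+ 2 + 1) * n.+1%:R^-1 < e.
      move=> e0; have : (Z w ^+ 2 + 1) * harmonic n @[n --> \oo] --> (Z w ^+ 2 + 1) * (0 : R).
        by apply: cvgMl_tmp; exact: cvg_harmonic.
      by rewrite mulr0 => /cvgr_lt; exact.
    have N0 n : 0 < n.+1%:R^-1 :> R by rewrite invr_gt0.
    have N1 n : n.+1%:R^-1 <= 1 :> R by rewrite invf_le1 ?ler1n.
    have bE n : b n = n.+1%:R^-1 ^+ 2 by rewrite /b exprVn.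
    have sinb n : `|sin (b n * Z w) - b n * Z w| <= b n * (b n * Z w ^+ 2).
      by apply: le_trans (sin_approx _) _; rewrite exprMn expr2 mulrA.
    have [lt|ge] := ltP (Z w) l.
      near=> n; rewrite /t.
      suff -> : sin (b n * Z w) < b n * (l - n.+1%:R^-1) by [].
      have : (Z w ^+ 2 + 1) * n.+1%:R^-1 < l - Z w.
        by near: n; apply: small; rewrite subr_gt0.
      have := sinb n; rewrite ler_norml => /andP[_].
      rewrite lerBlDr => /le_lt_trans + small_n; apply.
      rewrite -mulrDr ltr_pM2l// bE.
      have := N0 n; have := N1 n; move: small_n; set N := n.+1%:R^-1; set z := Z w.
      move=> h1 h2 h3; have : 0 <= z ^+ 2 * N * (1 - N).
        by rewrite mulr_ge0 ?subr_ge0// mulr_ge0 ?sqr_ge0// ltW.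
      by lra.
    near=> n; rewrite /t.
    suff : b n * (l - n.+1%:R^-1) <= sin (b n * Z w) by rewrite leNgt => /negbTE ->.
    have : (Z w ^+ 2 + 1) * n.+1%:R^-1 < 1.
      by near: n; exact: small.
    have := sinb n; rewrite ler_norml => /andP[+ _].
    rewrite lerBrDr => h0 small_n; apply: le_trans h0.
    rewrite [leRHS]addrC -mulrBr ler_pM2l// bE.
    have := N0 n; have := N1 n; move: ge small_n; set N := n.+1%:R^-1; set z := Z w.
    move=> ge h1 h2 h3; have : 0 <= N * (1 - (z ^+ 2 + 1) * N).
      by rewrite mulr_ge0 ?subr_ge0// ltW.
    by have := sqr_ge0 N; lra.
have t1 : \forall n \near \oo, `|t n| <= 1.
  have : (`|l| + 1) * harmonic n @[n --> \oo] --> (`|l| + 1) * (0 : R).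
    by apply: cvgMl_tmp; exact: cvg_harmonic.
  rewrite mulr0 => /cvgr_le/(_ 1 ltr01); apply: filterS => n hn.
  have N0 : 0 < n.+1%:R^-1 :> R by rewrite invr_gt0.
  have N1 : n.+1%:R^-1 <= 1 :> R by rewrite invf_le1 ?ler1n.
  apply: le_trans hn; rewrite normrM mulrC ler_pM//.
    by apply: (le_trans (ler_normB _ _)); rewrite lerD2l ger0_norm// ltW.
  by rewrite ger0_norm ?(ltW (b0 n))// /b -exprVn expr2 ler_piMl// ltW.
move=> h1; apply: (cvg_unique (@norm_hausdorff _ _) h1).
apply: cvg_near_cst; apply: filterS t1 => n tn.
exact: fourier_sin_lt.
Unshelve. all: by end_near. Qed.

(** Half-lines are a pi-system generating the Borel sets, and the sets of mass 0 for the signed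
    measure with density [rho], transported by Z, form a Dynkin system. *)
Lemma fourier_indic (A : set R) : measurable A -> Ex (fun w => \1_A (Z w) * rho w) = 0.
Proof.
have mI (B : set R) : measurable B -> measurable_fun setT (fun w => \1_B (Z w) : R).
  by move=> mB; exact: (measurableT_comp (measurable_indic _)).
have iI (B : set R) : measurable B -> intg (fun w => \1_B (Z w) * rho w).
  move=> mB; apply: (@intgrho _ 1); first exact: mI.
  by move=> w; rewrite indicE; case: (_ \in _); rewrite ?normr1 ?normr0.
have rho0 : Ex rho = 0.
  by rewrite -(H 0 0); congr Ex; apply/funext => w; rewrite mul0r addr0 cos0 mul1r.
have irho : intg rho by exact: (bounded_intg M).
move=> mA0; have mA : (@RGenInftyO.G R).-sigma.-measurable A.
  by rewrite -RGenInftyO.measurableE.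
apply: (@dynkin_induction _ _ (@RGenInftyO.G R)
  (fun A => Ex (fun w => \1_A (Z w) * rho w) = 0)) mA.
- exact: RGenInftyO.measurableE.
- move=> _ _ [a ->] [b ->]; exists (Num.min a b).
  apply/seteqP; split => x /=; rewrite !in_itv/= lt_min; first by case=> -> ->.
  by move=> /andP[].
- by rewrite -rho0; congr Ex; apply/funext => w; rewrite indicT mul1r.
- move=> _ [l ->]; rewrite -(fourier_lt l); congr Ex; apply/funext => w.
  by rewrite indicE mem_setE in_itv.
- move=> B mB EB.
  have -> : (fun w => \1_(~` B) (Z w) * rho w) = (fun w => rho w - \1_B (Z w) * rho w).
    by apply/funext => w; rewrite !indicE in_setC; case: (_ \in _) => /=; ring.
  by rewrite ExB ?EB ?rho0 ?subr0//; exact: iI.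
- move=> F mF tF EF.
  have mUF : measurable (\bigcup_k F k) by exact: bigcupT_measurable.
  have : Ex (fun w => \sum_(i < n) (\1_(F i) (Z w) * rho w)) @[n --> \oo] -->
      Ex (fun w => \1_(\bigcup_k F k) (Z w) * rho w).
    (* Disjointness leaves at most one index k with [F k z], and the partial sums jump from 0 to 1
       just after it. *)
    have sumE n z : \sum_(i < n) \1_(F i) z =
        if pselect (exists k, F k z) is left e then (sval (cid e) < n)%:R else 0 :> R.
      case: pselect => [e|ne]; last first.
        rewrite big1// => i _; rewrite indicE (_ : (z \in F i) = false)//.
        by apply/negbTE/negP; rewrite inE => Fi; apply: ne; exists i.
      case: cid => k Fk /=; elim: n => [|n IH]; first by rewrite big_ord0 ltn0.
      rewrite big_ord_recr/= IH indicE.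
      have -> : (z \in F n) = (n == k).
        apply/idP/eqP => [|->]; last by rewrite inE.
        by rewrite inE => Fn; apply: tF => //; exists z.
      by rewrite ltnS; case: ltngtP => _; rewrite ?addr0 ?add0r.
    apply: (@Ex_bounded_cvg _ _ _ _ _ _ M).
    - move=> n; apply: (@intgM _ _ _ P).
      by apply: (@intgS _ _ _ P n (fun i w => \1_(F i) (Z w) * rho w)) => i _; exact: iI.
    - by apply: measurable_funM => //; exact: mI.
    - move=> n w; rewrite -big_distrl/= sumE normrM -[leRHS]mul1r ler_pM//.
      by case: pselect => [e|_]; [case: (_ < _)%N|]; rewrite ?normr1 ?normr0.
    - move=> w; under eq_fun do rewrite -big_distrl/= sumE.
      apply: cvgMr_tmp; apply: cvg_near_cst.
      case: pselect => [e|ne]; last first.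
        by apply: nearW => n; rewrite indicE memNset// => -[k _ Fk]; apply: ne; exists k.
      case: cid => k Fk /=; near=> n.
      rewrite indicE mem_set//; last by exists k.
      by rewrite (_ : (k < n)%N)//; near: n; exact: nbhs_infty_gt.
  move=> h1; apply: (cvg_unique (@norm_hausdorff _ _) h1).
  rewrite (_ : (fun n => _) = cst 0); first exact: cvg_cst.
  apply/funext => n; rewrite (@ExS _ _ _ P n (fun i w => \1_(F i) (Z w) * rho w)).
    by rewrite big1.
  by move=> i _; exact: iI.
Unshelve. all: by end_near. Qed.
End fourier.

(** * Taylor remainders, and derivatives read off quadratic bounds *)

Section taylor.
Context {R : realType}.
Implicit Types (x y z th : R).

Lemma expRB1_le z : `|expR z - 1| <= `|z| * expR `|z|.
Proof.
rewrite -[X in _ - X]expR0 mulrC; apply: (le_norm_MVT (df := expR)) => y.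
by move=> yz; rewrite ger0_norm ?expR_ge0// ler_expR (le_trans (ler_norm _)).
Qed.

Lemma expRB1D_le z : `|expR z - 1 - z| <= `|z| ^+ 2 * expR `|z|.
Proof.
have := @le_norm_MVT _ (fun y => expR y - 1 - y) (fun y => expR y - 1) (`|z| * expR `|z|) z.
rewrite expR0 subrr !subr0 mulrAC -expr2; apply.
- move=> y; apply: is_derive_eq; by rewrite subr0.
- move=> y yz; apply: (le_trans (expRB1_le _)).
  by rewrite ler_pM// ?expR_ge0// ler_expR.
Qed.

Lemma expRB1DX_le z : `|expR z - 1 - z - z ^+ 2 / 2| <= `|z| ^+ 3 * expR `|z|.
Proof.
have := @le_norm_MVT _ (fun y => expR y - 1 - y - y ^+ 2 / 2) (fun y => expR y - 1 - y)
  (`|z| ^+ 2 * expR `|z|) z.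
rewrite expR0 subrr expr0n/= mul0r !subr0.
have -> : `|z| ^+ 2 * expR `|z| * `|z| = `|z| ^+ 3 * expR `|z| by ring.
apply.
- move=> y; apply: is_derive_eq; by rewrite /GRing.scale/=; field.
- move=> y yz; apply: (le_trans (expRB1D_le _)).
  by rewrite ler_pM// ?expR_ge0 ?exprn_ge0// ?ler_expR// lerXn2r// ?nnegrE.
Qed.

Lemma cosD_approx th z : `|cos (th + z) - cos th + z * sin th| <= `|z| ^+ 2.
Proof.
have sinth y : `|sin (th + y) - sin th| <= `|y|.
  have := @le_norm_MVT _ (fun x => sin (th + x)) (fun x => cos (th + x)) 1 y.
  rewrite addr0 mul1r; apply.
  - move=> x; apply: is_derive_eq; by rewrite /GRing.scale/=; ring.
  - by move=> x _; rewrite cos_max.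
have := @le_norm_MVT _ (fun y => cos (th + y) + y * sin th)
  (fun y => - sin (th + y) + sin th) `|z| z.
rewrite addr0 mul0r addr0 -expr2 addrAC; apply.
- move=> x; apply: is_derive_eq; by rewrite /GRing.scale/=; ring.
- by move=> y yz; rewrite addrC distrC (le_trans (sinth _)).
Qed.

(** Tilting yields two-point expansions with an explicit quadratic remainder; this turns them into
    derivatives without differentiating under an expectation. *)
Lemma is_derive_quad (f : R -> R) (a D C : R) :
  (forall k, `|k| <= 1 -> `|f (a + k) - f a - k * D| <= C * k ^+ 2) ->
  is_derive a (1 : R) f D.
Proof.
move=> H; have C0 : 0 <= C.
  by have := le_trans (normr_ge0 _) (H 1 _); rewrite normr1 expr1n mulr1; apply.
have cvg : h^-1 *: (f (h *: (1 : R) + a) - f a) @[h --> 0^'] --> D.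
  apply/cvgrPdist_le => e e0; near=> h.
  have h0 : h != 0 by near: h; exact: nbhs_dnbhs_neq.
  have h1 : `|h| <= Num.min 1 (e / (C + 1)).
    near: h; apply: dnbhs0_le; rewrite lt_min ltr01 divr_gt0// ltr_wpDl//.
  rewrite le_min in h1; have {h1} /andP[h1 he] := h1.
  rewrite /GRing.scale/= mulr1 [h + a]addrC distrC.
  have -> : h^-1 * (f (a + h) - f a) - D = h^-1 * (f (a + h) - f a - h * D).
    by field.
  rewrite normrM normfV ler_pdivrMl ?normr_gt0//.
  apply: (le_trans (H _ h1)); rewrite -(real_normK (num_real h)) expr2 mulrCA ler_wpM2l//.
  apply: le_trans (_ : (C + 1) * `|h| <= _); first by rewrite ler_wpM2r// lerDl.
  by rewrite mulrC -ler_pdivlMr// ltr_wpDl.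
apply: DeriveDef; first by apply/cvg_ex; exists D.
exact/cvg_lim.
Unshelve. all: by end_near. Qed.

Lemma is_derive0_cst (f : R -> R) : (forall x : R, is_derive x (1 : R) f 0) ->
  forall x, f x = f 0.
Proof.
move=> H x; have := @le_norm_MVT _ f (cst 0) 0 x H.
rewrite mul0r => H0; apply/eqP; rewrite -subr_eq0 -normr_le0.
by apply: H0 => y _; rewrite normr0.
Qed.

(** The constant is 3!, from the term y^3 / 3! of the exponential series. Polynomial moments thus
    follow from exponential ones. *)
Lemma norm_exp_le (x : R) (k : nat) : (k <= 3)%N ->
  `|x| ^+ k * expR `|x| <= 6 * expR (2 * `|x|).
Proof.
move=> k3; have -> : 2 * `|x| = `|x| + `|x| by ring.
rewrite expRD mulrA ler_wpM2r ?expR_ge0//.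
have := normr_ge0 x; set y := `|x| => y0.
have := expR_ge1Dxn 0 y0; have := expR_ge1Dxn 1 y0; have := expR_ge1Dxn 2 y0.
rewrite !factS fact0; case: k k3 => [|[|[|[|]]]]// _; rewrite ?expr0 ?expr1;
  have := sqr_ge0 y; have : 0 <= y ^+ 3 by rewrite exprn_ge0.
all: rewrite !mulnE/=; lra.
Qed.

(** Used to compare the coefficients of two expansions in a: the error left after division by the
    leading power is O(a). *)
Lemma eq0_linear_bound (x C : R) : (forall a, 0 < a <= 1 -> `|x| <= C * a) -> x = 0.
Proof.
move=> H; apply/eqP; rewrite -normr_le0; apply/ler_addgt0Pl => e e0; rewrite addr0.
have C0 : 0 <= C by have := le_trans (normr_ge0 x) (H 1 _); rewrite mulr1; apply; rewrite ltr01 lexx.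
pose a := Num.min 1 (e / (C + 1)).
have ea : 0 < e / (C + 1) by rewrite divr_gt0// ltr_wpDl.
apply: le_trans (H a _) _.
  by rewrite lt_min ltr01 ea/= ge_min lexx.
apply: le_trans (_ : (C + 1) * (e / (C + 1)) <= _); last first.
  by rewrite mulrC divfK// gt_eqF// ltr_wpDl.
by apply: ler_pM => //; rewrite ?le_min ?ler01 ?(ltW ea) ?lerDl// ge_min lexx orbT.
Qed.

End taylor.

(** Both sides are measures in A of the same finite total mass, so Dynkin's argument applies;
    finiteness is what allows complements to be obtained by subtraction. *)
Lemma eq_weighted_pi d1 d2 d3 (T1 : measurableType d1)
  (T2 : measurableType d2) (S : measurableType d3) (R : realType)
  (m1 : {measure set T1 -> \bar R}) (m2 : {measure set T2 -> \bar R})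
  (X1 : T1 -> S) (X2 : T2 -> S) (w1 : T1 -> R) (w2 : T2 -> R) (G : set (set S)) :
  @measurable _ S = <<s G >> -> setI_closed G ->
  measurable_fun setT X1 -> measurable_fun setT X2 ->
  measurable_fun setT w1 -> measurable_fun setT w2 ->
  (forall x, 0 <= w1 x) -> (forall x, 0 <= w2 x) ->
  (\int[m1]_x (w1 x)%:E < +oo)%E ->
  (\int[m1]_x (w1 x)%:E = \int[m2]_x (w2 x)%:E)%E ->
  (forall A, G A ->
    \int[m1]_x (\1_A (X1 x) * w1 x)%:E = \int[m2]_x (\1_A (X2 x) * w2 x)%:E)%E ->
  forall A, measurable A ->
    (\int[m1]_x (\1_A (X1 x) * w1 x)%:E = \int[m2]_x (\1_A (X2 x) * w2 x)%:E)%E.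
Proof.
move=> SG GI mX1 mX2 mw1 mw2 w10 w20 w1fin w12 HG A mA.
have mI d (T : measurableType d) (X : T -> S) (w : T -> R) (B : set S) :
    measurable_fun setT X -> measurable_fun setT w -> measurable B ->
    measurable_fun setT (fun x => (\1_B (X x) * w x)%:E).
  move=> mX mw mB; apply/measurable_EFinP/measurable_funM => //.
  exact: (measurableT_comp (measurable_indic mB) mX).
have I0 d (T : measurableType d) (X : T -> S) (w : T -> R) (B : set S) :
    (forall x, 0 <= w x) -> forall x, (0%:E <= (\1_B (X x) * w x)%:E)%E.
  by move=> w0 x; rewrite lee_fin mulr_ge0.
have split d (T : measurableType d) (m : {measure set T -> \bar R}) (X : T -> S)
    (w : T -> R) (B : set S) : measurable_fun setT X -> measurable_fun setT w ->
    (forall x, 0 <= w x) -> measurable B -> (\int[m]_x (w x)%:E < +oo)%E ->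
    (\int[m]_x (\1_(~` B) (X x) * w x)%:E =
     \int[m]_x (w x)%:E - \int[m]_x (\1_B (X x) * w x)%:E)%E.
  move=> mX mw w0 mB wfin.
  have E : (\int[m]_x (w x)%:E =
    \int[m]_x (\1_(~` B) (X x) * w x)%:E + \int[m]_x (\1_B (X x) * w x)%:E)%E.
    rewrite -ge0_integralD//; last 4 first.
    - by move=> x _; exact: I0.
    - exact: mI (measurableC mB).
    - by move=> x _; exact: I0.
    - exact: mI.
    apply: eq_integral => x _; rewrite -EFinD !indicE in_setC; congr (_%:E).
    by case: (X x \in B) => /=; ring.
  rewrite E addeK// fin_numElt; apply/andP; split.
    by apply: lt_le_trans (integral_ge0 _ _) => // x _; exact: I0.
  apply: le_lt_trans wfin; apply: ge0_le_integral => //.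
  - by move=> x _; exact: I0.
  - exact: mI.
  - exact/measurable_EFinP.
  - by move=> x _; rewrite lee_fin ler_piMl.
have mA' := mA; rewrite SG in mA'.
apply: (dynkin_induction SG GI _ HG _ _ mA').
- by under eq_integral do rewrite indicT mul1r; under [RHS]eq_integral do rewrite indicT mul1r.
- by move=> B mB EB; rewrite !split// ?EB ?w12// -w12.
- move=> F mF tF EF.
  have U d (T : measurableType d) (m : {measure set T -> \bar R}) (X : T -> S)
    (w : T -> R) : measurable_fun setT X -> measurable_fun setT w ->
    (forall x, 0 <= w x) ->
    (\int[m]_x (\1_(\bigcup_k F k) (X x) * w x)%:E =
     \big[+%E/0%E]_(0 <= n <oo) \int[m]_x (\1_(F n) (X x) * w x)%:E)%E.
    move=> mX mw w0; rewrite -integral_nneseries//; last 2 first.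
    - by move=> n; exact: mI.
    - by move=> n x _; exact: I0.
    apply: eq_integral => x _; rewrite EFinM indic_bigcup// muleC.
    rewrite -nneseriesZl; first by apply: eq_eseriesr => n _; rewrite muleC EFinM.
    by move=> n _; rewrite lee_fin.
  rewrite !U//; apply: eq_eseriesr => n _; exact: EF.
Qed.

(** * Translation invariance of Lebesgue measure *)

Section translation.
Context {R : realType}.
Local Notation mu := (@lebesgue_measure R).

Lemma lebesgue_measure_shift (a : R) (A : set R) : measurable A ->
  pushforward mu ((fun x => x + a) : _ -> measurableTypeR R) A = mu A.
Proof.
move=> mA.
have mf : measurable_fun setT ((fun x => x + a) : R -> measurableTypeR R).
  exact: measurable_funD.
apply/esym/lebesgue_measure_unique => //= _ [[b c]] _ <-.
rewrite /pushforward.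
have -> : (fun x => x + a) @^-1` `]b, c] = `]b - a, c - a]%classic.
  by apply/seteqP; split => x /=; rewrite !in_itv/= ltrBlDr lerBrDr.
rewrite !lebesgue_measure_itv/= !lte_fin ltrD2r.
by case: ifP => // _; rewrite -!EFinB; congr _%:E; ring.
Qed.

Lemma ge0_integral_shift (a : R) (f : R -> \bar R) : measurable_fun setT f ->
  (forall x, 0 <= f x)%E -> (\int[mu]_x f (x + a)%R = \int[mu]_x f x)%E.
Proof.
move=> mf f0.
have ms : measurable_fun setT ((fun x => x + a) : R -> measurableTypeR R).
  exact: measurable_funD.
rewrite [RHS](_ : _ = \int[pushforward mu ((fun x => x + a)%R :
    _ -> measurableTypeR R)]_x f x)%E.
  by rewrite ge0_integral_pushforward//= preimage_setT.
by apply: eq_measure_integral => //= A mA _; rewrite lebesgue_measure_shift.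
Qed.

End translation.

(** * Tilting, moments and cosine transform of a Gaussian variable *)

Section gaussian_variable.
Context d (T : measurableType d) (R : realType) (P : probability T R).
Context (W : T -> R) (m s : R).
Hypotheses (mW : measurable_fun setT W) (s0 : s != 0).
Hypothesis lawW : forall A, measurable A -> P (W @^-1` A) = normal_prob m s A.
Local Notation mu := (@lebesgue_measure R).
Local Notation v := (s ^+ 2).
Local Notation Ex := (Ex P).
Local Notation intg := (intg P).

Lemma gaussian_integral (f : R -> \bar R) : measurable_fun setT f ->
  (forall x, 0 <= f x)%E ->
  (\int[P]_w f (W w) = \int[mu]_x (f x * (normal_pdf m s x)%:E))%E.
Proof.
move=> mf f0.
transitivity (\int[P]_w (f (W w) * (cst 1 w)%:E))%E.
  by apply: eq_integral => w _; rewrite mule1.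
apply: (eq_integral_weighted (X2 := id)) => //.
- exact: measurable_normal_pdf.
- by move=> x; exact: normal_pdf_ge0.
- move=> A mA; transitivity (P (W @^-1` A)).
    rewrite -[X in P X]setIT -integral_indic//; last first.
      by rewrite -[_ @^-1` _]setTI; exact: mW.
    by apply: eq_integral => w _; rewrite mulr1.
  rewrite lawW// /normal_prob [LHS]integral_mkcond; apply: eq_integral => x _.
  by rewrite epatch_indic/= muleC EFinM.
Qed.

(** Completing the square: exp(t x) times the density is a constant times the density translated by
    t v. The moments and the cosine transform below derive from this identity. *)
Lemma gaussian_tilt (t : R) (f : R -> \bar R) : measurable_fun setT f ->
  (forall x, 0 <= f x)%E ->
  (\int[P]_w (f (W w) * (expR (t * W w))%:E) =
   (expR (t * m + t ^+ 2 * v / 2))%:E * \int[P]_w f (W w + t * v)%R)%E.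
Proof.
move=> mf f0.
have mexp : measurable_fun setT (fun x : R => expR (t * x)).
  by apply: measurableT_comp => //; exact: measurable_funM.
rewrite (@gaussian_integral (fun x => f x * (expR (t * x))%:E)%E); last 2 first.
- by apply: emeasurable_funM => //; exact/measurable_EFinP.
- by move=> x; rewrite mule_ge0// lee_fin expR_ge0.
rewrite (@gaussian_integral (fun x => f (x + t * v)%R)); last 2 first.
- by apply: measurableT_comp => //; exact: measurable_funD.
- by [].
have mpdf := measurable_normal_pdf m s.
rewrite -ge0_integralZl ?lee_fin ?expR_ge0//=; last 2 first.
- apply: emeasurable_funM; last exact/measurable_EFinP.
  by apply: measurableT_comp => //; exact: measurable_funD.
- by move=> x _; rewrite mule_ge0// lee_fin normal_pdf_ge0.
rewrite -(@ge0_integral_shift _ (t * v) (fun x => _ * _)%E).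
- apply: eq_integral => x _.
  rewrite /= -muleA -EFinM [RHS]muleCA -EFinM; congr (_ * _%:E)%E.
  rewrite normal_pdfE//= mulrCA [RHS]mulrCA; congr (_ * _).
  rewrite /normal_fun -!expRD; congr expR; field.
  by rewrite s0.
- by apply: emeasurable_funM; [apply: emeasurable_funM => //|]; exact/measurable_EFinP.
- by move=> x; rewrite !mule_ge0// lee_fin ?expR_ge0 ?normal_pdf_ge0.
Qed.

Lemma le_intg (f g : T -> R) : measurable_fun setT f -> intg g ->
  (forall w, `|f w| <= g w) -> intg f.
Proof.
move=> mf gi fg; apply: le_integrable gi => //; first exact/measurable_EFinP.
by move=> w _; rewrite /= lee_fin (le_trans (fg w))// ler_norm.
Qed.

Lemma gaussian_mgf (t : R) : intg (fun w => expR (t * W w)) /\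
  Ex (fun w => expR (t * W w)) = expR (t * m + t ^+ 2 * v / 2).
Proof.
have := @gaussian_tilt t (cst 1%E) (measurable_cst _) (fun=> lee01).
rewrite probability_integral_cst mule1.
under eq_integral do rewrite mul1e.
move=> E; split; last by rewrite /Ex /Rintegral E.
apply/integrableP; split.
  apply/measurable_EFinP; apply: measurableT_comp => //.
  exact: measurable_funM.
by under eq_integral do rewrite /= ger0_norm ?expR_ge0//; rewrite E ltry.
Qed.

Lemma gaussian_intg_exp (t : R) : intg (fun w => expR (t * `|W w|)).
Proof.
have [i1 _] := gaussian_mgf t; have [i2 _] := gaussian_mgf (- t).
apply: (le_intg _ (intgD i1 i2)).
  by apply: measurableT_comp => //; apply: measurable_funM => //; exact: measurableT_comp.
move=> w; rewrite ger0_norm ?expR_ge0//.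
have [W0|W0] := leP 0 (W w); first by rewrite (ger0_norm W0) lerDl expR_ge0.
by rewrite (ltr0_norm W0) mulNr mulrN lerDr expR_ge0.
Qed.

Lemma gaussian_intg_pow (k : nat) : (k <= 3)%N ->
  intg (fun w => `|W w| ^+ k * expR `|W w|).
Proof.
move=> k3; apply: (le_intg _ (intgZ 6 (gaussian_intg_exp 2))).
  apply: measurable_funM; first by apply: measurable_funX; exact: measurableT_comp.
  by apply: measurableT_comp => //; exact: measurableT_comp.
by move=> w; rewrite ger0_norm ?mulr_ge0 ?exprn_ge0 ?expR_ge0// norm_exp_le.
Qed.

Lemma gaussian_intg : intg W.
Proof.
apply: (le_intg mW (gaussian_intg_pow (isT : (1 <= 3)%N))) => w.
by rewrite expr1 ler_peMr// -expR0 ler_expR.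
Qed.

Lemma gaussian_intgX : intg (fun w => W w ^+ 2).
Proof.
apply: (le_intg _ (gaussian_intg_pow (isT : (2 <= 3)%N))); first exact: measurable_funX.
by move=> w; rewrite normrX ler_peMr ?exprn_ge0// -expR0 ler_expR.
Qed.

(** The moment generating function is expanded to first order as a tends to 0, once under the
    expectation and once in closed form; matching the coefficients of a gives the mean. *)
Lemma gaussian_mean : Ex W = m.
Proof.
pose I := Ex (fun w => `|W w| ^+ 2 * expR `|W w|).
(* For a <= 1 the exponent a m + a^2 v / 2 is at most a k in absolute value. *)
pose k := `|m| + v; have k0 : 0 <= k by rewrite addr_ge0// sqr_ge0.
apply/subr0_eq; apply: (@eq0_linear_bound _ _ (I + v + k ^+ 2 * expR k)) => a /andP[a0 a1].
have I2 := gaussian_intg_pow (isT : (2 <= 3)%N).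
have [ie Ee] := gaussian_mgf a.
have b1 : `|Ex (fun w => expR (a * W w) - 1 - a * W w)| <= a ^+ 2 * I.
  rewrite /I -ExZ//; apply: norm_Ex_le.
  - apply: intgB; last exact/intgZ/gaussian_intg.
    by apply: intgB => //; apply: (bounded_intg 1) => // w; rewrite normr1.
  - exact: intgZ.
  - move=> w; apply: (le_trans (expRB1D_le _)).
    rewrite normrM exprMn (gtr0_norm a0) -mulrA; apply: ler_wpM2l; first exact: sqr_ge0.
    by apply: ler_wpM2l; rewrite ?exprn_ge0// ler_expR ler_piMl.
have i1 : intg (fun=> 1) by apply: (bounded_intg 1) => // w; rewrite normr1.
move: b1; rewrite ExB; last 2 first.
- exact: intgB.
- exact/intgZ/gaussian_intg.
rewrite ExB// Ex_cst ExZ ?Ee; last exact: gaussian_intg.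
set y := a * m + _ => b1.
have yk : `|y| <= a * k.
  rewrite (le_trans (ler_normD _ _))// normrM (gtr0_norm a0) /k mulrDr lerD2l.
  rewrite ger0_norm; last by apply: mulr_ge0 => //; apply: mulr_ge0; exact: sqr_ge0.
  have := sqr_ge0 s; set V := v => V0.
  have : 0 <= a * (1 - a) * V by apply: mulr_ge0 => //; apply: mulr_ge0; rewrite ?subr_ge0 ?(ltW a0).
  have : 0 <= a * V by rewrite mulr_ge0// ltW.
  by lra.
have b2 : `|expR y - 1 - y| <= a ^+ 2 * (k ^+ 2 * expR k).
  apply: (le_trans (expRB1D_le _)); rewrite mulrA -exprMn ler_pM ?exprn_ge0 ?expR_ge0//.
    by rewrite lerXn2r// nnegrE// mulr_ge0// ltW.
  by rewrite ler_expR (le_trans yk)// ler_piMl.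
rewrite -(ler_pM2l a0) -{1}(gtr0_norm a0) -normrM.
have -> : a * (Ex W - m) = (expR y - 1 - y) - (expR y - 1 - a * Ex W) + a ^+ 2 * v / 2.
  by rewrite /y; field.
apply: (le_trans (ler_normD _ _)); rewrite [X in _ + X]ger0_norm; last first.
  by apply: mulr_ge0 => //; apply: mulr_ge0; exact: sqr_ge0.
have := ler_normB (expR y - 1 - y) (expR y - 1 - a * Ex W).
have : 0 <= a ^+ 2 * v by rewrite mulr_ge0 ?sqr_ge0.
by lra.
Qed.

(** The moment generating function is expanded to second order at a and at - a: in the sum of the
    two the odd terms cancel, and a^2 (Ex W^2 - v) is left with an error O(a^3). *)
Lemma gaussian_second_moment : m = 0 -> Ex (fun w => W w ^+ 2) = v.
Proof.
move=> m0; pose I := Ex (fun w => `|W w| ^+ 3 * expR `|W w|).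
apply/subr0_eq; apply: (@eq0_linear_bound _ _ (2 * I + v ^+ 2 * expR v)) => a /andP[a0 a1].
have I3 := gaussian_intg_pow (isT : (3 <= 3)%N).
have i1 : intg (fun=> 1) by apply: (bounded_intg 1) => // w; rewrite normr1.
have b1 (c : R) : `|c| = a -> `|expR (a ^+ 2 * v / 2) - 1 - c * Ex W
    - c ^+ 2 / 2 * Ex (fun w => W w ^+ 2)| <= a ^+ 3 * I.
  move=> ca; have [ie Ee] := gaussian_mgf c.
  have c2 : c ^+ 2 = a ^+ 2 by rewrite -ca real_normK// num_real.
  have -> : expR (a ^+ 2 * v / 2) = Ex (fun w => expR (c * W w)).
    by rewrite Ee m0 mulr0 add0r c2.
  rewrite -(ExZ (c ^+ 2 / 2) gaussian_intgX) -(ExZ c gaussian_intg).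
  rewrite -{1}(Ex_cst P 1) -ExB// -ExB; last 2 first.
  - exact: intgB.
  - exact/intgZ/gaussian_intg.
  rewrite -ExB; last 2 first.
  - by apply: intgB; [exact: intgB|exact/intgZ/gaussian_intg].
  - exact/intgZ/gaussian_intgX.
  rewrite /I -ExZ//; apply: norm_Ex_le.
  - apply: intgB; last exact/intgZ/gaussian_intgX.
    by apply: intgB; [exact: intgB|exact/intgZ/gaussian_intg].
  - exact: intgZ.
  - move=> w; have -> : c ^+ 2 / 2 * W w ^+ 2 = (c * W w) ^+ 2 / 2 by ring.
    apply: (le_trans (expRB1DX_le _)).
    rewrite normrM exprMn ca -mulrA; apply: ler_wpM2l; first by rewrite exprn_ge0// ltW.
    by apply: ler_wpM2l; rewrite ?exprn_ge0// ler_expR ler_piMl.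
have := b1 a (gtr0_norm a0); have := b1 (- a) _; rewrite normrN gtr0_norm// => /(_ erefl).
rewrite sqrrN; set S := Ex (fun w => W w ^+ 2); set e := expR _ => h1 h2.
have : `|e - 1 - a ^+ 2 * v / 2| <= `|a ^+ 2 * v / 2| ^+ 2 * expR `|a ^+ 2 * v / 2|.
  exact: expRB1D_le.
rewrite (_ : `|a ^+ 2 * v / 2| = a ^+ 2 * v / 2); last first.
  apply: ger0_norm; by apply: mulr_ge0 => //; apply: mulr_ge0; exact: sqr_ge0.
move=> h3; have h4 : (a ^+ 2 * v / 2) ^+ 2 * expR (a ^+ 2 * v / 2) <= a ^+ 3 / 2 * (v ^+ 2 * expR v).
  have a2 : a ^+ 2 <= 1 by rewrite exprn_ile1// ltW.
  have v0 : 0 <= v by exact: sqr_ge0.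
  have e2 : expR (a ^+ 2 * v / 2) <= expR v.
    rewrite ler_expR; have := mulr_ge0 (sqr_ge0 a) v0; have : a ^+ 2 * v <= v by rewrite ler_piMl.
    by lra.
  have -> : a ^+ 3 / 2 * (v ^+ 2 * expR v) = (a ^+ 3 / 2 * v ^+ 2) * expR v by ring.
  rewrite ler_pM ?expR_ge0 ?sqr_ge0//.
  have -> : (a ^+ 2 * v / 2) ^+ 2 = (a ^+ 3 * v ^+ 2 / 2) * (a / 2) by field.
  have -> : a ^+ 3 / 2 * v ^+ 2 = a ^+ 3 * v ^+ 2 / 2 by ring.
  rewrite ler_piMr//; last by lra.
  by apply: mulr_ge0 => //; apply: mulr_ge0; rewrite ?sqr_ge0 ?exprn_ge0 ?(ltW a0).
have a20 : 0 < a ^+ 2 by rewrite exprn_gt0.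
rewrite -(ler_pM2l a20) -{1}(gtr0_norm a20) -normrM.
have -> : a ^+ 2 * (S - v) = 2 * (e - 1 - a ^+ 2 * v / 2)
   - (e - 1 - - a * Ex W - a ^+ 2 / 2 * S) - (e - 1 - a * Ex W - a ^+ 2 / 2 * S).
  by field.
apply: (le_trans (ler_normB _ _)); apply: (le_trans (lerD (ler_normB _ _) (lexx _))).
rewrite normrM (ger0_norm (ler0n _ 2)).
have -> : a ^+ 2 * ((2 * I + v ^+ 2 * expR v) * a) =
  2 * (a ^+ 3 / 2 * (v ^+ 2 * expR v)) + a ^+ 3 * I + a ^+ 3 * I by field.
by move: h1 h2 h3 h4; lra.
Qed.

(** [gaussian_tilt] asks for a nonnegative function: it is applied to f + 1, and the moment
    generating function removes the constant. *)
Lemma gaussian_tilt_bounded (t : R) (f : R -> R) : measurable_fun setT f ->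
  (forall x, `|f x| <= 1) ->
  Ex (fun w => expR (t * W w) * f (W w)) =
  expR (t * m + t ^+ 2 * v / 2) * Ex (fun w => f (W w + t * v)).
Proof.
move=> mf f1; set c := expR (t * m + _).
have f2 x : 0 <= f x + 1 by have := f1 x; rewrite ler_norml => /andP[]; lra.
have [ie Ee] := gaussian_mgf t.
have mfW : measurable_fun setT (fun w => f (W w)) by exact: measurableT_comp.
have mfWt : measurable_fun setT (fun w => f (W w + t * v)).
  by apply: (measurableT_comp mf); exact: measurable_funD.
have i1 : intg (fun w => expR (t * W w) * f (W w)).
  apply: (le_intg _ ie).
    apply: measurable_funM => //; apply: measurableT_comp => //.
    exact: measurable_funM.
  by move=> w; rewrite normrM ger0_norm ?expR_ge0// ler_piMr ?expR_ge0.
have i2 : intg (fun w => f (W w + t * v)) by exact: (bounded_intg 1).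
have i0 : intg (fun=> 1 : R) by apply: (bounded_intg 1) => // w; rewrite normr1.
have := @gaussian_tilt t (fun x => (f x + 1)%:E) _ _.
rewrite (ExE (intgD i2 i0)) => H.
have {H} : (\int[P]_w ((f (W w) + 1)%:E * (expR (t * W w))%:E) =
    (c * Ex (fun w => f (W w + t * v) + 1)%R)%:E)%E.
  apply: H; first by apply/measurable_EFinP; exact: measurable_funD.
  by move=> x; rewrite lee_fin.
move=> /(congr1 fine)/=; rewrite -/(Rintegral _ _ _) => H.
have : Ex (fun w => expR (t * W w) * f (W w) + expR (t * W w)) =
    c * (Ex (fun w => f (W w + t * v)) + 1).
  rewrite -[in RHS](Ex_cst P 1) -ExD// -H; congr fine; apply: eq_integral => w _.
  by congr (_%:E); ring.
by rewrite ExD// Ee -/c mulrDr mulr1 => /addIr.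
Qed.

Lemma measurable_cos_comp (th a : R) : measurable_fun setT (fun w => cos (th + a * W w)).
Proof.
apply: (measurableT_comp (continuous_measurable_fun (@continuous_cos R))).
by apply: measurable_funD => //; exact: measurable_funM.
Qed.

Lemma intg_cos (th a : R) : intg (fun w => cos (th + a * W w)).
Proof. by apply: (bounded_intg 1) => [|w]; [exact: measurable_cos_comp|exact: cos_max]. Qed.

(** The transform solves phi' = - a v phi in a. This is the Gaussian integration by parts E[W sin] =
    a v E[cos], obtained here by tilting, since a sine is a cosine with phase moved by - pi / 2. *)
Lemma gaussian_cos (th a : R) : m = 0 ->
  Ex (fun w => cos (th + a * W w)) = cos th * expR (- (a ^+ 2 * v / 2)).
Proof.
move=> m0; pose phi th a := Ex (fun w => cos (th + a * W w)).
pose I := Ex (fun w => `|W w| ^+ 2 * expR `|W w|).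
have I2 := gaussian_intg_pow (isT : (2 <= 3)%N).
have I0 : 0 <= I.
  by apply: Rintegral_ge0 => w _; rewrite mulr_ge0 ?expR_ge0 ?exprn_ge0.
have sinE x : sin x = cos (x - pi / 2) by rewrite cosBpihalf.
have v0 : 0 <= v := sqr_ge0 s.
have phi1 ps b : `|phi ps b| <= 1.
  rewrite -(Ex_cst P 1); apply: norm_Ex_le; first exact: intg_cos.
    by apply: (bounded_intg 1) => // w; rewrite normr1.
  by move=> w; exact: cos_max.
(* Three quadratic errors: Taylor for cos and exp under the expectation ([b1]), the phase shift b k
   v produced by the tilt ([b2]), and its normalisation exp(k^2 v / 2) ([b3]). *)
have step ps b k : `|k| <= 1 ->
    `|phi ps (b + k) - phi ps b - k * (- (b * v) * phi ps b)|
      <= (2 * I + (b * v) ^+ 2 + v * expR v) * k ^+ 2.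
  move=> k1; set q := ps - pi / 2.
  have kW w : `|k * W w| <= `|W w| by rewrite normrM ler_piMl.
  have k2 : `|k| ^+ 2 = k ^+ 2 by rewrite real_normK// num_real.
  have k21 : k ^+ 2 <= 1 by rewrite -k2 exprn_ile1.
  have tilt : Ex (fun w => expR (k * W w) * cos (q + b * W w)) =
      expR (k ^+ 2 * v / 2) * phi (q + b * k * v) b.
    rewrite (@gaussian_tilt_bounded k (fun x => cos (q + b * x))); last 2 first.
    - apply: (measurableT_comp (continuous_measurable_fun (@continuous_cos R))).
      by apply: measurable_funD => //; exact: measurable_funM.
    - by move=> x; exact: cos_max.
    rewrite m0 mulr0 add0r; congr (_ * _); congr (Ex _); apply/funext => w.
    by congr cos; ring.
  have iT : intg (fun w => expR (k * W w) * cos (q + b * W w)).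
    have [ie _] := gaussian_mgf k; apply: (le_intg _ ie).
      by apply: measurable_funM; [exact: (intgM ie)|exact: measurable_cos_comp].
    by move=> w; rewrite normrM ger0_norm ?expR_ge0// ler_piMr ?expR_ge0 ?cos_max.
  have b1 : `|phi ps (b + k) - phi ps b + (expR (k ^+ 2 * v / 2) * phi (q + b * k * v) b
      - phi q b)| <= 2 * I * k ^+ 2.
    rewrite -tilt /phi -ExB; [|exact: intg_cos..].
    rewrite -ExB//; last exact: intg_cos.
    rewrite -ExD; last 2 first.
    - by apply: intgB; exact: intg_cos.
    - by apply: intgB => //; exact: intg_cos.
    have -> : 2 * I * k ^+ 2 = (2 * k ^+ 2) * I by ring.
    rewrite /I -ExZ//; apply: norm_Ex_le.
    - by apply: intgD; [apply: intgB; exact: intg_cos|apply: intgB => //; exact: intg_cos].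
    - exact: intgZ.
    move=> w; have -> : ps + (b + k) * W w = (ps + b * W w) + k * W w by ring.
    have -> : q + b * W w = (ps + b * W w) - pi / 2 by rewrite /q; ring.
    rewrite cosBpihalf; set y := ps + _; set z := k * W w.
    have -> : cos (y + z) - cos y + (expR z * sin y - sin y) =
       (cos (y + z) - cos y + z * sin y) + (expR z - 1 - z) * sin y by ring.
    apply: (le_trans (ler_normD _ _)).
    have z2 : `|z| ^+ 2 * expR `|z| <= k ^+ 2 * (`|W w| ^+ 2 * expR `|W w|).
      rewrite /z normrM exprMn k2 -mulrA ler_wpM2l ?sqr_ge0// ler_wpM2l ?exprn_ge0//.
      by rewrite ler_expR -normrM.
    have h1 : `|cos (y + z) - cos y + z * sin y| <= `|z| ^+ 2 * expR `|z|.
      apply: (le_trans (cosD_approx _ _)); rewrite ler_peMr ?exprn_ge0//.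
      by rewrite -expR0 ler_expR.
    have h2 : `|(expR z - 1 - z) * sin y| <= `|z| ^+ 2 * expR `|z|.
      by rewrite normrM (le_trans _ (expRB1D_le z))// ler_piMr// sin_max.
    by lra.
  have b2 : `|phi (q + b * k * v) b - phi q b - b * k * v * phi ps b| <= (b * k * v) ^+ 2.
    rewrite /phi -ExZ; last exact: intg_cos.
    rewrite -ExB; [|exact: intg_cos..]; rewrite -ExB; last 2 first.
    - by apply: intgB; exact: intg_cos.
    - exact/intgZ/intg_cos.
    rewrite -[leRHS](Ex_cst P); apply: norm_Ex_le.
    - by apply: intgB; [apply: intgB; exact: intg_cos|exact/intgZ/intg_cos].
    - by apply: (bounded_intg ((b * k * v) ^+ 2)) => // w; rewrite ger0_norm// sqr_ge0.
    move=> w; have -> : q + b * k * v + b * W w = (q + b * W w) + b * k * v by ring.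
    have <- : - sin (q + b * W w) = cos (ps + b * W w).
      rewrite /q (_ : ps - pi / 2 + b * W w = (ps + b * W w) - pi / 2); last by ring.
      by rewrite sinBpihalf opprK.
    rewrite mulrN opprK -[leRHS]real_normK ?num_real//.
    exact: cosD_approx.
  have b3 : `|(expR (k ^+ 2 * v / 2) - 1) * phi (q + b * k * v) b| <= v * expR v * k ^+ 2.
    rewrite normrM; apply: (@le_trans _ _ `|expR (k ^+ 2 * v / 2) - 1|).
      by rewrite ler_piMr.
    apply: (le_trans (expRB1_le _)).
    have h0 : 0 <= k ^+ 2 * v by rewrite mulr_ge0// sqr_ge0.
    rewrite ger0_norm; last by rewrite divr_ge0.
    have h1 : k ^+ 2 * v / 2 <= v.
      by have : k ^+ 2 * v <= v; [rewrite ler_piMl|lra].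
    have -> : v * expR v * k ^+ 2 = (k ^+ 2 * v) * expR v by ring.
    rewrite ler_pM ?expR_ge0 ?ler_expR//; first by rewrite divr_ge0.
    by lra.
  have -> : phi ps (b + k) - phi ps b - k * (- (b * v) * phi ps b) =
    (phi ps (b + k) - phi ps b + (expR (k ^+ 2 * v / 2) * phi (q + b * k * v) b - phi q b))
    - (phi (q + b * k * v) b - phi q b - b * k * v * phi ps b)
    - (expR (k ^+ 2 * v / 2) - 1) * phi (q + b * k * v) b by ring.
  apply: (le_trans (ler_normB _ _)); apply: (le_trans (lerD (ler_normB _ _) (lexx _))).
  have -> : (2 * I + (b * v) ^+ 2 + v * expR v) * k ^+ 2 =
    2 * I * k ^+ 2 + (b * k * v) ^+ 2 + v * expR v * k ^+ 2 by ring.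
  by rewrite !lerD.
have dphi ps b : is_derive b (1 : R) (phi ps) (- (b * v) * phi ps b).
  exact: is_derive_quad (step ps b).
have dg b : is_derive b (1 : R) (fun b => phi th b * expR (b ^+ 2 * v / 2)) 0.
  by apply: is_derive_eq; rewrite /GRing.scale/=; field.
have := is_derive0_cst dg a.
rewrite expr0n/= !mul0r expR0 mulr1 => E.
rewrite -/(phi th a) expRN; apply/(canRL (mulfK _)); first by rewrite gt_eqF ?expR_gt0.
rewrite E /phi -[RHS](Ex_cst P); congr (Ex _); apply/funext => w.
by rewrite mul0r addr0.
Qed.

End gaussian_variable.

(** * Gaussian families given by their linear combinations *)

Section cylinders.
Context {R : realType}.

(** Vectors are functions on [nat] of which the generated sigma-algebra sees the first n coordinates
    only. These orthants form a pi-system, ready for Dynkin's theorem. *)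
Definition cylinders (n : nat) : set (set (nat -> R)) :=
  [set A | exists a : nat -> R, A = [set g | forall i, (i < n)%N -> g i < a i]].

Local Notation vec n := (g_sigma_algebraType (cylinders n)).

Lemma cylinders_setI n : setI_closed (cylinders n).
Proof.
move=> _ _ [a ->] [b ->]; exists (fun i => Num.min (a i) (b i)).
apply/seteqP; split => g /=.
- by move=> [ga gb] i ni; rewrite lt_min ga// gb.
- by move=> H; split => i /H; rewrite lt_min => /andP[].
Qed.

Lemma measurable_vec d (T : measurableType d) n (F : T -> vec n) :
  (forall i, (i < n)%N -> measurable_fun setT (fun x => F x i : R)) ->
  measurable_fun setT F.
Proof.
move=> mF; apply: (@measurability _ _ T (vec n) setT F (cylinders n)) => // _ [_ [a ->] <-].
rewrite setTI.
have -> : F @^-1` [set g | forall i, (i < n)%N -> g i < a i] =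
    \bigcap_(i in [set i | (i < n)%N]) ((fun x => F x i : R) @^-1` `]-oo, a i[).
  apply/seteqP; split => x /=.
  - by move=> H i ni; rewrite /= in_itv/= H.
  - by move=> H i ni; have := H i ni; rewrite /= in_itv.
apply: bigcap_measurableType => i ni.
by rewrite -[X in measurable X]setTI; exact: mF.
Qed.

Lemma measurable_coord n i : (i < n)%N -> measurable_fun setT (fun g : vec n => g i : R).
Proof.
move=> ni; apply: (measurability (@RGenInftyO.G R)).
  exact: RGenInftyO.measurableE.
move=> _ [_ [r ->] <-]; rewrite setTI.
(* A half-space in coordinate i is a countable union of orthants, the other coordinates being merely
   bounded by k. *)
have -> : (fun g : vec n => g i : R) @^-1` `]-oo, r[ =
    \bigcup_k [set g | forall j, (j < n)%N -> g j < (if j == i then r else k%:R)].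
  apply/seteqP; split => g /=; rewrite in_itv/=.
  - move=> gr; pose M := \sum_(j < n) `|g j|.
    exists (Num.truncn M).+1 => // j nj; case: eqP => [->//|_].
    apply: le_lt_trans (truncnS_gt _); rewrite /M (bigD1 (Ordinal nj))//=.
    by rewrite (le_trans (ler_norm _))// lerDl sumr_ge0.
  - by move=> [k _ /(_ i ni)]; rewrite eqxx.
apply: bigcupT_measurable => k; apply: sub_sigma_algebra.
by exists (fun j => if j == i then r else k%:R).
Qed.

End cylinders.
Notation vec n := (g_sigma_algebraType (cylinders n)).

Section bilinear.
Context {R : realType}.
Implicit Types (n : nat) (C : nat -> nat -> R) (a b : nat -> R).

Definition lin n a (g : nat -> R) : R := \sum_(i < n) a i * g i.
Definition bil n C a b : R := \sum_(i < n) \sum_(j < n) a i * C i j * b j.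

Lemma linDl n a b g (x y : R) :
  lin n (fun i => x * a i + y * b i) g = x * lin n a g + y * lin n b g.
Proof. by rewrite /lin !mulr_sumr -big_split/=; apply: eq_bigr => i _; ring. Qed.

Lemma bil_lin n C a b : bil n C a b = lin n a (fun i => lin n b (C i)).
Proof.
apply: eq_bigr => i _; rewrite /lin mulr_sumr; apply: eq_bigr => j _; ring.
Qed.

Lemma bilC n C a b : (forall i j, C i j = C j i) -> bil n C a b = bil n C b a.
Proof.
move=> CC; rewrite /bil exchange_big; apply: eq_bigr => i _; apply: eq_bigr => j _.
by rewrite CC; ring.
Qed.

Lemma bilDl n C a b c (x y : R) :
  bil n C (fun i => x * a i + y * b i) c = x * bil n C a c + y * bil n C b c.
Proof. by rewrite !bil_lin linDl. Qed.

Lemma bilD2 n C a b (x y : R) : (forall i j, C i j = C j i) ->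
  bil n C (fun i => x * a i + y * b i) (fun i => x * a i + y * b i) =
  x ^+ 2 * bil n C a a + 2 * (x * y) * bil n C a b + y ^+ 2 * bil n C b b.
Proof.
move=> CC; set c := fun i => _.
rewrite {1}/c bilDl (bilC _ a c)// (bilC _ b c)// /c !bilDl (bilC _ b a)//.
by ring.
Qed.

End bilinear.

Section gaussian_family.
Context d (T : measurableType d) (R : realType) (P : probability T R).
Local Notation Ex := (Ex P).
Local Notation intg := (intg P).

(** A centred Gaussian vector, encoded by the laws of its linear combinations. C may be singular:
    for a combination of variance 0, [gaussian_law] is a Dirac mass. *)
Definition gaussian_family (n : nat) (Gam : nat -> T -> R) (C : nat -> nat -> R) : Prop :=
  [/\ forall i, measurable_fun setT (Gam i),
      forall i j, C i j = C j i,
      forall a, 0 <= bil n C a a &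
      forall a A, measurable A -> P ((fun w => lin n a (Gam^~ w)) @^-1` A) =
        gaussian_law 0 (Num.sqrt (bil n C a a)) A].

Section char.
Context (n : nat) (Gam : nat -> T -> R) (C : nat -> nat -> R).
Hypothesis GF : gaussian_family n Gam C.

Lemma measurable_lin a : measurable_fun setT (fun w => lin n a (Gam^~ w)).
Proof.
have [mG _ _ _] := GF; apply: measurable_sum => i.
by apply: measurable_funM => //; exact: mG.
Qed.

Lemma gaussian_family_cos th a :
  Ex (fun w => cos (th + lin n a (Gam^~ w))) = cos th * expR (- (bil n C a a / 2)).
Proof.
have [mG CC C0 law] := GF; have law_a := law a.
have [b0|b0] := eqVneq (bil n C a a) 0.
  have lin0 : {ae P, forall w, lin n a (Gam^~ w) = 0}.
    exists ((fun w => lin n a (Gam^~ w)) @^-1` (~` [set 0])); split.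
    - rewrite -[X in measurable X]setTI; apply: measurable_lin => //.
      exact: measurableC.
    - rewrite law_a; last exact: measurableC.
      by rewrite b0 sqrtr0 /gaussian_law eqxx diracE memNset//; apply.
    - by move=> w /=.
  rewrite b0 mul0r oppr0 expR0 mulr1 -[RHS](Ex_cst P); congr fine.
  apply: ae_eq_integral => //.
  - apply/measurable_EFinP.
    apply: (measurableT_comp (continuous_measurable_fun (@continuous_cos R))).
    by apply: measurable_funD => //; exact: measurable_lin.
  - by apply: filterS lin0 => w /= -> _; rewrite addr0.
have s0 : Num.sqrt (bil n C a a) != 0 by rewrite sqrtr_eq0 -ltNge lt0r b0 C0.
have := @gaussian_cos _ _ R P (fun w => lin n a (Gam^~ w)) 0 _ (measurable_lin a) s0 _ th 1 erefl.
rewrite expr1n mul1r sqr_sqrtr// => <-.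
  by congr (Ex _); apply/funext => w; rewrite mul1r.
by move=> A mA; rewrite law_a// /gaussian_law (negbTE s0).
Qed.

End char.
End gaussian_family.

(** * Cameron-Martin formula in finite dimension *)

Section cameron_martin.
Context d (T : measurableType d) (R : realType) (P : probability T R).
Local Notation Ex := (Ex P).
Local Notation intg := (intg P).
Context (n : nat) (Gam : nat -> T -> R) (C : nat -> nat -> R).
Hypothesis GF : gaussian_family P n Gam C.
Context (a : nat -> R).
Local Notation v := (bil n C a a).
Hypothesis v0 : 0 < v.

(** [c i] is the covariance of [Gam i] with G and v the variance of G, so that [W i] is the residual
    of [Gam i] after regression on G. *)
Let c (i : nat) : R := lin n a (C i).
Let G (w : T) : R := lin n a (Gam^~ w).
Let W (i : nat) (w : T) : R := Gam i w - c i / v * G w.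

Let mG : measurable_fun setT G. Proof. exact: measurable_lin GF a. Qed.
Let mW i : measurable_fun setT (W i).
Proof.
have [mGam _ _ _] := GF; apply: measurable_funB => //.
exact: measurable_funM.
Qed.

(** Coefficients on [Gam] of a combination e of the residuals; [bil_res] below expresses that the
    residuals are orthogonal to G. *)
Let res (e : nat -> R) (i : nat) : R := 1 * e i + - (lin n e c / v) * a i.

Let lin_res e w : lin n e (W^~ w) = lin n (res e) (Gam^~ w).
Proof.
rewrite linDl mul1r -/(G w) mulNr.
transitivity (\sum_(i < n) (e i * Gam i w - e i * c i / v * G w)).
  by apply: eq_bigr => i _; rewrite /W; ring.
by rewrite sumrB -!mulr_suml.
Qed.

Let bil_res e : bil n C (res e) a = 0.
Proof.
rewrite bilDl mul1r [bil n C e a]bil_lin -/c mulNr divfK ?gt_eqF// /lin.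
apply/eqP; rewrite subr_eq0; apply/eqP; apply: eq_bigr => i _.
by [].
Qed.

(** The cross term of the quadratic form vanishes by orthogonality, so the transform of the pair (W,
    G) factors. Independence is extracted from this factorisation. *)
Let cos_WG th e t : Ex (fun w => cos (th + lin n e (W^~ w) + t * G w)) =
  cos th * expR (- (bil n C (res e) (res e) / 2)) * expR (- (t ^+ 2 * v / 2)).
Proof.
have [_ CC _ _] := GF.
transitivity (Ex (fun w => cos (th + lin n (fun i => 1 * res e i + t * a i) (Gam^~ w)))).
  by congr (Ex _); apply/funext => w; rewrite lin_res linDl mul1r addrA.
rewrite (gaussian_family_cos GF) bilD2// bil_res mulr0 addr0 expr1n mul1r -mulrA -expRD.
by congr (_ * expR _); field.
Qed.

Let mcos (X : T -> R) : measurable_fun setT X -> measurable_fun setT (fun w => cos (X w)).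
Proof. by move=> mX; exact: (measurableT_comp (continuous_measurable_fun (@continuous_cos R))). Qed.

Let mlinW e : measurable_fun setT (fun w => lin n e (W^~ w)).
Proof. by apply: measurable_sum => i; exact: measurable_funM. Qed.

Let intg_bound (f : T -> R) (M : R) : measurable_fun setT f -> (forall w, `|f w| <= M) -> intg f.
Proof. by move=> mf fM; exact: (bounded_intg M). Qed.

Let rho (th t : R) (w : T) : R := cos (th + t * G w) - Ex (fun w => cos (th + t * G w)).

Let mrho th t : measurable_fun setT (rho th t).
Proof.
apply: measurable_funB => //; apply: mcos; apply: measurable_funD => //.
exact: measurable_funM.
Qed.

Let rho2 th t w : `|rho th t w| <= 2.
Proof.
rewrite /rho (le_trans (ler_normB _ _))// (_ : 2 = 1 + 1 :> R)// lerD ?cos_max//.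
rewrite -[leRHS](Ex_cst P); apply: norm_Ex_le.
- apply: (@intg_bound _ 1) => [|x]; last exact: cos_max.
  by apply: mcos; apply: measurable_funD => //; exact: measurable_funM.
- by apply: (@intg_bound _ 1) => // x; rewrite normr1.
- by move=> x; exact: cos_max.
Qed.

Let ind (l : nat -> R) (k : nat) (w : T) : R := \prod_(i < k) \1_(`]-oo, l i[) (W i w).

Let mind l k : measurable_fun setT (ind l k).
Proof.
apply: measurable_prod => i _.
exact: (measurableT_comp (measurable_indic _) (mW i)).
Qed.

Let indic01 (A : set R) x : 0 <= (\1_A x : R) <= 1.
Proof. by rewrite indicE; case: (x \in A); rewrite ?lexx ?ler01. Qed.

Let ind01 l k w : 0 <= ind l k w <= 1.
Proof.
rewrite /ind; elim: k => [|k /andP[h0 h1]]; first by rewrite big_ord0 ler01 lexx.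
have /andP[i0 i1] := indic01 `]-oo, l k[ (W k w).
by rewrite big_ord_recr/= mulr_ge0// mulr_ile1.
Qed.

(** The indicators of an orthant are inserted one coordinate at a time: step k applies
    [fourier_indic] to [W k], with the cosine, the indicators already present and [rho] as its
    weight. The base case is the factorisation [cos_WG]. *)
Let cos_ind_rho l th t k : (k <= n)%N -> forall th' e,
  Ex (fun w => cos (th' + lin n e (W^~ w)) * ind l k w * rho th t w) = 0.
Proof.
have mX th' e : measurable_fun setT (fun w => cos (th' + lin n e (W^~ w))).
  by apply: mcos; exact: measurable_funD.
have mI th' e k' : measurable_fun setT (fun w => cos (th' + lin n e (W^~ w)) * ind l k' w * rho th t w).
  by apply: measurable_funM => //; exact: measurable_funM.
have bI th' e k' w : `|cos (th' + lin n e (W^~ w)) * ind l k' w * rho th t w| <= 2.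
  have /andP[i0 i1] := ind01 l k' w.
  rewrite -[leRHS]mul1r normrM ler_pM// normrM mulr_ile1 ?cos_max//.
  by rewrite ger0_norm.
have iI th' e k' : intg (fun w => cos (th' + lin n e (W^~ w)) * ind l k' w * rho th t w).
  exact: (@intg_bound _ 2).
elim: k => [_|k IH kn] th' e.
  have i1 : intg (fun w => cos (th' + lin n e (W^~ w))).
    by apply: (@intg_bound _ 1) => // w; exact: cos_max.
  have i2 s t' : intg (fun w => cos (s + lin n e (W^~ w) + t' * G w)).
    apply: (@intg_bound _ 1) => [|w]; last exact: cos_max.
    by apply: mcos; apply: measurable_funD; [exact: measurable_funD|exact: measurable_funM].
  transitivity (Ex (fun w => (1 / 2) * (cos ((th' + th) + lin n e (W^~ w) + t * G w)
      + cos ((th' - th) + lin n e (W^~ w) + (- t) * G w))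
      - Ex (fun w => cos (th + t * G w)) * cos (th' + lin n e (W^~ w)))).
    congr (Ex _); apply/funext => w; rewrite /ind big_ord0 mulr1 /rho mulrBr cos_prod.
    congr (1 / 2 * (cos _ + cos _) - _); [ring|ring|exact: mulrC].
  have iS := intgD (i2 (th' + th) t) (i2 (th' - th) (- t)).
  rewrite ExB; [|exact: intgZ|exact: intgZ].
  rewrite (ExZ (1 / 2) iS) (ExD (i2 _ _) (i2 _ _)) (ExZ _ i1) !cos_WG.
  have -> : Ex (fun w => cos (th' + lin n e (W^~ w))) =
      cos th' * expR (- (bil n C (res e) (res e) / 2)).
    have := cos_WG th' e 0; rewrite expr0n/= !mul0r oppr0 expR0 mulr1 => <-.
    by congr (Ex _); apply/funext => w; rewrite mul0r addr0.
  have -> : Ex (fun w => cos (th + t * G w)) = cos th * expR (- (t ^+ 2 * v / 2)).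
    have := cos_WG th (fun=> 0) t.
    have lin0 g : lin n (fun=> 0 : R) g = 0 by rewrite /lin big1// => i _; rewrite mul0r.
    have r0 i : res (fun=> 0) i = 0 by rewrite /res lin0 mul0r oppr0 mul0r mulr0 addr0.
    have -> : bil n C (res (fun=> 0)) (res (fun=> 0)) = 0.
      by rewrite /bil big1// => i _; rewrite big1// => j _; rewrite r0 !mul0r.
    rewrite mul0r oppr0 expR0 mulr1 => <-.
    by congr (Ex _); apply/funext => w; rewrite lin0 addr0.
  by rewrite sqrrN cosD cosB; field.
transitivity (Ex (fun w => \1_(`]-oo, l k[) (W k w) *
    (cos (th' + lin n e (W^~ w)) * ind l k w * rho th t w))).
  congr (Ex _); apply/funext => w; rewrite /ind big_ord_recr/=.
  by ring.
apply: (@fourier_indic _ _ _ P _ _ 2) => // ph b.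
pose dk i : R := (i == k)%:R.
have lin_dk w : lin n dk (W^~ w) = W k w.
  rewrite /lin (bigD1 (Ordinal kn))//= /dk eqxx mul1r big1 ?addr0// => i /negbTE ik.
  by rewrite (_ : (i == k :> nat) = false) ?mul0r// -ik.
pose eb b i : R := 1 * e i + b * dk i.
transitivity (Ex (fun w => (1 / 2) * (
    cos ((ph + th') + lin n (eb b) (W^~ w)) * ind l k w * rho th t w +
    cos ((th' - ph) + lin n (eb (- b)) (W^~ w)) * ind l k w * rho th t w))).
  congr (Ex _); apply/funext => w; rewrite /eb !linDl lin_dk 2!mulrA cos_prod.
  have -> : ph + th' + (1 * lin n e (W^~ w) + b * W k w) =
    ph + b * W k w + (th' + lin n e (W^~ w)) by ring.
  have -> : cos (th' - ph + (1 * lin n e (W^~ w) + - b * W k w)) =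
    cos (ph + b * W k w - (th' + lin n e (W^~ w))) by rewrite -cosN; congr cos; ring.
  by ring.
by rewrite ExZ ?ExD// ?IH ?addr0 ?mulr0 ?(ltnW kn)//; exact: intgD.
Qed.

(** One last use of [fourier_indic], now in the variable G and with the centred indicator of the
    orthant as weight, makes events of G independent of orthants of W. *)
Let indep l : forall A, measurable A ->
  (\int[P]_w (\1_A (G w) * ind l n w)%:E = \int[P]_w (\1_A (G w) * Ex (ind l n))%:E)%E.
Proof.
move=> A mA.
have iind : intg (ind l n).
  by apply: (@intg_bound _ 1) => // w; have /andP[i0 i1] := ind01 l n w; rewrite ger0_norm.
have mA' : measurable_fun setT (fun w => \1_A (G w) : R).
  exact: (measurableT_comp (measurable_indic _) mG).
have bA w : `|\1_A (G w) : R| <= 1.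
  by have /andP[i0 i1] := indic01 A (G w); rewrite ger0_norm.
have E1 : `|Ex (ind l n)| <= 1.
  rewrite -[leRHS](Ex_cst P); apply: norm_Ex_le => //.
    by apply: (@intg_bound _ 1) => // w; rewrite normr1.
  by move=> w; have /andP[i0 i1] := ind01 l n w; rewrite ger0_norm.
have i1 : intg (fun w => \1_A (G w) * ind l n w).
  apply: (@intg_bound _ 1); first exact: measurable_funM.
  move=> w; rewrite normrM mulr_ile1//.
  by have /andP[i0 i1] := ind01 l n w; rewrite ger0_norm.
have i2 : intg (fun w => \1_A (G w) * Ex (ind l n)).
  apply: (@intg_bound _ 1); first exact: measurable_funM.
  by move=> w; rewrite normrM mulr_ile1.
rewrite (ExE i1) (ExE i2); congr (_%:E); apply/eqP; rewrite -subr_eq0 -ExB//; apply/eqP.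
transitivity (Ex (fun w => \1_A (G w) * (ind l n w - Ex (ind l n)))).
  by congr (Ex _); apply/funext => w; rewrite mulrBr.
apply: (@fourier_indic _ _ _ P _ _ 2) => //.
- exact: measurable_funB.
- move=> w; rewrite (le_trans (ler_normB _ _))// (_ : 2 = 1 + 1 :> R)// lerD//.
  by have /andP[? ?] := ind01 l n w; rewrite ger0_norm.
move=> th t.
have ic : intg (fun w => cos (th + t * G w)).
  apply: (@intg_bound _ 1) => [|x]; last exact: cos_max.
  by apply: mcos; apply: measurable_funD => //; exact: measurable_funM.
have ici : intg (fun w => cos (th + t * G w) * ind l n w).
  apply: (@intg_bound _ 1) => [|w]; first by apply: measurable_funM => //; exact: intgM ic.
  rewrite normrM mulr_ile1 ?cos_max//.
  by have /andP[? ?] := ind01 l n w; rewrite ger0_norm.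
have iind' := intgZ (Ex (fun w => cos (th + t * G w))) iind.
have ic' := intgZ (Ex (ind l n)) ic.
have H0 : Ex (fun w => cos (th + t * G w) * ind l n w -
    Ex (fun w => cos (th + t * G w)) * ind l n w) = 0.
  rewrite -[RHS](cos_ind_rho l th t (leqnn n) 0 (fun=> 0)); congr (Ex _).
  apply/funext => w; rewrite (_ : lin n _ _ = 0) ?addr0 ?cos0 ?mul1r /rho; first by ring.
  by rewrite /lin big1// => i _; rewrite mul0r.
transitivity (Ex (fun w => cos (th + t * G w) * ind l n w -
    Ex (ind l n) * cos (th + t * G w))).
  by congr (Ex _); apply/funext => w; ring.
move: H0; rewrite (ExB ici iind') (ExB ici ic') (ExZ _ iind) (ExZ _ ic) => <-.
by congr (_ - _); exact: mulrC.
Qed.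

(** [Gam] is a function S of (W, G), and adding c to it leaves every [W i] fixed and adds v to G. By
    independence the density then concerns the one-dimensional law of G alone, where the formula is
    [gaussian_tilt] with t = 1. *)
Theorem cameron_martin (f : vec n -> \bar R) : measurable_fun setT f ->
  (forall g, 0 <= f g)%E ->
  (forall g g', (forall i, (i < n)%N -> g i = g' i) -> f g = f g') ->
  (\int[P]_w (f (Gam^~ w) * (expR (G w - v / 2))%:E) =
   \int[P]_w f (fun i => Gam i w + c i)%R)%E.
Proof.
move=> mf f0 fext.
(* Slots below n hold the residuals and slot n holds G, shifted by v in [V2]. S restores the
   coordinates below n only, hence the requirement that f ignore the others. *)
pose V1 (w : T) : vec n.+1 := fun i => if (i < n)%N then W i w else G w.
pose V2 (w : T) : vec n.+1 := fun i => if (i < n)%N then W i w else G w + v.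
pose S (V : vec n.+1) : vec n := fun i => V i + c i / v * V n.
have mexpG : measurable_fun setT (fun w => expR (G w - v / 2)).
  by apply: measurableT_comp => //; exact: measurable_funB.
have mV1 : measurable_fun setT V1.
  by apply: measurable_vec => i _; rewrite /V1; case: (i < n)%N.
have mV2 : measurable_fun setT V2.
  apply: measurable_vec => i _; rewrite /V2; case: (i < n)%N => //.
  exact: measurable_funD.
have mS : measurable_fun setT S.
  apply: measurable_vec => i ni; apply: measurable_funD.
    by apply: measurable_coord; rewrite ltnS ltnW.
  by apply: measurable_funM => //; exact: measurable_coord.
have s0 : Num.sqrt v != 0 by rewrite sqrtr_eq0 -ltNge.
have lawG A : measurable A -> P (G @^-1` A) = normal_prob 0 (Num.sqrt v) A.
  by have [_ _ _ law] := GF; move=> mA; rewrite law// /gaussian_law (negbTE s0).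
have ind_cyl l k w : ind l k w = \1_[set w | forall i, (i < k)%N -> W i w < l i] w.
  rewrite /ind; elim: k => [|k IH].
    rewrite big_ord0 indicE; suff -> : w \in [set w | forall i, (i < 0)%N -> W i w < l i] by [].
    by rewrite inE.
  rewrite big_ord_recr/= IH !indicE -natrM mulnb; congr (_%:R); congr nat_of_bool.
  apply/idP/idP.
    move=> /andP[/set_mem H /set_mem/=]; rewrite in_itv/= => Hk.
    by apply/mem_set => i; rewrite ltnS leq_eqVlt => /orP[/eqP ->//|/H].
  move=> /set_mem H; apply/andP; split; apply/mem_set.
    by move=> i ik; apply: H; rewrite ltnS ltnW.
  by rewrite /= in_itv/= H.
have V_cyl (l : nat -> R) (y : R) w :
    \1_[set g : nat -> R | forall i, (i < n.+1)%N -> g i < l i]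
      (fun i => if (i < n)%N then W i w else y) = \1_(`]-oo, l n[) y * ind l n w :> R.
  rewrite ind_cyl !indicE -natrM mulnb; congr (_%:R); congr nat_of_bool.
  apply/idP/idP.
    move=> /set_mem H; apply/andP; split; apply/mem_set.
      by have := H n (ltnSn n); rewrite ltnn /= in_itv.
    by move=> i ni; have := H i (ltnW ni); rewrite ni.
  move=> /andP[/set_mem/= + /set_mem H]; rewrite in_itv/= => yl; apply/mem_set => i ni.
  case: ifPn => [/H//|]; rewrite -leqNgt => ni'.
  by have -> : i = n by apply/eqP; rewrite eqn_leq ni' -ltnS ni.
have mind_l l k := mind l k.
have ind_ge0 l k w : 0 <= ind l k w by have /andP[] := ind01 l k w.
have Eind_ge0 l k : 0 <= Ex (ind l k) by apply: Rintegral_ge0 => w _.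
have factor l (F : R -> R) : measurable_fun setT F -> (forall x, 0 <= F x) ->
    (\int[P]_w (F (G w) * ind l n w)%:E = \int[P]_w (F (G w) * Ex (ind l n))%:E)%E.
  move=> mF F0.
  have := @eq_integral_weighted _ _ _ _ _ _ _ P P G G (ind l n) (cst (Ex (ind l n)))
    mG mG (mind_l l n) (measurable_cst _) (ind_ge0 l n) (fun=> Eind_ge0 l n)
    (indep l) (EFin \o F).
  by apply; [exact/measurable_EFinP|move=> x; rewrite /= lee_fin].
have tilt (F : R -> R) : measurable_fun setT F -> (forall x, 0 <= F x) ->
    (\int[P]_w (F (G w) * expR (G w - v / 2))%:E = \int[P]_w (F (G w + v))%:E)%E.
  move=> mF F0.
  have := @gaussian_tilt _ _ _ P G 0 _ mG s0 lawG 1 (fun x => (F x * expR (- (v / 2)))%:E).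
  rewrite sqr_sqrtr ?(ltW v0)// => H.
  transitivity (\int[P]_w ((F (G w) * expR (- (v / 2)))%:E * (expR (1 * G w))%:E))%E.
    apply: eq_integral => w _; rewrite -EFinM mul1r -mulrA; congr (_ * _)%:E.
    by rewrite -expRD; congr expR; ring.
  rewrite H; last 2 first.
  - by apply/measurable_EFinP; exact: measurable_funM.
  - by move=> x; rewrite lee_fin mulr_ge0 ?expR_ge0.
  rewrite -ge0_integralZl ?lee_fin ?expR_ge0//; last 2 first.
  - apply/measurable_EFinP; apply: measurable_funM => //; apply: (measurableT_comp mF).
    exact: measurable_funD.
  - by move=> x _; rewrite lee_fin mulr_ge0 ?expR_ge0.
  apply: eq_integral => w _; rewrite -EFinM; congr (_%:E).
  rewrite mulr0 add0r expr1n !mul1r mulrCA -expRD subrr expR0 mulr1.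
  by [].
have tot : (\int[P]_w (expR (G w - v / 2))%:E = 1)%E.
  transitivity (\int[P]_w (cst 1 (G w) * expR (G w - v / 2))%:E)%E.
    by apply: eq_integral => w _; rewrite mul1r.
  by rewrite tilt// -[RHS](probability_integral_cst P).
(* On an orthant the indicator of W is replaced by its expectation through independence, the tilt
   moves G, and the indicator is put back. *)
have sets A : measurable (A : set (vec n.+1)) ->
    (\int[P]_w (\1_A (V1 w) * expR (G w - v / 2))%:E =
     \int[P]_w (\1_A (V2 w) * (cst 1 w : R))%:E)%E.
  apply: (@eq_weighted_pi _ _ _ _ _ _ _ P P V1 V2 _ _ (cylinders n.+1)) => //.
  - exact: cylinders_setI.
  - by rewrite tot ltry.
  - by rewrite tot -[LHS](probability_integral_cst P).
  move=> _ [l ->].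
  transitivity (\int[P]_w ((\1_(`]-oo, l n[) (G w) * expR (G w - v / 2)) * ind l n w)%:E)%E.
    by apply: eq_integral => w _; rewrite V_cyl; congr (_%:E); ring.
  transitivity (\int[P]_w (\1_(`]-oo, l n[) (G w + v) * ind l n w)%:E)%E; last first.
    by apply: eq_integral => w _; rewrite V_cyl mulr1.
  have mi : measurable_fun setT (\1_(`]-oo, l n[) : R -> R) by exact: measurable_indic.
  have me : measurable_fun setT (fun x : R => expR (x - v / 2)).
    by apply: measurableT_comp => //; exact: measurable_funB.
  rewrite (factor l (fun x => \1_(`]-oo, l n[) x * expR (x - v / 2))); last 2 first.
  - exact: measurable_funM.
  - by move=> x; rewrite mulr_ge0 ?expR_ge0.
  rewrite (factor l (fun x => \1_(`]-oo, l n[) (x + v))); last 2 first.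
  - by apply: (measurableT_comp mi); exact: measurable_funD.
  - by [].
  rewrite -(tilt (fun x => \1_(`]-oo, l n[) x * Ex (ind l n))); last 2 first.
  - exact: measurable_funM.
  - by move=> x; rewrite mulr_ge0.
  by apply: eq_integral => w _; congr (_%:E); ring.
transitivity (\int[P]_w (f (S (V1 w)) * (expR (G w - v / 2))%:E))%E.
  apply: eq_integral => w _; congr (_ * _)%E; apply: fext => i ni.
  by rewrite /S /V1 ni ltnn /W subrK.
transitivity (\int[P]_w (f (S (V2 w)) * (cst 1 w : R)%:E))%E; last first.
  apply: eq_integral => w _; rewrite mule1; apply: fext => i ni.
  rewrite /S /V2 ni ltnn /W mulrDr divfK ?gt_eqF//.
  by rewrite addrA subrK.
apply: (@eq_integral_weighted _ _ _ _ _ _ _ P P V1 V2 _ _ _ _ _ _ _ _ sets (f \o S)) => //.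
- exact: measurableT_comp.
- by move=> V; exact: f0.
Qed.

End cameron_martin.

(** * Second moment of the tilted difference quotients *)

Section cameron_martin_bounded.
Context d (T : measurableType d) (R : realType) (P : probability T R).
Local Notation Ex := (Ex P).
Local Notation intg := (intg P).
Context (n : nat) (Gam : nat -> T -> R) (C : nat -> nat -> R).
Hypothesis GF : gaussian_family P n Gam C.
Local Notation vecn := (g_sigma_algebraType (@cylinders R n)).

Definition local_on (f : (nat -> R) -> R) : Prop :=
  forall g g', (forall i, (i < n)%N -> g i = g' i) -> f g = f g'.

Lemma measurable_Gam : measurable_fun setT (fun w => (Gam^~ w : vecn)).
Proof. by have [mG _ _ _] := GF; apply: measurable_vec => i _. Qed.

Lemma measurable_shift (e : nat -> R) : measurable_fun setT (fun g : vecn => (fun i => g i + e i) : vecn).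
Proof.
by apply: measurable_vec => i ni; apply: measurable_funD => //; exact: measurable_coord.
Qed.

Lemma Ex_cameron_martin (a : nat -> R) (f : vecn -> R) (M : R) :
  0 < bil n C a a -> measurable_fun setT f -> (forall g, 0 <= f g <= M) -> local_on f ->
  intg (fun w => f (Gam^~ w) * expR (lin n a (Gam^~ w) - bil n C a a / 2)) /\
  Ex (fun w => f (Gam^~ w) * expR (lin n a (Gam^~ w) - bil n C a a / 2)) =
  Ex (fun w => f (fun i => Gam i w + lin n a (C i))).
Proof.
move=> v0 mf fM fl.
have f0 g : 0 <= f g by have /andP[] := fM g.
have mfG : measurable_fun setT (fun w => f (Gam^~ w)).
  exact: (measurableT_comp mf measurable_Gam).
have mfGc : measurable_fun setT (fun w => f (fun i => Gam i w + lin n a (C i))).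
  apply: (measurableT_comp mf (measurableT_comp (measurable_shift (fun i => lin n a (C i))) _)).
  exact: measurable_Gam.
have i2 : intg (fun w => f (fun i => Gam i w + lin n a (C i))).
  by apply: (bounded_intg M) => // w; rewrite ger0_norm; have /andP[] := fM (fun i => Gam i w + lin n a (C i)).
have := @cameron_martin _ _ _ _ _ _ _ GF a v0 (EFin \o f).
rewrite /= (ExE i2) => H.
have {H} E : (\int[P]_x (f (Gam^~ x) * expR (lin n a (Gam^~ x) - bil n C a a / 2))%:E =
    (Ex (fun w => f (fun i => Gam i w + lin n a (C i))))%:E)%E.
  apply: H; first exact/measurable_EFinP.
    by move=> g; rewrite lee_fin.
  by move=> g g' gg'; rewrite (fl _ _ gg').
split; last by rewrite /Ex /Rintegral E.
apply/integrableP; split.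
  apply/measurable_EFinP; apply: measurable_funM => //.
  apply: measurableT_comp => //; apply: measurable_funB => //.
  exact: measurable_lin GF a.
under eq_integral do rewrite /= ger0_norm ?mulr_ge0 ?expR_ge0//.
by rewrite E ltry.
Qed.

Context (Y : nat -> vecn -> R) (M : R) (L : nat -> nat -> R).
Hypothesis mY : forall i, measurable_fun setT (Y i).
Hypothesis YM : forall i g, 0 <= Y i g <= M.
Hypothesis Yl : forall i, local_on (Y i).
Hypothesis C0 : forall i j, 0 <= C i j.
Hypothesis Cd : forall i, 0 < C i i.

(** Each Y_i is composed with the shift by - s C_i and multiplied by the matching Cameron-Martin
    density. As s tends to 0 the quotient tends to the sum of Y_i Gam_i minus the derivative of Y_i
    in the direction C_i, when these derivatives exist. *)
Definition skorokhod_quotient (s : R) (w : T) : R :=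
  \sum_(i < n) (Y i (fun k => Gam k w - s * C k i) *
     expR (s * Gam i w - s ^+ 2 * C i i / 2) - Y i (Gam^~ w)) / s.

Hypothesis YL : forall i j s g, (i < n)%N -> (j < n)%N -> 0 < s ->
  `|Y i (fun k => g k + s * C k j) - Y i g| <= s * L i j.

Let mYs i (e : nat -> R) : measurable_fun setT (fun g : vecn => Y i (fun k => g k + e k)).
Proof. exact: (measurableT_comp (mY i) (measurable_shift e)). Qed.

Lemma measurable_skorokhod_quotient s : measurable_fun setT (skorokhod_quotient s).
Proof.
have [mG _ _ _] := GF; apply: measurable_sum => i; apply: measurable_funM => //.
apply: measurable_funB; last exact: (measurableT_comp (mY i) measurable_Gam).
apply: measurable_funM; last first.
  by apply: measurableT_comp => //; apply: measurable_funB => //; exact: measurable_funM.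
exact: (measurableT_comp (mYs i (fun k => - (s * C k i))) measurable_Gam).
Qed.

Let delta (i : nat) (k : nat) : R := (k == i)%:R.

Let lin_delta i g : (i < n)%N -> lin n (delta i) g = g i.
Proof.
move=> ni; rewrite /lin (bigD1 (Ordinal ni))//= /delta eqxx mul1r big1 ?addr0// => k /negbTE ki.
by rewrite (_ : (k == i :> nat) = false) ?mul0r// -ki.
Qed.

Let bil_delta i j : (i < n)%N -> (j < n)%N -> bil n C (delta i) (delta j) = C i j.
Proof. by move=> ni nj; rewrite bil_lin lin_delta// lin_delta. Qed.

(** Write Y_i^j for Y_i at Gam + s C_j. Expanding the square and shifting every term gives (exp(s^2
    C_ij) - 1) Ex (Y_i^j Y_j^i) + Ex ((Y_i^j - Y_i) (Y_j^i - Y_j)). Divided by s^2, these are the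
    two terms of the Skorokhod isometry. *)
Lemma skorokhod_quotient_second_moment (s : R) : 0 < s ->
  (forall i j, (i < n)%N -> (j < n)%N -> s ^+ 2 * C i j <= 1) ->
  intg (fun w => skorokhod_quotient s w ^+ 2) /\
  Ex (fun w => skorokhod_quotient s w ^+ 2) <=
  \sum_(i < n) \sum_(j < n) (4 * M ^+ 2 * C i j + L i j * L j i).
Proof.
move=> s0 sC; have [mG CC _ _] := GF.
have M0 : 0 <= M by have /andP[] := YM 0%N (fun=> 0); exact: le_trans.
pose A i w := Y i (fun k => Gam k w - s * C k i) * expR (s * Gam i w - s ^+ 2 * C i i / 2).
pose Y0 i w := Y i (Gam^~ w).
pose Yp i j w := Y i (fun k => Gam k w + s * C k j).
have mY0 i : measurable_fun setT (Y0 i) by exact: (measurableT_comp (mY i) measurable_Gam).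
have mYp i j : measurable_fun setT (Yp i j).
  exact: (measurableT_comp (mYs i (fun k => s * C k j)) measurable_Gam).
have bM (f g x y : R) : 0 <= f <= x -> 0 <= g <= y -> 0 <= f * g <= x * y.
  by move=> /andP[f0 fx] /andP[g0 gy]; rewrite mulr_ge0//= ler_pM.
have iY i j : intg (fun w => Y0 i w * Y0 j w).
  apply: (bounded_intg (M * M)); first exact: measurable_funM.
  by move=> w; have /andP[? ?] := bM _ _ _ _ (YM i (Gam^~ w)) (YM j (Gam^~ w)); rewrite ger0_norm.
have iYpp i j i' j' : intg (fun w => Yp i j w * Yp i' j' w).
  apply: (bounded_intg (M * M)); first exact: measurable_funM.
  by move=> w; have /andP[? ?] := bM _ _ _ _ (YM i (fun k => Gam k w + s * C k j)) (YM i' (fun k => Gam k w + s * C k j')); rewrite ger0_norm.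
have iYp i j k : intg (fun w => Yp i j w * Y0 k w).
  apply: (bounded_intg (M * M)); first exact: measurable_funM.
  by move=> w; have /andP[? ?] := bM _ _ _ _ (YM i (fun k => Gam k w + s * C k j)) (YM k (Gam^~ w)); rewrite ger0_norm.
have shiftl i j : local_on (fun g => Y i (fun k => g k + - (s * C k j))).
  by move=> g g' gg'; apply: Yl => k nk; rewrite gg'.
have hAA i j : (i < n)%N -> (j < n)%N -> intg (fun w => A i w * A j w) /\
    Ex (fun w => A i w * A j w) = expR (s ^+ 2 * C i j) * Ex (fun w => Yp i j w * Yp j i w).
  (* A_i A_j carries the density of the shift by s (C_i + C_j), up to the factor exp(s^2 C_ij) from
     the cross term of the variance. The shift turns Y_i(Gam - s C_i) into Y_i(Gam + s C_j). *)
  move=> ni nj; pose a k := s * delta i k + s * delta j k.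
  have aa : bil n C a a = s ^+ 2 * (C i i + C i j *+ 2 + C j j).
    rewrite bilD2// !bil_delta//; ring.
  have aa0 : 0 < bil n C a a.
    rewrite aa mulr_gt0 ?exprn_gt0// -addrA ltr_wpDr// addr_ge0// ?mulrn_wge0//.
  have la g : lin n a g = s * g i + s * g j by rewrite linDl !lin_delta.
  have [] := @Ex_cameron_martin a (fun g => Y i (fun k => g k + - (s * C k i)) *
    Y j (fun k => g k + - (s * C k j))) (M * M) aa0.
  - by apply: measurable_funM; exact: mYs.
  - by move=> g; apply: bM.
  - by move=> g g' gg'; rewrite (shiftl i i _ _ gg') (shiftl j j _ _ gg').
  move=> I1 E1.
  have AE : (fun w => A i w * A j w) = (fun w => expR (s ^+ 2 * C i j) *
      (Y i (fun k => Gam k w + - (s * C k i)) * Y j (fun k => Gam k w + - (s * C k j)) *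
      expR (lin n a (Gam^~ w) - bil n C a a / 2))).
    apply/funext => w; rewrite /A la aa.
    set p := s * Gam i w - s ^+ 2 * C i i / 2; set q := s * Gam j w - s ^+ 2 * C j j / 2.
    set r := s ^+ 2 * C i j.
    have -> : s * Gam i w + s * Gam j w - s ^+ 2 * (C i i + C i j *+ 2 + C j j) / 2 =
      p + q + - r by rewrite /p /q /r; field.
    have r1 : expR r * expR (- r) = 1 by rewrite -expRD subrr expR0.
    rewrite (expRD (p + q)) (expRD p); set y1 := Y i _; set y2 := Y j _; set ep := expR p; set eq := expR q.
    transitivity (y1 * y2 * (ep * eq) * (expR r * expR (- r))); first by rewrite r1; ring.
    by ring.
  rewrite AE; split; first exact: intgZ.
  rewrite ExZ// E1; congr (_ * Ex _); apply/funext => w; rewrite /Yp; congr (Y _ _ * Y _ _);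
    by apply/funext => k; rewrite la (CC k i) (CC k j); ring.
have hAY i j : (i < n)%N -> (j < n)%N -> intg (fun w => A i w * Y0 j w) /\
    Ex (fun w => A i w * Y0 j w) = Ex (fun w => Yp j i w * Y0 i w).
  move=> ni nj; pose a k := s * delta i k + 0 * delta i k.
  have aa : bil n C a a = s ^+ 2 * C i i.
    by rewrite bilD2// !bil_delta//; ring.
  have aa0 : 0 < bil n C a a by rewrite aa mulr_gt0 ?exprn_gt0.
  have la g : lin n a g = s * g i by rewrite linDl !lin_delta// mul0r addr0.
  have [] := @Ex_cameron_martin a (fun g => Y i (fun k => g k + - (s * C k i)) *
    Y j g) (M * M) aa0.
  - by apply: measurable_funM => //; exact: mYs.
  - by move=> g; apply: bM.
  - by move=> g g' gg'; rewrite (shiftl i i _ _ gg') (Yl j gg').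
  move=> I1 E1.
  have AE : (fun w => A i w * Y0 j w) = (fun w =>
      Y i (fun k => Gam k w + - (s * C k i)) * Y j (Gam^~ w) *
      expR (lin n a (Gam^~ w) - bil n C a a / 2)).
    by apply/funext => w; rewrite /A la aa /Y0; ring.
  rewrite AE; split => //.
  rewrite E1; congr (Ex _); apply/funext => w; rewrite /Yp /Y0 mulrC; congr (Y _ _ * Y _ _);
    by apply/funext => k; rewrite la (CC k i); ring.
have bnd i j : (i < n)%N -> (j < n)%N ->
    intg (fun w => (A i w - Y0 i w) * (A j w - Y0 j w)) /\
    Ex (fun w => (A i w - Y0 i w) * (A j w - Y0 j w)) <=
    s ^+ 2 * (4 * M ^+ 2 * C i j + L i j * L j i).
  move=> ni nj; have [I1 E1] := hAA _ _ ni nj; have [I2 E2] := hAY _ _ ni nj.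
  have [I3 E3] := hAY _ _ nj ni; have I4 := iY i j.
  have I12 := intgB I1 I2; have I123 := intgB I12 I3; have I1234 := intgD I123 I4.
  have XE : (fun w => (A i w - Y0 i w) * (A j w - Y0 j w)) =
    (fun w => A i w * A j w - A i w * Y0 j w - A j w * Y0 i w + Y0 i w * Y0 j w).
    by apply/funext => w; ring.
  rewrite XE; split => //.
  rewrite (ExD I123 I4) (ExB I12 I3) (ExB I1 I2) E1 E2 E3.
  have J1 := iYpp i j j i; have J2 := iYp j i i; have J3 := iYp i j j.
  (* Once this expectation is rewritten, the four terms collapse to a product of increments of Y and
     a multiple of exp(s^2 C_ij) - 1. *)
  have -> : Ex (fun w => Y0 i w * Y0 j w) = Ex (fun w => (Yp i j w - Y0 i w) * (Yp j i w - Y0 j w))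
     - Ex (fun w => Yp i j w * Yp j i w) + Ex (fun w => Yp j i w * Y0 i w) + Ex (fun w => Yp i j w * Y0 j w).
    have K1 := intgB J1 J2; have K2 := intgB K1 J3; have K3 := intgD K2 I4.
    have -> : (fun w => (Yp i j w - Y0 i w) * (Yp j i w - Y0 j w)) =
      (fun w => Yp i j w * Yp j i w - Yp j i w * Y0 i w - Yp i j w * Y0 j w + Y0 i w * Y0 j w).
      by apply/funext => w; ring.
    by rewrite (ExD K2 I4) (ExB K1 J3) (ExB J1 J2); ring.
  have b1 : Ex (fun w => Yp i j w * Yp j i w) <= M * M.
    rewrite -[leRHS](Ex_cst P); apply: le_Ex => //.
      by apply: (bounded_intg (M * M)) => // w; rewrite ger0_norm// mulr_ge0.
    by move=> w; have /andP[] := bM _ _ _ _ (YM i (fun k => Gam k w + s * C k j)) (YM j (fun k => Gam k w + s * C k i)).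
  have b1' : 0 <= Ex (fun w => Yp i j w * Yp j i w).
    apply: Rintegral_ge0 => w _.
    by have /andP[] := bM _ _ _ _ (YM i (fun k => Gam k w + s * C k j)) (YM j (fun k => Gam k w + s * C k i)).
  have b2 : `|Ex (fun w => (Yp i j w - Y0 i w) * (Yp j i w - Y0 j w))| <= s ^+ 2 * (L i j * L j i).
    have bw w : `|(Yp i j w - Y0 i w) * (Yp j i w - Y0 j w)| <= s ^+ 2 * (L i j * L j i).
      have -> : s ^+ 2 * (L i j * L j i) = (s * L i j) * (s * L j i) by ring.
      by rewrite normrM ler_pM// YL.
    rewrite -[leRHS](Ex_cst P); apply: norm_Ex_le => //.
      apply: (bounded_intg (s ^+ 2 * (L i j * L j i))) => //.
      by apply: measurable_funM; exact: measurable_funB.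
    apply: (bounded_intg (s ^+ 2 * (L i j * L j i))) => // w.
    by rewrite ger0_norm// (le_trans _ (bw w)).
  (* From exp(- y / 2) >= 1 - y / 2 follows exp y <= (1 - y / 2)^(-2) <= 4 on [0, 1]; this is the 4
     of the bound. *)
  have b3 : expR (s ^+ 2 * C i j) - 1 <= 4 * (s ^+ 2 * C i j).
    have := sC _ _ ni nj; have : 0 <= s ^+ 2 * C i j by rewrite mulr_ge0// sqr_ge0.
    set y := s ^+ 2 * C i j => y0 y1.
    have h : (1 - y / 2) ^- 2 >= expR y.
      rewrite -[leLHS]invrK -expRN lef_pV2 ?posrE ?expR_gt0 ?exprn_gt0//; last by lra.
      have -> : - y = - (y / 2) + - (y / 2) by field.
      rewrite expRD expr2 ler_pM ?expR_ge0//; try lra;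
        by have := expR_ge1Dx (- (y / 2)); lra.
    have h4 : (1 - y / 2) ^- 2 <= 4.
      rewrite -[leLHS]mul1r ler_pdivrMr ?exprn_gt0//; last by lra.
      by nra.
    have := expRB1_le y; rewrite (ger0_norm y0) => /(le_trans (ler_norm _)) h5.
    have : y * expR y <= y * 4 by rewrite ler_wpM2l// (le_trans h).
    by lra.
  have : (expR (s ^+ 2 * C i j) - 1) * Ex (fun w => Yp i j w * Yp j i w) <=
      4 * (s ^+ 2 * C i j) * (M * M).
    apply: ler_pM => //.
    by have := expR_ge1Dx (s ^+ 2 * C i j); have : 0 <= s ^+ 2 * C i j by [rewrite mulr_ge0// sqr_ge0]; lra.
  move: b2; rewrite ler_norml => /andP[_].
  lra.
pose U i w := (A i w - Y0 i w) / s.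
have ZE : (fun w => skorokhod_quotient s w ^+ 2) =
    (fun w => \sum_(i < n) \sum_(j < n) (s ^- 2 * ((A i w - Y0 i w) * (A j w - Y0 j w)))).
  apply/funext => w; rewrite expr2 /skorokhod_quotient mulr_suml; apply: eq_bigr => i _.
  rewrite mulr_sumr; apply: eq_bigr => j _; rewrite -/(A i w) -/(A j w) -/(Y0 i w) -/(Y0 j w).
  by field; rewrite gt_eqF.
have iU i j : (i < n)%N -> (j < n)%N -> intg (fun w => s ^- 2 * ((A i w - Y0 i w) * (A j w - Y0 j w))).
  by move=> ni nj; apply: intgZ; have [] := bnd i j ni nj.
have iUs i : (i < n)%N -> intg (fun w => \sum_(j < n) (s ^- 2 * ((A i w - Y0 i w) * (A j w - Y0 j w)))).
  move=> ni; apply: (intgS (F := fun j w => s ^- 2 * ((A i w - Y0 i w) * (A j w - Y0 j w)))).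
  by move=> j nj; exact: iU.
rewrite ZE; split.
  by apply: (intgS (F := fun i w => \sum_(j < n) (s ^- 2 * ((A i w - Y0 i w) * (A j w - Y0 j w))))).
rewrite (ExS (F := fun i w => \sum_(j < n) (s ^- 2 * ((A i w - Y0 i w) * (A j w - Y0 j w)))))//.
apply: ler_sum => i _.
rewrite (ExS (F := fun j w => s ^- 2 * ((A i w - Y0 i w) * (A j w - Y0 j w)))); last first.
  by move=> j nj; exact: iU.
apply: ler_sum => j _; have [I E] := bnd i j (ltn_ord i) (ltn_ord j).
by rewrite ExZ// mulrC ler_pdivrMr ?exprn_gt0// mulrC.
Qed.

End cameron_martin_bounded.

(** * Tail bounds passed to almost sure limits *)

Section chebyshev.
Context d (T : measurableType d) (R : realType) (P : probability T R).
Local Notation Ex := (Ex P).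
Local Notation intg := (intg P).

Lemma measurable_norm_gt (Z : T -> R) (a : R) : measurable_fun setT Z ->
  measurable [set w | a < `|Z w|].
Proof.
move=> mZ; rewrite -[X in measurable X]setTI.
have -> : [set w | a < `|Z w|] = (fun w => `|Z w|) @^-1` `]a, +oo[.
  by apply/seteqP; split => w /=; rewrite in_itv/= andbT.
by apply: (measurableT_comp (@normr_measurable R setT) mZ).
Qed.

Lemma chebyshev_sq (Z : T -> R) (a : R) : measurable_fun setT Z ->
  intg (fun w => Z w ^+ 2) -> 0 < a ->
  (P [set w | (a < `|Z w|)%R] <= (Ex (fun w => Z w ^+ 2) / a ^+ 2)%:E)%E.
Proof.
move=> mZ iZ a0; have mA := measurable_norm_gt a mZ.
have iA : intg (\1_[set w | a < `|Z w|] : T -> R).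
  apply: (bounded_intg 1); first exact: measurable_indic.
  by move=> w; rewrite indicE; case: (_ \in _); rewrite ?normr1 ?normr0.
rewrite -[X in P X]setIT -integral_indic// (ExE iA) lee_fin ler_pdivlMr ?exprn_gt0//.
rewrite mulrC -ExZ//; apply: le_Ex => //; first exact: intgZ.
move=> w; rewrite indicE; case: (boolP (w \in _)) => [/set_mem/= aZ|_].
  by rewrite mulr1 -[leRHS]real_normK ?num_real// lerXn2r// ?nnegrE ?ltW.
by rewrite mulr0 sqr_ge0.
Qed.

(** Fatou's lemma for sets: up to a null set, A lies in the increasing union over m of the
    intersections of [F n] for n >= m, each of measure at most c. The outer measure admits a
    non-measurable A. *)
Lemma mu_ext_le_liminf (A : set T) (F : nat -> set T) (c : \bar R) (n0 : nat) :
  (forall n, measurable (F n)) ->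
  {ae P, forall w, A w -> exists m, forall n, (m <= n)%N -> F n w} ->
  (forall n, (n0 <= n)%N -> (P (F n) <= c)%E) -> (mu_ext P A <= c)%E.
Proof.
move=> mF [N [mN PN NA]] Fc.
(* Starting at [maxn m n0] puts into each intersection some [F n] whose measure is bounded by c. *)
pose G m := \bigcap_(n in [set n | (maxn m n0 <= n)%N]) F n.
have mG m : measurable (G m) by apply: bigcap_measurableType.
have mUG : measurable (\bigcup_m G m) by exact: bigcupT_measurable.
have PUG : (P (\bigcup_m G m) <= c)%E.
  have GG : {homo G : n m / (n <= m)%N >-> (n <= m)%O}.
    move=> p q pq; apply/subsetPset => w Gw n /= qn; apply: Gw => /=.
    by apply: leq_trans qn; rewrite geq_max leq_maxr (leq_trans pq) ?leq_maxl.
  have cv := nondecreasing_cvg_mu (mu := P) mG mUG GG.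
  rewrite -(cvg_lim _ cv)//; apply: lime_le; first by apply/cvg_ex; eexists; exact: cv.
  apply: nearW => m /=; apply: (le_trans _ (Fc (maxn m n0) (leq_maxr _ _))).
  by apply: le_measure; rewrite ?inE//; apply: bigcap_inf => /=.
have sub : A `<=` (\bigcup_m G m) `|` N.
  move=> w Aw; have [Nw|Nw] := pselect (N w); first by right.
  left; have [|m Hm] := contrapT (fun x => Nw (NA _ x)) _.
    by exact: Aw.
  by exists m => // n /= mn; apply: Hm; rewrite (leq_trans _ mn)// leq_maxl.
apply: (le_trans (le_mu_ext _ sub)); rewrite measurable_mu_extE//; last exact: measurableU.
apply: (le_trans (measureU2 _ _ _)) => //.
have PN' : (P N <= 0)%E := eq_ind_r (fun x => (x <= 0)%E) (lexx _) PN.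
by apply: (le_trans (leeD PUG PN')); rewrite adde0.
Qed.

(** The strict inequality is an open condition, so it passes from the limit to [Z_ n] for all large
    n. *)
Lemma mu_ext_le_limit (Z_ : nat -> T -> R) (Z : T -> R) (a : R) (c : \bar R) (n0 : nat) :
  (forall n, measurable_fun setT (Z_ n)) ->
  {ae P, forall w, Z_ n w @[n --> \oo] --> Z w} ->
  (forall n, (n0 <= n)%N -> (P [set w | (a < `|Z_ n w|)%R] <= c)%E) ->
  (mu_ext P [set w | (a < `|Z w|)%R] <= c)%E.
Proof.
move=> mZ ZZ; apply: mu_ext_le_liminf; first by move=> n; exact: measurable_norm_gt.
apply: filterS ZZ => w /cvg_norm cZ /= aZ.
by have [m _ Hm] := cvgr_gt _ cZ _ aZ; exists m => n /Hm.
Qed.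

End chebyshev.

Lemma is_derive_harmonic (R : realType) (f : R -> R) (D : R) :
  is_derive (0 : R) (1 : R) f D ->
  (f (harmonic n) - f 0) / harmonic n @[n --> \oo] --> D.
Proof.
case=> df <-.
have H : h^-1 *: (f (h *: (1 : R) + 0) - f 0) @[h --> 0^'] --> 'D_1 f 0 by exact: df.
apply/cvgrPdist_lt => e e0; move/cvgrPdist_lt: H => /(_ e e0) H.
have {}H := @cvg_harmonic R _ H; near=> n.
have h0 : harmonic n != 0 :> R by rewrite gt_eqF// harmonic_gt0.
have : harmonic n != 0 :> R -> `|'D_1 f 0 - (harmonic n)^-1 *: (f (harmonic n *: (1 : R) + 0) - f 0)| < e.
  by near: n; exact: H.
by move=> /(_ h0); rewrite /GRing.scale/= mulr1 addr0 mulrC.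
Unshelve. all: by end_near. Qed.

Lemma cvg_sum_ord (R : realType) (n : nat) (f : nat -> nat -> R) (l : nat -> R) :
  (forall i, (i < n)%N -> f i m @[m --> \oo] --> l i) ->
  \sum_(i < n) f i m @[m --> \oo] --> \sum_(i < n) l i.
Proof.
elim: n => [|n IH] H.
  by under eq_fun do rewrite big_ord0; rewrite big_ord0; exact: cvg_cst.
under eq_fun do rewrite big_ord_recr/=; rewrite big_ord_recr/=.
by apply: cvgD; [apply: IH => i ni; apply: H; rewrite ltnS ltnW|exact: H].
Qed.

Lemma is_derive_continuous (R : realType) (f df : R -> R) :
  (forall x : R, is_derive x (1 : R) f (df x)) -> continuous f.
Proof.
by move=> fdf x; apply/differentiable_continuous/derivable1_diffP; have [] := fdf x.
Qed.

(** * The Euler scheme and its derivatives in the noise *)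

Section euler.
Context {R : realType}.
Context (b db : R -> R) (Delta sigma y0 : R).

Fixpoint euler (g : nat -> R) (m : nat) : R :=
  if m is m'.+1 then euler g m' + b (euler g m') * Delta + sigma * g m' else y0.

(** Majorant of the effect of a perturbation c of the noise when each Euler step contracts by
    rho. *)
Fixpoint geom_acc (rho : R) (c : nat -> R) (m : nat) : R :=
  if m is m'.+1 then rho * geom_acc rho c m' + c m' else 0.

(** Derivative of [euler] in the noise direction c, with the factor sigma left out. *)
Fixpoint euler_diff (g c : nat -> R) (m : nat) : R :=
  if m is m'.+1 then (1 + db (euler g m') * Delta) * euler_diff g c m' + c m' else 0.

Lemma eq_euler g g' m : (forall i, (i < m)%N -> g i = g' i) -> euler g m = euler g' m.
Proof.
elim: m => [//|m IH] gg' /=; rewrite IH ?gg'// => i im.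
by apply: gg'; rewrite ltnS ltnW.
Qed.

Lemma measurable_euler n m : measurable_fun setT b -> (m <= n)%N ->
  measurable_fun setT (fun g : g_sigma_algebraType (@cylinders R n) => euler g m).
Proof.
move=> mb; elim: m => [_|m IH mn] /=; first exact: measurable_cst.
have mE := IH (ltnW mn).
apply: measurable_funD; last by apply: measurable_funM => //; exact: measurable_coord.
by apply: measurable_funD => //; apply: measurable_funM => //; exact: (measurableT_comp mb).
Qed.

Lemma geom_acc_ge0 rho c m : 0 <= rho -> (forall i, 0 <= c i) -> 0 <= geom_acc rho c m.
Proof. by move=> r0 c0; elim: m => [//|m IH] /=; rewrite addr_ge0// mulr_ge0. Qed.

Lemma euler_shift_le rho g c s m : 0 <= rho -> 0 <= s -> (forall i, 0 <= c i) ->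
  (forall x y, `|x + b x * Delta - (y + b y * Delta)| <= rho * `|x - y|) ->
  `|euler (fun i => g i + s * c i) m - euler g m| <= s * (`|sigma| * geom_acc rho c m).
Proof.
move=> r0 s0 c0 H; elim: m => [|m IH] /=; first by rewrite subrr normr0 !mulr0.
set X := euler _ m; set X' := euler g m.
have -> : X + b X * Delta + sigma * (g m + s * c m) - (X' + b X' * Delta + sigma * g m) =
  (X + b X * Delta - (X' + b X' * Delta)) + s * (sigma * c m) by ring.
apply: (le_trans (ler_normD _ _)).
rewrite mulrDr mulrDr lerD//; last by rewrite !normrM !(ger0_norm s0) (ger0_norm (c0 m)).
apply: (le_trans (H _ _)); rewrite [X in _ <= X](_ : _ = rho * (s * (`|sigma| * geom_acc rho c m))).
  by rewrite ler_wpM2l.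
by ring.
Qed.

Hypothesis bdb : forall x : R, is_derive x (1 : R) b (db x).

Lemma is_derive_euler g c m :
  is_derive (0 : R) (1 : R) (fun s => euler (fun i => g i - s * c i) m)
    (- (sigma * euler_diff g c m)).
Proof.
elim: m => [|m IH] /=; first by rewrite mulr0 oppr0; exact: is_derive_cst.
have e0 : euler (fun i => g i - 0 * c i) m = euler g m.
  by congr euler; apply/funext => i; rewrite mul0r subr0.
have := @is_derive1_comp _ b (fun s => euler (fun i => g i - s * c i) m) 0
  (db (euler g m)) (- (sigma * euler_diff g c m)).
rewrite e0 => /(_ (bdb _) IH) H.
apply: is_derive_eq; rewrite /GRing.scale/=; ring.
Qed.

(** The divergence of the vector with entries k(X_i): the noise times the entry, minus the
    derivative of the entry in the direction of column i of C. Since [euler g i] sees only the noise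
    before i, this derivative involves the [C j i] with j < i. *)
Definition discrete_skorokhod (k dk : R -> R) (C : nat -> nat -> R) (n : nat) (g : nat -> R) : R :=
  \sum_(i < n) (g i * k (euler g i) -
    dk (euler g i) * (sigma * euler_diff g (fun j => C j i) i)).

(** Variation of constants: increment l enters at step l and is multiplied by the factors of index l
    + 1 to m - 1, hence p at l + 1. *)
Lemma euler_diffE g c m : (forall i, (i < m)%N -> 1 + db (euler g i) * Delta != 0) ->
  let p l := \prod_(j < l) (1 + db (euler g j) * Delta) in
  euler_diff g c m = p m * \sum_(l < m) c l / p l.+1.
Proof.
move=> H p; elim: m H => [|m IH] H /=; first by rewrite big_ord0 mulr0.
rewrite IH; last by move=> i im; apply: H; rewrite ltnS ltnW.
have p0 : p m.+1 != 0 by apply/prodf_neq0 => i _; exact: H.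
rewrite big_ord_recr/= mulrDr [p m.+1 * (_ / _)]mulrC divfK// mulrA.
have -> : p m.+1 = p m * (1 + db (euler g m) * Delta) by rewrite /p big_ord_recr.
by rewrite [p m * _]mulrC.
Qed.

End euler.

Section euler_skorokhod.
Context d (T : measurableType d) (R : realType) (P : probability T R).
Context (n : nat) (Gam : nat -> T -> R) (C : nat -> nat -> R).
Hypothesis GF : gaussian_family P n Gam C.
Hypothesis C0 : forall i j, 0 <= C i j.
Hypothesis Cd : forall i, 0 < C i i.
Context (b db k dk : R -> R) (Delta sigma y0 rho M M1 : R).
Hypothesis bdb : forall x : R, is_derive x (1 : R) b (db x).
Hypothesis kdk : forall x : R, is_derive x (1 : R) k (dk x).
Hypothesis kM : forall x, 0 <= k x <= M.
Hypothesis kM1 : forall x y, `|k x - k y| <= M1 * `|x - y|.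
Hypothesis rho0 : 0 <= rho.
Hypothesis brho : forall x y, `|x + b x * Delta - (y + b y * Delta)| <= rho * `|x - y|.

(** [minn i n] keeps [Y i] a function of the first n coordinates also for i >= n, as the
    second-moment lemma quantifies over all i. *)
Let Y (i : nat) (g : nat -> R) : R := k (euler b Delta sigma y0 g (minn i n)).
Let L i j : R := M1 * (`|sigma| * geom_acc rho (fun l => C l j) i).

Let dsk : T -> R := fun w =>
  discrete_skorokhod b db Delta sigma y0 k dk C n (Gam^~ w).

Let Yq (s : R) (w : T) : R := @skorokhod_quotient d T R n Gam C Y s w.

Let mY i : measurable_fun setT (Y i : g_sigma_algebraType (@cylinders R n) -> R).
Proof.
apply: (measurableT_comp (continuous_measurable_fun (is_derive_continuous kdk))).
apply: measurable_euler; last exact: geq_minr.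
exact: continuous_measurable_fun (is_derive_continuous bdb).
Qed.

Let mYq s : measurable_fun setT (Yq s).
Proof. exact: (measurable_skorokhod_quotient GF). Qed.

Let Yq_cvg w : Yq (harmonic m) w @[m --> \oo] --> dsk w.
Proof.
set g := Gam^~ w; pose f i s := k (euler b Delta sigma y0 (fun l => g l - s * C l i) i) *
  expR (s * g i - s ^+ 2 * C i i / 2).
pose D i := g i * k (euler b Delta sigma y0 g i) - dk (euler b Delta sigma y0 g i) *
  (sigma * euler_diff b db Delta sigma y0 g (fun j => C j i) i).
have e0 i : euler b Delta sigma y0 (fun l => g l - 0 * C l i) i = euler b Delta sigma y0 g i.
  by congr euler; apply/funext => l; rewrite mul0r subr0.
have f0 i : f i 0 = k (euler b Delta sigma y0 g i).
  by rewrite /f e0 expr0n/= !mul0r subrr expR0 mulr1.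
have fD i : is_derive (0 : R) (1 : R) (f i) (D i).
  have H1 := is_derive_euler Delta sigma y0 bdb g (fun j => C j i) i.
  have := @is_derive1_comp _ k (fun s => euler b Delta sigma y0 (fun l => g l - s * C l i) i) 0
    (dk (euler b Delta sigma y0 g i)) _.
  rewrite e0 => /(_ _ (kdk _) H1) H2.
  apply: is_derive_eq; rewrite /= e0 /GRing.scale/= expr0n/= !mul0r subrr expR0 /D.
  by ring.
rewrite /dsk /discrete_skorokhod.
have YE m : Yq (harmonic m) w = \sum_(i < n) ((f i (harmonic m) - f i 0) / harmonic m).
  rewrite /Yq /skorokhod_quotient; apply: eq_bigr => i _.
  by rewrite f0 /Y (minn_idPl (ltnW (ltn_ord i))).
under eq_fun do rewrite YE.
apply: (@cvg_sum_ord _ n (fun i m => (f i (harmonic m) - f i 0) / harmonic m) D) => i _.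
exact: is_derive_harmonic.
Qed.

Lemma measurable_discrete_skorokhod : measurable_fun setT dsk.
Proof.
by apply: (@measurable_fun_cvg _ _ _ _ (fun m => Yq (harmonic m))) => // w _; exact: Yq_cvg.
Qed.

(** The second moment is bounded for the quotient at s = [harmonic m]; Chebyshev's bound is uniform
    in m and survives the limit. *)
Lemma discrete_skorokhod_tail a : 0 < a ->
  (P [set w | (a < `|dsk w|)%R] <=
   ((\sum_(i < n) \sum_(j < n) (4 * M ^+ 2 * C i j + L i j * L j i)) / a ^+ 2)%:E)%E.
Proof.
move=> a0; rewrite -measurable_mu_extE; last exact: measurable_norm_gt measurable_discrete_skorokhod.
pose Cs := \sum_(i < n) \sum_(j < n) C i j.
have Cs0 : 0 <= Cs by apply: sumr_ge0 => i _; apply: sumr_ge0.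
have CCs i j : (i < n)%N -> (j < n)%N -> C i j <= Cs.
  move=> ni nj; rewrite /Cs (bigD1 (Ordinal ni))//= (bigD1 (Ordinal nj))//= -addrA lerDl.
  rewrite addr_ge0//; first by rewrite sumr_ge0.
  by rewrite sumr_ge0// => l Hl; rewrite sumr_ge0.
(* From [m0] on, s^2 C_ij <= 1 for all entries at once, each being at most their sum [Cs]. *)
have [m0 m0P] : exists m0, forall m, (m0 <= m)%N -> (harmonic m : R) <= (Cs + 1)^-1.
  have c0 : 0 < (Cs + 1)^-1 by rewrite invr_gt0 ltr_wpDl.
  by have [m0 _ H] := cvgr_le _ (@cvg_harmonic R) _ c0; exists m0.
apply: (@mu_ext_le_limit _ _ _ P (fun m => Yq (harmonic m)) _ _ _ m0) => //.
  by apply: aeW; exact: Yq_cvg.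
move=> m mm0; have h0 : 0 < (harmonic m : R) := harmonic_gt0 m.
have [||||iq Eq] := @skorokhod_quotient_second_moment _ _ _ P n Gam C GF Y M L mY _ _ C0 Cd _ _ h0.
- by move=> i g; exact: kM.
- move=> i g g' gg'; rewrite /Y; congr k; apply: eq_euler => l li; apply: gg'.
  exact: leq_trans li (geq_minr _ _).
- move=> i j s g ni nj s0; rewrite /Y (minn_idPl (ltnW ni)).
  apply: (le_trans (kM1 _ _)); rewrite /L mulrCA; apply: ler_wpM2l.
    by have := le_trans (normr_ge0 _) (kM1 1 0); rewrite subr0 normr1 mulr1.
  by apply: euler_shift_le => //; exact: ltW.
- move=> i j ni nj; have h1 := m0P _ mm0.
  have Cs1 : 0 < Cs + 1 by rewrite ltr_wpDl.
  have h2 : harmonic m * (Cs + 1) <= 1 :> R by rewrite -ler_pdivlMr// mul1r.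
  have h3 : harmonic m <= 1 :> R by rewrite invf_le1 ?ler1n.
  have hC : harmonic m * C i j <= harmonic m * (Cs + 1) :> R.
    by apply: ler_wpM2l; [exact: ltW|apply: (le_trans (CCs _ _ ni nj)); rewrite lerDl].
  rewrite expr2 -mulrA; apply: (@le_trans _ _ (1 * (harmonic m * C i j))); last by lra.
  by apply: ler_wpM2r => //; rewrite mulr_ge0// ltW.
apply: (le_trans (chebyshev_sq (mYq _) iq a0)); rewrite lee_fin.
by rewrite ler_pM2r ?invr_gt0 ?exprn_gt0.
Qed.

End euler_skorokhod.

Lemma powR_MVT (R : realType) (q x y : R) : 0 < x -> x < y ->
  exists2 c, x < c < y & y `^ q - x `^ q = q * c `^ (q - 1) * (y - x).
Proof.
move=> x0 xy.
have D z : x <= z -> is_derive z (1 : R) (powR (R:=R) ^~ q) (q * z `^ (q - 1)).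
  move=> xz; have z0 : z \in `]0, +oo[ by rewrite in_itv/= andbT (lt_le_trans x0).
  by apply: DeriveDef; [exact: derivable_powR|rewrite -derive1E powR_derive1].
have [||c] := @MVT R (powR (R:=R) ^~ q) (fun c => q * c `^ (q - 1)) x y xy.
- by move=> z; rewrite in_itv/= => /andP[xz _]; apply: D; exact: ltW.
- apply: derivable_within_continuous => z; rewrite in_itv/= => /andP[xz _].
  by have [] := D z xz.
by rewrite in_itv/= => xcy E; exists c.
Qed.

(** * Covariances of fractional Gaussian noise and their damped sums *)

Section fbm_covariance.
Context {R : realType} (p Delta : R).
Hypotheses (p1 : 1 < p) (p2 : p < 2) (Delta0 : 0 < Delta).

Let D (m : nat) : R := m.+1%:R `^ p - m%:R `^ p.

(** With p = 2H, the covariance of two increments m cells apart: half the second difference of z^p,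
    scaled by Delta^p. The case m = 0 is the variance. *)
Definition fgn_cov_dist (m : nat) : R :=
  if m is m'.+1 then Delta `^ p / 2 * (D m - D m') else Delta `^ p.
Local Notation cn := fgn_cov_dist.

(** In truncated subtraction the argument is the distance between i and j. *)
Definition fgn_cov (i j : nat) : R := cn ((i - j) + (j - i))%N.

Let Dp0 : 0 < Delta `^ p. Proof. exact: powR_gt0. Qed.

Let D0 : D 0 = 1. Proof. by rewrite /D powR1 powR0 ?subr0 // gt_eqF// (lt_trans ltr01). Qed.

Let Db m : p * m%:R `^ (p - 1) <= D m <= p * m.+1%:R `^ (p - 1).
Proof.
case: m => [|m].
  by rewrite D0 powR1 mulr1 powR0 ?mulr0 ?ler01 ?(ltW p1)// gt_eqF// subr_gt0.
have m0 : 0 < m.+1%:R :> R by [].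
have mm : m.+1%:R < m.+2%:R :> R by rewrite ltr_nat.
have [c /andP[mc cm]] := powR_MVT p m0 mm.
rewrite /D => ->; rewrite [_.+2%:R - _](_ : _ = 1) ?mulr1; last by rewrite -natrB// subSnn.
have c0 : 0 < c := lt_trans m0 mc.
have pm1 : 0 <= p - 1 by rewrite subr_ge0 ltW.
by apply/andP; split; (apply: ler_wpM2l; [exact: ltW (lt_trans ltr01 p1)|]);
  apply: ge0_ler_powR; rewrite ?nnegrE// ltW.
Qed.

Let Dmono m : D m <= D m.+1.
Proof. by have /andP[_ h1] := Db m; have /andP[h2 _] := Db m.+1; exact: le_trans h2. Qed.

Lemma fgn_cov_dist_ge0 m : 0 <= cn m.
Proof. by case: m => [|m] /=; rewrite ?(ltW Dp0)// mulr_ge0 ?subr_ge0// divr_ge0// ltW. Qed.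

Lemma fgn_cov_ge0 i j : 0 <= fgn_cov i j.
Proof. exact: fgn_cov_dist_ge0. Qed.

Lemma fgn_cov_diag i : 0 < fgn_cov i i.
Proof. by rewrite /fgn_cov subnn. Qed.

Let D_le_mono m n : (m <= n)%N -> D m <= D n.
Proof.
by move=> mn; rewrite -(subnK mn); elim: (n - m)%N => [//|k IH]; rewrite addSn (le_trans IH).
Qed.

Let sum_cn q : \sum_(m < q.+1) cn m = Delta `^ p / 2 * (1 + D q).
Proof.
elim: q => [|q IH]; first by rewrite big_ord1 D0/=; field.
by rewrite big_ord_recr IH/=; field.
Qed.

(** The row through l of a matrix that depends on the distance has l + 1 entries up to the diagonal
    and q after it. *)
Let row_sum (e : nat -> R) l q :
  \sum_(j < l + q.+1) e ((l - j) + (j - l))%N = \sum_(m < l.+1) e m + \sum_(m < q) e m.+1.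
Proof.
elim: q => [|q IH].
  rewrite big_ord0 addr0 addn1 (reindex_inj rev_ord_inj)/=; apply: eq_bigr => j _.
  have jl : (j <= l)%N by rewrite -ltnS.
  by rewrite subSS subKn// (_ : _ - _ = 0)%N ?addn0//; apply/eqP; rewrite subn_eq0 leq_subr.
rewrite addnS big_ord_recr/= IH [\sum_(m < q.+1) _]big_ord_recr/= addrA; congr (_ + e _).
have -> : (l - (l + q.+1) = 0)%N by apply/eqP; rewrite subn_eq0 leq_addr.
by rewrite add0n addKn.
Qed.

Lemma fgn_cov_row_sum l q : \sum_(j < l + q.+1) fgn_cov l j = Delta `^ p / 2 * (D l + D q).
Proof.
rewrite row_sum sum_cn.
have : cn 0 + \sum_(m < q) cn m.+1 = \sum_(m < q.+1) cn m by rewrite big_ord_recl.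
by rewrite sum_cn/= => /(canRL (addKr _)) ->; field.
Qed.

Lemma fgn_cov_sum n : \sum_(i < n) \sum_(j < n) fgn_cov i j = (n%:R * Delta) `^ p.
Proof.
case: n => [|n].
  by rewrite big_ord0 mul0r powR0// gt_eqF// (lt_trans ltr01).
have sumD k : \sum_(l < k) D l = k%:R `^ p.
  elim: k => [|k IH]; first by rewrite big_ord0 powR0// gt_eqF// (lt_trans ltr01).
  by rewrite big_ord_recr/= IH /D; ring.
transitivity (\sum_(i < n.+1) Delta `^ p / 2 * (D i + D (rev_ord i))).
  apply: eq_bigr => i _; rewrite -fgn_cov_row_sum /=.
  suff -> : (i + (n.+1 - i.+1).+1 = n.+1)%N by [].
  by rewrite subSS addnS subnKC// -ltnS.
rewrite -mulr_sumr big_split/=.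
have -> : \sum_(i < n.+1) D (n.+1 - i.+1) = \sum_(i < n.+1) D i.
  by rewrite [RHS](reindex_inj rev_ord_inj).
by rewrite sumD powRM ?(ltW Delta0)//; field.
Qed.

(** A row sum is the covariance of one increment with B at time n Delta. The differences [D] are
    bounded through the derivative of z^p, which increases because p > 1. *)
Lemma fgn_cov_row_le n l : (l < n)%N ->
  \sum_(j < n) fgn_cov l j <= 2 * Delta * (n%:R * Delta) `^ (p - 1).
Proof.
move=> ln; have nE : (n = l + (n - l.+1).+1)%N by rewrite -subSn// subSS subnKC// ltnW.
rewrite [in leLHS]nE fgn_cov_row_sum.
have Dn k : (k < n)%N -> D k <= 2 * n%:R `^ (p - 1).
  move=> kn; have /andP[_ /le_trans] := Db k; apply.
  apply: ler_pM; rewrite ?powR_ge0 ?(ltW p2)//; first exact: ltW (lt_trans ltr01 p1).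
  by apply: ge0_ler_powR; rewrite ?nnegrE ?subr_ge0 ?(ltW p1) ?ler_nat.
have -> : 2 * Delta * (n%:R * Delta) `^ (p - 1) =
    Delta `^ p / 2 * (2 * n%:R `^ (p - 1) + 2 * n%:R `^ (p - 1)).
  rewrite powRM ?(ltW Delta0)//.
  have -> : Delta `^ p = Delta * Delta `^ (p - 1).
    by rewrite mulr_powRB1// ?(lt_trans ltr01)// ltW.
  by field.
apply: ler_wpM2l; first by rewrite divr_ge0// ltW.
by apply: lerD; apply: Dn => //; rewrite ltn_subrL/= (leq_ltn_trans _ ln).
Qed.

Section geometric.
Context (rho : R) (M : R).
Hypotheses (M0 : 0 < M) (rho0 : 0 <= rho) (rhoE : 1 - rho = M * Delta).

(** As M Delta = 1 - rho, the bound is B times the full geometric series. *)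
Lemma geom_acc_le (c : nat -> R) (B : R) m : (forall l, (l < m)%N -> c l <= B) -> 0 <= B ->
  geom_acc rho c m <= B / (M * Delta).
Proof.
move=> cB B0; have MD : 0 < M * Delta by rewrite mulr_gt0.
elim: m cB => [|m IH] cB /=; first by rewrite divr_ge0// ltW.
apply: (@le_trans _ _ (rho * (B / (M * Delta)) + B)).
  by rewrite lerD ?cB// ler_wpM2l// IH// => l lm; apply: cB; rewrite ltnS ltnW.
have -> : rho = 1 - M * Delta by rewrite -rhoE; ring.
have E : M * Delta * (B / (M * Delta)) = B by rewrite mulrC divfK ?gt_eqF.
by rewrite mulrBl mul1r E; lra.
Qed.

Lemma geom_accD (c e : nat -> R) m : geom_acc rho (fun l => c l + e l) m =
  geom_acc rho c m + geom_acc rho e m.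
Proof. by elim: m => [|m IH] /=; [rewrite addr0|rewrite IH; ring]. Qed.

Lemma geom_acc_sum (n : nat) (c : nat -> nat -> R) m :
  \sum_(j < n) geom_acc rho (c j) m = geom_acc rho (fun l => \sum_(j < n) c j l) m.
Proof.
elim: n => [|n IH].
  rewrite big_ord0; elim: m => [//|m IH] /=; by rewrite -IH big_ord0 mulr0 addr0.
rewrite big_ord_recr/= IH -geom_accD; congr geom_acc; apply/funext => l.
by rewrite big_ord_recr.
Qed.

Lemma geom_acc_le_sum (c : nat -> R) m : (forall l, 0 <= c l) -> rho <= 1 ->
  geom_acc rho c m <= \sum_(l < m) c l.
Proof.
move=> c0 r1; elim: m => [|m IH] /=; first by rewrite big_ord0.
rewrite big_ord_recr/= lerD2r; apply: le_trans IH; rewrite ler_piMl//.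
exact: geom_acc_ge0.
Qed.

Lemma geom_acc_mono (c e : nat -> R) m : (forall l, (l < m)%N -> c l <= e l) ->
  geom_acc rho c m <= geom_acc rho e m.
Proof.
elim: m => [//|m IH] ce /=; rewrite lerD ?ce// ler_wpM2l// IH// => l lm.
by apply: ce; rewrite ltnS ltnW.
Qed.

(** The effect of one increment on one Euler value is O(Delta), whatever the number of steps.
    Covariances within one unit of time are summed without damping, which costs 8 Delta; beyond,
    each is at most 4 Delta^2 and the damping sums this to 4 Delta^2 / (M Delta). *)
Lemma geom_acc_fgn_cov_le k j : Delta <= 1 / 2 ->
  geom_acc rho (fun l => fgn_cov l k) j <= (8 + 4 / M) * Delta.
Proof.
(* N cells cover about one unit of time; Delta <= 1/2 keeps N Delta in [1/2, 1]. *)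
move=> D12; pose N := Num.truncn (Delta^-1).
have iD0 : 0 <= Delta^-1 by rewrite invr_ge0 ltW.
have /andP[N1 N2] : N%:R <= Delta^-1 < N.+1%:R by exact: truncn_itv.
have DN1 : N%:R * Delta <= 1 by rewrite -[leRHS](mulVf (lt0r_neq0 Delta0)) ler_pM2r.
have DN2 : 1 < N.+1%:R * Delta by rewrite -[ltLHS](mulVf (lt0r_neq0 Delta0)) ltr_pM2r.
have DN3 : 1 / 2 <= N%:R * Delta by move: DN2; rewrite -natr1 mulrDl mul1r; lra.
have DN4 : N.+1%:R * Delta <= 2 by rewrite -natr1 mulrDl mul1r; lra.
have N0 : 0 < N%:R :> R by rewrite -(pmulr_lgt0 _ Delta0); lra.
pose e m := if (m <= N)%N then cn m else 0.
pose F := 4 * Delta ^+ 2.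
have e0 m : 0 <= e m by rewrite /e; case: ifP => // _; exact: fgn_cov_dist_ge0.
have F0 : 0 <= F by rewrite mulr_ge0 ?sqr_ge0.
(* Beyond N the mean value theorem bounds the second difference of z^p by 4 N^(p-2), and (N
   Delta)^(p-2) <= 2 because N Delta >= 1/2 and p - 2 > -1. *)
have far m : cn m <= e m + F.
  rewrite /e; case: (leqP m N) => [_|]; first by rewrite lerDl.
  case: m => [//|m]; rewrite ltnS => Nm; rewrite add0r /=.
  have NmR : N%:R <= m%:R :> R by rewrite ler_nat.
  have m0 : 0 < m%:R :> R := lt_le_trans N0 NmR.
  have /andP[_ h1] := Db m.+1; have /andP[h2 _] := Db m.
  have mm : m%:R < m.+2%:R :> R by rewrite ltr_nat.
  have [c /andP[mc _] E] := powR_MVT (p - 1) m0 mm.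
  have c0 : 0 < c := lt_trans m0 mc.
  have h3 : m.+2%:R `^ (p - 1) - m%:R `^ (p - 1) <= 2 * N%:R `^ (p - 2).
    rewrite E (_ : m.+2%:R - m%:R = 2); last by rewrite -addn2 natrD; ring.
    rewrite mulrC; apply: ler_wpM2l => //; have -> : p - 1 - 1 = p - 2 by ring.
    apply: (@le_trans _ _ (c `^ (p - 2))).
      by apply: ler_piMl; [exact: powR_ge0|move: p2; lra].
    rewrite -[p - 2]opprB !powRN lef_pV2 ?posrE ?powR_gt0//.
    apply: ge0_ler_powR; rewrite ?nnegrE ?subr_ge0 ?(ltW p2) ?(ltW c0) ?ler0n//.
    exact: le_trans NmR (ltW mc).
  have h4 : D m.+1 - D m <= 4 * N%:R `^ (p - 2).
    have h5 : 0 <= N%:R `^ (p - 2) by exact: powR_ge0.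
    apply: (@le_trans _ _ (p * (m.+2%:R `^ (p - 1) - m%:R `^ (p - 1)))).
      by move: h1 h2; lra.
    apply: (@le_trans _ _ (p * (2 * N%:R `^ (p - 2)))).
      by apply: ler_wpM2l => //; move: p1; lra.
    by move: p2; nra.
  apply: (@le_trans _ _ (Delta `^ p / 2 * (4 * N%:R `^ (p - 2)))).
    by apply: ler_wpM2l => //; rewrite divr_ge0// ltW.
  have -> : Delta `^ p / 2 * (4 * N%:R `^ (p - 2)) = 2 * Delta ^+ 2 * (N%:R * Delta) `^ (p - 2).
    rewrite powRM ?(ltW Delta0) ?ler0n//.
    have -> : Delta `^ p = Delta ^+ 2 * Delta `^ (p - 2).
      rewrite -powR_mulrn ?(ltW Delta0)// -powRD; last by rewrite (gt_eqF Delta0) implybT.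
      by congr (_ `^ _); ring.
    by field.
  rewrite /F (_ : 4 * Delta ^+ 2 = 2 * Delta ^+ 2 * 2); last by ring.
  apply: ler_wpM2l; first by rewrite mulr_ge0// sqr_ge0.
  rewrite -[p - 2]opprB powRN -[leRHS]invrK lef_pV2 ?posrE ?powR_gt0 ?invr_gt0//; last by lra.
  apply: (@le_trans _ _ ((1 / 2) `^ (2 - p))); last first.
    by apply: ge0_ler_powR; rewrite ?nnegrE ?subr_ge0 ?(ltW p2)//; lra.
  rewrite -[X in X <= _]mul1r -[X in X <= _]powRr1; last by lra.
  by apply: ger_powR; move: p1 p2; lra.
have MD : 0 < M * Delta by rewrite mulr_gt0.
apply: (@le_trans _ _ (geom_acc rho (fun l => e ((k - l) + (l - k))%N + F) j)).
  by apply: geom_acc_mono => l _; rewrite /fgn_cov addnC; exact: far.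
rewrite geom_accD.
have b1 : geom_acc rho (fun=> F) j <= 4 / M * Delta.
  apply: (le_trans (@geom_acc_le (fun=> F) F j _ F0)) => //.
  by rewrite /F expr2 le_eqVlt; apply/orP; left; apply/eqP; field; rewrite !gt_eqF.
(* At most N + 1 terms are nonzero, and their sum is of order Delta because N Delta is of order 1.
   Two such sums, with p < 2, give the 8. *)
have esum q : \sum_(m < q) e m <= 2 * Delta * p.
  have E : \sum_(m < q) e m = \sum_(m < minn q N.+1) cn m.
    elim: q => [|q IH]; first by rewrite min0n !big_ord0.
    rewrite big_ord_recr/= IH /e; case: (leqP q N) => qN.
      have -> : minn q N.+1 = q by apply/minn_idPl; rewrite leqW.
      have -> : minn q.+1 N.+1 = q.+1 by apply/minn_idPl.
      by rewrite big_ord_recr.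
    have -> : minn q N.+1 = N.+1 by apply/minn_idPr.
    have -> : minn q.+1 N.+1 = N.+1 by apply/minn_idPr; rewrite leqW.
    by rewrite addr0.
  have DN : Delta `^ p / 2 * (1 + D N) <= 2 * Delta * p.
    have := D_le_mono (leq0n N); rewrite D0 => h0.
    apply: (@le_trans _ _ (Delta `^ p * D N)).
      by rewrite -mulrA ler_wpM2l ?(ltW Dp0)//; lra.
    have /andP[_ h1] := Db N.
    apply: (@le_trans _ _ (Delta `^ p * (p * N.+1%:R `^ (p - 1)))).
      by rewrite ler_wpM2l ?(ltW Dp0).
    have -> : Delta `^ p * (p * N.+1%:R `^ (p - 1)) = Delta * p * (N.+1%:R * Delta) `^ (p - 1).
      rewrite powRM ?(ltW Delta0)//.
      have -> : Delta `^ p = Delta * Delta `^ (p - 1).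
        by rewrite mulr_powRB1// ?(lt_trans ltr01)// ltW.
      by ring.
    have -> : 2 * Delta * p = Delta * p * 2 by ring.
    apply: ler_wpM2l; first by rewrite mulr_ge0 ?(ltW Delta0)// ltW// (lt_trans ltr01).
    apply: (@le_trans _ _ (2 `^ (p - 1))).
      apply: ge0_ler_powR; rewrite ?nnegrE ?subr_ge0 ?(ltW p1)//.
      by rewrite mulr_ge0// ltW.
    by rewrite -[leRHS]powRr1//; apply: ler_powR; move: p1 p2; lra.
  rewrite E; case: (minn q N.+1) (geq_minr q N.+1) => [|r] rN.
    by rewrite big_ord0 mulr_ge0// ?mulr_ge0 ?(ltW Delta0)// ltW// (lt_trans ltr01).
  apply: le_trans DN; rewrite sum_cn; apply: ler_wpM2l; first by rewrite divr_ge0// ltW.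
  by rewrite lerD2l D_le_mono.
have b2 : geom_acc rho (fun l => e ((k - l) + (l - k))%N) j <= 8 * Delta.
  have r1 : rho <= 1 by rewrite -subr_ge0 rhoE ltW.
  apply: (le_trans (geom_acc_le_sum _ _ r1)) => //.
  apply: (@le_trans _ _ (\sum_(l < k + j.+1) e ((k - l) + (l - k))%N)).
    rewrite addnC addSn -addnS big_split_ord/= lerDl; exact: sumr_ge0.
  rewrite row_sum.
  have h1 := esum k.+1.
  have h2 : \sum_(m < j) e m.+1 <= \sum_(m < j.+1) e m by rewrite big_ord_recl lerDr.
  have h3 := esum j.+1.
  have : Delta * p <= Delta * 2 by rewrite ler_wpM2l// ltW.
  by lra.
by lra.
Qed.

(** In each crossed product one factor is bounded by [geom_acc_fgn_cov_le]; the other is summed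
    along its row, where the 1 / (M Delta) of the damping cancels the Delta of [fgn_cov_row_le].
    With T = n Delta, the n rows of order Delta T^(p-1) make T^p. *)
Lemma skorokhod_bound_sum (n : nat) (k1 c : R) : Delta <= 1 / 2 -> 0 <= c ->
  \sum_(i < n) \sum_(j < n) (4 * k1 ^+ 2 * fgn_cov i j +
    (c * geom_acc rho (fun l => fgn_cov l j) i) * (c * geom_acc rho (fun l => fgn_cov l i) j))
  <= (4 * k1 ^+ 2 + c ^+ 2 * ((8 + 4 / M) * (2 / M))) * (n%:R * Delta) `^ p.
Proof.
move=> D12 c0.
have [->|n0] := eqVneq n 0%N.
  by rewrite big_ord0 mul0r powR0 ?mulr0// gt_eqF// (lt_trans ltr01).
have T0 : 0 <= n%:R * Delta by rewrite mulr_ge0// ltW.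
have g0 i j : 0 <= geom_acc rho (fun l => fgn_cov l j) i.
  by apply: geom_acc_ge0 => // l; exact: fgn_cov_ge0.
have M40 : 0 <= 8 + 4 / M by rewrite addr_ge0// divr_ge0// ltW.
rewrite (eq_bigr (fun i : 'I_n => 4 * k1 ^+ 2 * (\sum_(j < n) fgn_cov i j) + \sum_(j < n)
  ((c * geom_acc rho (fun l => fgn_cov l j) i) * (c * geom_acc rho (fun l => fgn_cov l i) j)))); last first.
  by move=> i _; rewrite big_split/= mulr_sumr.
rewrite big_split/= -mulr_sumr fgn_cov_sum [leRHS]mulrDl lerD2l.
have row i : (i < n)%N -> \sum_(j < n) (c * geom_acc rho (fun l => fgn_cov l j) i) *
    (c * geom_acc rho (fun l => fgn_cov l i) j) <=
    c ^+ 2 * ((8 + 4 / M) * Delta) * (2 * (n%:R * Delta) `^ (p - 1) / M).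
  move=> ni.
  apply: (@le_trans _ _ (\sum_(j < n) c ^+ 2 * ((8 + 4 / M) * Delta) *
      geom_acc rho (fun l => fgn_cov l j) i)).
    apply: ler_sum => j _.
    rewrite [leLHS](_ : _ = c ^+ 2 * geom_acc rho (fun l => fgn_cov l i) j *
      geom_acc rho (fun l => fgn_cov l j) i); last by ring.
    apply: ler_wpM2r => //; apply: ler_wpM2l; first exact: sqr_ge0.
    exact: geom_acc_fgn_cov_le.
  rewrite -mulr_sumr; apply: ler_wpM2l.
    by rewrite mulr_ge0 ?sqr_ge0// mulr_ge0// ltW.
  rewrite (geom_acc_sum n (fun j l => fgn_cov l j)).
  have B0 : 0 <= 2 * Delta * (n%:R * Delta) `^ (p - 1).
    by rewrite mulr_ge0 ?powR_ge0// mulr_ge0// ltW.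
  apply: (le_trans (geom_acc_le _ B0)).
    by move=> l li; apply: fgn_cov_row_le; exact: ltn_trans ni.
  by rewrite le_eqVlt; apply/orP; left; apply/eqP; field; rewrite !gt_eqF.
apply: (@le_trans _ _ (\sum_(i < n) c ^+ 2 * ((8 + 4 / M) * Delta) *
    (2 * (n%:R * Delta) `^ (p - 1) / M))).
  by apply: ler_sum => i _; exact: row.
rewrite sumr_const card_ord -[X in X <= _]mulr_natl.
have <- : n%:R * Delta * (n%:R * Delta) `^ (p - 1) = (n%:R * Delta) `^ p.
  by rewrite mulr_powRB1// (lt_trans ltr01).
by rewrite le_eqVlt; apply/orP; left; apply/eqP; field; rewrite gt_eqF.
Qed.

End geometric.
End fbm_covariance.

(** * Fractional Brownian motion: laws of increments *)

Section gaussian_law_moments.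
Context d (T : measurableType d) (R : realType) (P : probability T R).

Lemma gaussian_law_moments (W : T -> R) (m s : R) : measurable_fun setT W ->
  (forall A, measurable A -> P (W @^-1` A) = gaussian_law m s A) ->
  [/\ intg P W, intg P (fun w => W w ^+ 2), Ex P W = m &
      m = 0 -> Ex P (fun w => W w ^+ 2) = s ^+ 2].
Proof.
move=> mW law; have [s0|s0] := eqVneq s 0; last first.
  have lawN A : measurable A -> P (W @^-1` A) = normal_prob m s A.
    by move=> mA; rewrite law// /gaussian_law (negbTE s0).
  split; first exact: gaussian_intg mW s0 lawN.
  - exact: gaussian_intgX mW s0 lawN.
  - exact: gaussian_mean mW s0 lawN.
  - exact: gaussian_second_moment mW s0 lawN.
have Wm : {ae P, forall w, W w = m}.
  exists (W @^-1` (~` [set m])); split.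
  - rewrite -[X in measurable X]setTI; apply: mW => //; exact: measurableC.
  - rewrite law; last exact: measurableC.
    by rewrite /gaussian_law s0 eqxx diracE memNset//; apply.
  - by move=> w /=.
have I (f : R -> R) : measurable_fun setT f -> intg P (fun w => f (W w)) /\ Ex P (fun w => f (W w)) = f m.
  move=> mf; have mfW : measurable_fun setT (fun w => f (W w)) by exact: measurableT_comp.
  have ic : intg P (fun=> f m) by apply: (bounded_intg `|f m|) => // w.
  have ae : {ae P, forall w, setT w -> (f (W w))%:E = (f m)%:E}.
    by apply: filterS Wm => w /= ->.
  split; last first.
    rewrite -[RHS](Ex_cst P); congr fine; apply: ae_eq_integral => //.
    exact/measurable_EFinP.
  apply/integrableP; split; first exact/measurable_EFinP.
  have /integrableP[_] := ic; congr (_ < _)%E; apply: ae_eq_integral => //.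
  - by apply/measurable_EFinP; exact: measurableT_comp.
  - by apply: filterS Wm => w /= ->.
have [i1 e1] := I id (@measurable_id _ _ _).
have [i2 e2] := I (fun x => x ^+ 2) (measurable_funX _ (@measurable_id _ _ _)).
by split => // m0; rewrite e2 m0 s0.
Qed.

(** [gaussian_process] provides some s of unknown sign, while a Gaussian family is stated with a
    nonnegative square root. *)
Lemma gaussian_law_norm (m s : R) (A : set R) : gaussian_law m s A = gaussian_law m `|s| A.
Proof.
have E : (`|s| == 0) = (s == 0) by exact: normr_eq0.
rewrite /gaussian_law E; have [//|s0] := boolP (s == 0).
rewrite /normal_prob; apply: eq_integral => x _; congr (_%:E).
rewrite /normal_pdf E (negbTE s0).
by rewrite /normal_peak /normal_fun real_normK// num_real.
Qed.

End gaussian_law_moments.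

Section fbm.
Context d (T : measurableType d) (R : realType) (P : probability T R).
Context (H : R) (B : R -> {RV P >-> R}).
Hypothesis BH : fractional_brownian_motion H B.

Definition fbm_cov (s t : R) : R := (s `^ (2 * H) + t `^ (2 * H) - `|t - s| `^ (2 * H)) / 2.

Lemma fbm_law t : 0 <= t -> exists m s, forall A, measurable A ->
  P ((B t : T -> R) @^-1` A) = gaussian_law m s A.
Proof.
move=> t0; have [GP _ _ _] := BH.
have [m [s law]] := GP 1 (fun=> t) (fun=> 1) (fun=> t0).
exists m; exists s => A mA; rewrite -(law A mA).
have -> // : (fun w => \sum_(i < 1) 1 * B t w) = B t :> (T -> R).
by apply/funext => w; rewrite big_ord1 mul1r.
Qed.

Lemma fbm_moments t : 0 <= t -> [/\ intg P (B t), intg P (fun w => B t w ^+ 2) & Ex P (B t) = 0].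
Proof.
move=> t0; have [m [s law]] := fbm_law t0.
have [i1 i2 _ _] := gaussian_law_moments (measurable_funPT (B t)) law.
split => //; have [_ EB _ _] := BH.
by have := EB t t0; rewrite unlock /Ex /Rintegral => ->.
Qed.

Lemma fbm_cross s t : 0 <= s -> 0 <= t ->
  intg P (fun w => B s w * B t w) /\ Ex P (fun w => B s w * B t w) = fbm_cov s t.
Proof.
move=> s0 t0; have [i1 i2 _] := fbm_moments s0; have [j1 j2 _] := fbm_moments t0.
split.
  have m1 : measurable_fun setT (fun w => B s w * B t w) by exact: measurable_funM.
  apply: (le_intg m1 (intgD i2 j2)) => w; rewrite normrM -[B s w ^+ 2]real_normK ?num_real// -[B t w ^+ 2]real_normK ?num_real//.
  by have := sqr_ge0 (`|B s w| - `|B t w|); have := normr_ge0 (B s w); have := normr_ge0 (B t w); nra.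
have [_ EB cov _] := BH.
have := cov s t s0 t0; rewrite /fbm_cov covariance.unlock !EB// => /(congr1 fine)/= <-.
rewrite expectation.unlock; congr fine; apply: eq_integral => w _.
by transitivity (((B s w - 0) * (B t w - 0))%:E) => //; rewrite !subr0.
Qed.

Section increments.
Context (n : nat) (s t : nat -> R).
Hypotheses (s0 : forall k, 0 <= s k) (t0 : forall k, 0 <= t k).

Definition increment (k : nat) (w : T) : R := B (t k) w - B (s k) w.
Definition increment_cov (k l : nat) : R :=
  fbm_cov (t k) (t l) - fbm_cov (t k) (s l) - fbm_cov (s k) (t l) + fbm_cov (s k) (s l).

Lemma measurable_increment k : measurable_fun setT (increment k).
Proof. exact: measurable_funB. Qed.

Lemma increment_cross k l : intg P (fun w => increment k w * increment l w) /\
  Ex P (fun w => increment k w * increment l w) = increment_cov k l.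
Proof.
have [a1 b1] := fbm_cross (t0 k) (t0 l); have [a2 b2] := fbm_cross (t0 k) (s0 l).
have [a3 b3] := fbm_cross (s0 k) (t0 l); have [a4 b4] := fbm_cross (s0 k) (s0 l).
have c1 := intgB a1 a2; have c2 := intgB c1 a3; have c3 := intgD c2 a4.
have -> : (fun w => increment k w * increment l w) = (fun w => B (t k) w * B (t l) w
   - B (t k) w * B (s l) w - B (s k) w * B (t l) w + B (s k) w * B (s l) w).
  by apply/funext => w; rewrite /increment; ring.
split => //; rewrite (ExD c2 a4) (ExB c1 a3) (ExB a1 a2).
by rewrite b1 b2 b3 b4.
Qed.

Lemma gaussian_family_increments : gaussian_family P n increment increment_cov.
Proof.
have sq a : intg P (fun w => lin n a (increment^~ w) ^+ 2) /\
    Ex P (fun w => lin n a (increment^~ w) ^+ 2) = bil n increment_cov a a.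
  have E : (fun w => lin n a (increment^~ w) ^+ 2) = (fun w => \sum_(i < n) \sum_(j < n)
      (a i * a j) * (increment i w * increment j w)).
    apply/funext => w; rewrite expr2 /lin mulr_suml; apply: eq_bigr => i _.
    by rewrite mulr_sumr; apply: eq_bigr => j _; ring.
  have I i : intg P (fun w => \sum_(j < n) (a i * a j) * (increment i w * increment j w)).
    apply: (intgS (F := fun j w => (a i * a j) * (increment i w * increment j w))) => j _.
    by apply: intgZ; have [] := increment_cross i j.
  rewrite E; split.
    by apply: (intgS (F := fun i w => \sum_(j < n) (a i * a j) * (increment i w * increment j w))).
  rewrite (ExS (F := fun i w => \sum_(j < n) (a i * a j) * (increment i w * increment j w)))//.
  apply: eq_bigr => i _.
  rewrite (ExS (F := fun j w => (a i * a j) * (increment i w * increment j w))); last first.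
    by move=> j _; apply: intgZ; have [] := increment_cross i j.
  by apply: eq_bigr => j _; have [h1 h2] := increment_cross i j; rewrite ExZ// h2; ring.
have b0 a : 0 <= bil n increment_cov a a.
  by have [_ <-] := sq a; apply: Rintegral_ge0 => w _; exact: sqr_ge0.
have fC x y : fbm_cov x y = fbm_cov y x.
  by rewrite /fbm_cov distrC [X in X - _]addrC.
split => //.
- exact: measurable_increment.
- move=> k l; rewrite /increment_cov (fC (t k) (t l)) (fC (t k) (s l)) (fC (s k) (t l)) (fC (s k) (s l)).
  by ring.
move=> a A mA; have [GP _ _ _] := BH.
(* A combination of n increments is one of B at 2n times: the right end points with coefficients a,
   the left ones with - a. *)
pose tt (i : 'I_(n + n)) : R := match fintype.split i with inl j => t j | inr j => s j end.
pose cc (i : 'I_(n + n)) : R := match fintype.split i with inl j => a j | inr j => - a j end.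
have tt0 i : 0 <= tt i by rewrite /tt; case: (fintype.split i).
have [m [sd law]] := GP (n + n)%N tt cc tt0.
have linE w : \sum_(i < n + n) cc i * B (tt i) w = lin n a (increment^~ w).
  rewrite big_split_ord/= /lin -big_split/=; apply: eq_bigr => i _.
  rewrite /cc /tt (unsplitK (inl i : 'I_n + 'I_n)) (unsplitK (inr i : 'I_n + 'I_n)).
  by rewrite /increment; ring.
have law' A' : measurable A' -> P ((fun w => lin n a (increment^~ w)) @^-1` A') = gaussian_law m sd A'.
  by move=> mA'; rewrite -(law A' mA') (funext linE).
have mlin : measurable_fun setT (fun w => lin n a (increment^~ w)).
  by apply: measurable_sum => i; apply: measurable_funM => //; exact: measurable_increment.
have [i1 i2 Em Es] := gaussian_law_moments mlin law'.
have m0 : m = 0.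
  rewrite -Em /lin (ExS (F := fun i w => a i * increment i w)).
    apply: big1 => i _; have [ti _ Et] := fbm_moments (t0 i); have [si _ Est] := fbm_moments (s0 i).
    by rewrite (ExZ _ (intgB ti si)) (ExB ti si) Et Est subr0 mulr0.
  move=> i _; apply: intgZ; have [ti _ _] := fbm_moments (t0 i); have [si _ _] := fbm_moments (s0 i).
  exact: intgB.
have [_ Eb] := sq a.
by rewrite (law' A mA) m0 gaussian_law_norm -Eb (Es m0) sqrtr_sqr.
Qed.

End increments.
End fbm.

Section fbm_paths.
Context d (T : measurableType d) (R : realType) (P : probability T R).
Context (H : R) (B : R -> {RV P >-> R}).
Hypotheses (H12 : 1 / 2 < H) (H1 : H < 1).
Hypothesis BH : fractional_brownian_motion H B.
Local Notation p := (2 * H).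

Let p0 : p != 0. Proof. by rewrite gt_eqF//; move: H12; lra. Qed.

Lemma fbm_start : {ae P, forall w, B 0 w = 0}.
Proof.
have [m [s law]] := fbm_law BH (lexx 0).
have [_ _ Em Es] := gaussian_law_moments (measurable_funPT (B 0)) law.
have [_ _ E0] := fbm_moments BH (lexx 0).
have [_ E2] := fbm_cross BH (lexx 0) (lexx 0).
have m0 : m = 0 by rewrite -Em.
have s0 : s = 0.
  apply/eqP; rewrite -sqrf_eq0 -(Es m0) -[X in _ == X]E0; apply/eqP.
  transitivity (fbm_cov H 0 0); first by rewrite -E2.
  by rewrite /fbm_cov subrr normr0 !powR0// E0; lra.
exists ((B 0 : T -> R) @^-1` (~` [set 0])); split.
- by rewrite -[X in measurable X]setTI; apply: measurable_funPT => //; exact: measurableC.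
- rewrite (law _ (measurableC (measurable_set1 0))).
  by rewrite m0 s0 /gaussian_law eqxx diracE memNset//; apply.
- by move=> w /=.
Qed.

Lemma increment_cov_grid (Delta : R) : 0 < Delta ->
  increment_cov H (fun k => k%:R * Delta) (fun k => k.+1%:R * Delta) = fgn_cov p Delta.
Proof.
move=> D0; have main l m : increment_cov H (fun k => k%:R * Delta)
    (fun k => k.+1%:R * Delta) (l + m)%N l = fgn_cov_dist p Delta m.
  have nD (x y : nat) : (y <= x)%N -> `|x%:R * Delta - y%:R * Delta| `^ p = (x - y)%:R `^ p * Delta `^ p.
    move=> yx; rewrite -mulrBl -natrB// ger0_norm ?powRM// ?(ltW D0)//.
    by rewrite mulr_ge0 ?(ltW D0).
  have nD' (x y : nat) : (y <= x)%N -> `|y%:R * Delta - x%:R * Delta| `^ p = (x - y)%:R `^ p * Delta `^ p.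
    by move=> yx; rewrite distrC nD.
  rewrite /increment_cov /fbm_cov.
  rewrite (nD' (l + m).+1 l.+1) ?ltnS ?leq_addr// (nD' (l + m).+1 l) ?leqW ?leq_addr//.
  rewrite (nD' (l + m) l)%N ?leq_addr// subSS addKn -addnS addKn.
  case: m => [|m] /=.
    by rewrite addn1 addn0 nD// subSnn !powR0// powR1; field.
  rewrite (nD' (l + m.+1)%N l.+1); last by rewrite addnS ltnS leq_addr.
  have -> : (l + m.+1 - l.+1 = m)%N by rewrite addnS subSS addKn.
  by field.
apply/funext => k; apply/funext => l.
have sym x y : increment_cov H (fun k => k%:R * Delta) (fun k => k.+1%:R * Delta) x y =
    increment_cov H (fun k => k%:R * Delta) (fun k => k.+1%:R * Delta) y x.
  have fC u v : fbm_cov H u v = fbm_cov H v u by rewrite /fbm_cov distrC [X in X - _]addrC.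
  rewrite /increment_cov; set a := fbm_cov H _ _; set b := fbm_cov H _ _.
  set c := fbm_cov H _ _; set e := fbm_cov H _ _.
  rewrite /a /b /c /e (fC (x.+1%:R * _)) (fC (x.+1%:R * _) (y%:R * _)).
  by rewrite (fC (x%:R * _) (y.+1%:R * _)) (fC (x%:R * _) (y%:R * _)); ring.
have [lk|/ltnW kl] := leqP l k.
  rewrite -[in LHS](subnKC lk) main /fgn_cov; congr (fgn_cov_dist _ _ _).
  by rewrite (_ : l - k = 0)%N ?addn0//; apply/eqP; rewrite subn_eq0.
rewrite sym -[in LHS](subnKC kl) main /fgn_cov; congr (fgn_cov_dist _ _ _).
by rewrite (_ : k - l = 0)%N ?add0n//; apply/eqP; rewrite subn_eq0.
Qed.

Lemma gaussian_family_grid (Delta : R) (n : nat) : 0 < Delta ->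
  gaussian_family P n (fun k w => B (k.+1%:R * Delta) w - B (k%:R * Delta) w) (fgn_cov p Delta).
Proof.
move=> D0; rewrite -increment_cov_grid//.
by apply: (gaussian_family_increments BH) => k; rewrite mulr_ge0// ltW.
Qed.

(** Chernoff's bound with parameters 1 / v and - 1 / v, where v = (t - s)^H is the standard
    deviation; the constant comes from 2 exp(1/2) <= 4. *)
Lemma fbm_increment_tail (s t a : R) : 0 <= s -> s < t -> 0 < a ->
  (P [set w | (a < `|B t w - B s w|)%R] <= (4 * expR (- (a / (t - s) `^ H)))%:E)%E.
Proof.
move=> s0 st a0; have t0 : 0 <= t := le_trans s0 (ltW st).
pose W w := B t w - B s w.
have mW : measurable_fun setT W by exact: measurable_funB.
have GF := @gaussian_family_increments _ _ _ _ _ _ BH 1 (fun=> s) (fun=> t) (fun=> s0) (fun=> t0).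
have [_ _ _ law] := GF.
pose v := (t - s) `^ H; have v0 : 0 < v by rewrite powR_gt0// subr_gt0.
have vE : bil 1 (increment_cov H (fun=> s) (fun=> t)) (fun=> 1) (fun=> 1) = v ^+ 2.
  have ts0 : 0 < t - s by rewrite subr_gt0.
  have e1 : `|t - s| = t - s by rewrite gtr0_norm.
  have e2 : `|s - t| = t - s by rewrite distrC e1.
  have e3 : v ^+ 2 = (t - s) `^ p.
    by rewrite /v -powR_mulrn ?powR_ge0// -powRrM mulrC.
  rewrite /bil !big_ord1 mul1r mulr1 /increment_cov /fbm_cov !subrr normr0 powR0//.
  by rewrite e1 e2 e3; field.
have lawW A : measurable A -> P (W @^-1` A) = normal_prob 0 v A.
  move=> mA; have := law (fun=> 1) A mA; rewrite vE sqrtr_sqr gtr0_norm//.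
  rewrite /gaussian_law gt_eqF// => <-.
  have -> // : (fun w => lin 1 (fun=> 1) (increment B (fun=> s) (fun=> t) ^~ w)) = W.
  by apply/funext => w; rewrite /lin big_ord1 mul1r.
have vn0 : v != 0 by rewrite gt_eqF.
have [i1 E1] := gaussian_mgf mW vn0 lawW v^-1.
have [i2 E2] := gaussian_mgf mW vn0 lawW (- v^-1).
have mA := measurable_norm_gt a mW.
have iA : intg P (\1_[set w | a < `|W w|] : T -> R).
  apply: (bounded_intg 1); first exact: measurable_indic.
  by move=> w; rewrite indicE; case: (_ \in _); rewrite ?normr1 ?normr0.
rewrite -/v -[X in P X]setIT -integral_indic// (ExE iA) lee_fin expRN ler_pdivlMr ?expR_gt0//.
rewrite mulrC -ExZ//; apply: (@le_trans _ _ (Ex P (fun w => expR (v^-1 * W w) + expR (- v^-1 * W w)))).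
  apply: le_Ex; [exact: intgZ|exact: intgD|].
  move=> w; rewrite indicE; case: (boolP (w \in _)) => [/set_mem/= aW|_]; last first.
    by rewrite mulr0 addr_ge0 ?expR_ge0.
  rewrite mulr1; have [W0|W0] := leP 0 (W w).
    apply: (@le_trans _ _ (expR (v^-1 * W w))); last by rewrite lerDl expR_ge0.
    rewrite ler_expR mulrC ler_pM2l ?invr_gt0//; apply: ltW; by rewrite -(ger0_norm W0).
  apply: (@le_trans _ _ (expR (- v^-1 * W w))); last by rewrite lerDr expR_ge0.
  rewrite ler_expR mulrC mulNr -mulrN ler_pM2l ?invr_gt0//; apply: ltW.
  by rewrite -(ltr0_norm W0).
rewrite (ExD i1 i2) E1 E2 !mulr0 !add0r sqrrN exprVn mulVf ?sqrf_eq0//.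
have : expR (1 / 2) <= 2 :> R; last by lra.
have : (expR (1 / 2) : R) * expR (- (1 / 2)) = 1 by rewrite -expRD subrr expR0.
by have := expR_ge1Dx (- (1 / 2) : R); have := expR_gt0 (1 / 2 : R); nra.
Qed.

End fbm_paths.

(** * Path regularity by dyadic chaining *)

Section dyadic.
Context {R : realType}.

Lemma within_continuous_seq (f : R -> R) (D : set R) (s : R) (u : nat -> R) :
  {within D, continuous f} -> D s -> (forall n, D (u n)) ->
  u n @[n --> \oo] --> s -> f (u n) @[n --> \oo] --> f s.
Proof.
move=> /subspace_continuousP cf Ds Du us A /(cf _ Ds) H.
rewrite /nbhs/= in H; have [N _ HN] := us _ H.
by exists N => // n /HN /= /(_ (Du n)).
Qed.

Context (f : R -> R) (N n0 : nat) (q : R).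
Hypotheses (q0 : 0 < q) (q1 : q < 1).
Hypothesis cf : {within `[0, +oo[, continuous f}.
Hypothesis fq : forall n k, (n0 <= n)%N -> (k.+1 <= N * 2 ^ n)%N ->
  `|f (k.+1%:R / 2 ^+ n) - f (k%:R / 2 ^+ n)| <= q ^+ n.

Let tr (n : nat) (s : R) : nat := Num.truncn (s * 2 ^+ n).
Let dy (n : nat) (s : R) : R := (tr n s)%:R / 2 ^+ n.
Let P2 n : 0 < 2 ^+ n :> R. Proof. by rewrite exprn_gt0. Qed.

Let tr_itv n s : 0 <= s -> (tr n s)%:R <= s * 2 ^+ n < (tr n s).+1%:R.
Proof. by move=> s0; apply: truncn_itv; rewrite mulr_ge0. Qed.

Let tr_le n s : 0 <= s <= N%:R -> (tr n s <= N * 2 ^ n)%N.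
Proof.
move=> /andP[s0 sN]; have /andP[h _] := tr_itv n s0.
by rewrite -(ler_nat R) natrM natrX (le_trans h)// ler_pM2r.
Qed.

(** Halving the cells either keeps the dyadic point below s or moves it by one new cell to the
    right, so [fq] bounds one link of the chain. *)
Let dy_step n s : (n0 <= n)%N -> 0 <= s <= N%:R -> `|f (dy n.+1 s) - f (dy n s)| <= q ^+ n.+1.
Proof.
move=> nn sN; have /andP[s0 _] := sN.
have /andP[h1 h2] := tr_itv n s0; have /andP[h3 h4] := tr_itv n.+1 s0.
have lo : (2 * tr n s <= tr n.+1 s)%N.
  rewrite -ltnS -(ltr_nat R); apply: le_lt_trans h4.
  by rewrite natrM exprS mulrCA ler_pM2l.
have hi : (tr n.+1 s < 2 * (tr n s).+1)%N.
  rewrite -(ltr_nat R); apply: le_lt_trans h3 _.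
  by rewrite natrM exprS mulrCA ltr_pM2l.
have dE : dy n s = (2 * tr n s)%:R / 2 ^+ n.+1.
  by rewrite /dy natrM exprS; field; rewrite gt_eqF.
have [e|ne] := eqVneq (tr n.+1 s) (2 * tr n s)%N.
  by rewrite dE /dy e subrr normr0 exprn_ge0// ltW.
have e : tr n.+1 s = (2 * tr n s).+1.
  move: hi; rewrite mulnS add2n ltnS => hi.
  by apply/eqP; rewrite eqn_leq hi/= ltn_neqAle eq_sym ne.
rewrite dE /dy e; apply: fq; first exact: leqW.
by rewrite -e; exact: tr_le.
Qed.

Let dy_chain n m s : (n0 <= n)%N -> 0 <= s <= N%:R ->
  `|f (dy (n + m) s) - f (dy n s)| <= q ^+ n / (1 - q).
Proof.
move=> nn sN.
suff : `|f (dy (n + m) s) - f (dy n s)| <= (q ^+ n - q ^+ (n + m)) / (1 - q).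
  move=> /le_trans; apply; rewrite ler_pM2r ?invr_gt0 ?subr_gt0//.
  by rewrite lerBlDr lerDl exprn_ge0// ltW.
elim: m => [|m IH]; first by rewrite addn0 !subrr normr0 mul0r.
rewrite addnS.
have -> : f (dy (n + m).+1 s) - f (dy n s) =
  (f (dy (n + m).+1 s) - f (dy (n + m) s)) + (f (dy (n + m) s) - f (dy n s)) by ring.
apply: (le_trans (ler_normD _ _)).
apply: (le_trans (lerD (dy_step (leq_trans nn (leq_addr m n)) sN) IH)).
rewrite exprS; set e := q ^+ (n + m); have e0 : 0 <= e by rewrite exprn_ge0// ltW.
have i0 : 0 < (1 - q)^-1 by rewrite invr_gt0 subr_gt0.
rewrite [X in X + _ <= _](_ : _ = (q * e * (1 - q)) / (1 - q)); last first.
  by field; rewrite subr_eq0 gt_eqF.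
rewrite -mulrDl ler_pM2r//.
rewrite -subr_ge0 (_ : _ - _ = e * (1 - q) ^+ 2); last by ring.
by rewrite mulr_ge0// sqr_ge0.
Qed.

Let dy_cvg n s : 0 <= s -> dy (n + m) s @[m --> \oo] --> s.
Proof.
move=> s0; apply/cvgrPdist_le => e e0.
have : ((1 / 2 : R) ^+ m) @[m --> \oo] --> (0 : R).
  by apply: cvg_expr; rewrite ger0_norm; lra.
move=> /cvgr_le/(_ e e0); apply: filterS => m hm.
have /andP[h1 h2] := tr_itv (n + m) s0.
rewrite ger0_norm; last by rewrite subr_ge0 ler_pdivrMr.
apply: le_trans hm.
have -> : s - dy (n + m) s = (s * 2 ^+ (n + m) - (tr (n + m) s)%:R) / 2 ^+ (n + m).
  by rewrite /dy; field; rewrite gt_eqF.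
rewrite ler_pdivrMr//; apply: (@le_trans _ _ 1); first by rewrite lerBlDr addrC natr1 ltW.
rewrite exprD mulrCA -exprMn (_ : 1 / 2 * 2 = 1 :> R); last by field.
by rewrite expr1n mulr1 exprn_ege1// ler1n.
Qed.

(** Chain from t to its dyadic point, across at most one cell, and on to s: three terms, each at
    most q^n / (1 - q). *)
Lemma dyadic_modulus n s t : (n0 <= n)%N -> 0 <= s -> s <= t -> t <= N%:R ->
  t - s <= 2 ^- n -> `|f t - f s| <= 3 / (1 - q) * q ^+ n.
Proof.
move=> nn s0 st tN ts; have t0 := le_trans s0 st.
have near_dy x : 0 <= x <= N%:R -> `|f x - f (dy n x)| <= q ^+ n / (1 - q).
  move=> /andP[x0 xN].
  have c : `|f (dy (n + m) x) - f (dy n x)| @[m --> \oo] --> `|f x - f (dy n x)|.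
    apply: cvg_norm; apply: cvgB; last exact: cvg_cst.
    apply: (within_continuous_seq cf) (dy_cvg n x0).
      by rewrite /= in_itv/= x0.
    by move=> m; rewrite /= in_itv/= andbT divr_ge0// ltW.
  rewrite -(cvg_lim _ c)//; apply: limr_le; first by apply/cvg_ex; eexists; exact: c.
  apply: nearW => m; apply: dy_chain => //.
  by rewrite x0.
have mid : `|f (dy n t) - f (dy n s)| <= q ^+ n.
  have /andP[h1 h2] := tr_itv n s0; have /andP[h3 h4] := tr_itv n t0.
  have lo : (tr n s <= tr n t)%N by apply: le_truncn; rewrite ler_pM2r.
  have hi : (tr n t < (tr n s).+2)%N.
    rewrite -(ltr_nat R); apply: le_lt_trans h3 _.
    have : (t - s) * 2 ^+ n <= 1 by rewrite -ler_pdivlMr// mul1r.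
    by rewrite mulrBl -[in X in _ -> X]natr1; lra.
  have [e|ne] := eqVneq (tr n t) (tr n s).
    by rewrite /dy e subrr normr0 exprn_ge0// ltW.
  have e : tr n t = (tr n s).+1.
    by apply/eqP; rewrite eqn_leq -ltnS hi/= ltn_neqAle eq_sym ne.
  rewrite /dy e; apply: fq => //; rewrite -e; apply: tr_le.
  by rewrite t0.
have a1 := near_dy t; have a2 := near_dy s.
have -> : f t - f s = (f t - f (dy n t)) + (f (dy n t) - f (dy n s)) - (f s - f (dy n s)) by ring.
apply: (le_trans (ler_normB _ _)); apply: (le_trans (lerD (ler_normD _ _) (lexx _))).
have b1 := a1; rewrite t0 tN in b1; have b2 := a2; rewrite s0 (le_trans st tN) in b2.
have -> : 3 / (1 - q) * q ^+ n = q ^+ n / (1 - q) + q ^+ n / (1 - q) + q ^+ n / (1 - q) by ring.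
apply: lerD (b2 isT); apply: lerD (b1 isT) _; apply: (le_trans mid).
rewrite ler_pdivlMr ?subr_gt0// ler_piMr ?exprn_ge0 ?(ltW q0)//.
by rewrite lerBlDr lerDl ltW.
Qed.

(** At distance about 2^(-n) the squared increment is of order q^(2n), and its ratio to the distance
    is of order (2 q^2)^n, which tends to 0. *)
Lemma dyadic_quadratic_modulus : 2 * q ^+ 2 < 1 -> forall e, 0 < e -> exists2 del, 0 < del &
  forall s t, 0 <= s -> s <= t -> t <= N%:R -> t - s <= del -> (f t - f s) ^+ 2 <= e * (t - s).
Proof.
move=> q2 e e0; pose K := 2 * (3 / (1 - q)) ^+ 2.
have K0 : 0 < K by rewrite mulr_gt0// exprn_gt0// divr_gt0// subr_gt0.
have q20 : 0 <= 2 * q ^+ 2 by rewrite mulr_ge0// sqr_ge0.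
have [n1 n1n0 Hn1] : exists2 n1, (n0 <= n1)%N & forall n, (n1 <= n)%N -> K * (2 * q ^+ 2) ^+ n <= e.
  have : (2 * q ^+ 2) ^+ n @[n --> \oo] --> (0 : R) by apply: cvg_expr; rewrite ger0_norm.
  move=> /cvgr_le/(_ _ (divr_gt0 e0 K0))[n1 _ H].
  exists (maxn n0 n1); first exact: leq_maxl.
  by move=> n; rewrite geq_max => /andP[_ /H/=]; rewrite ler_pdivlMr// mulrC.
exists (2 ^- n1); first by rewrite invr_gt0.
move=> s t s0 st tN ts; have [<-|sneqt] := eqVneq s t; first by rewrite !subrr expr0n mulr0.
have ts0 : 0 < t - s by rewrite subr_gt0 lt_neqAle sneqt.
have ex : exists n, 2 ^- n.+1 < t - s.
  have : ((1 / 2 : R) ^+ n) @[n --> \oo] --> (0 : R) by apply: cvg_expr; rewrite ger0_norm; lra.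
  move=> /cvgr_lt/(_ _ ts0)[n _ H]; exists n.
  by have := H n.+1 (leqnSn n); rewrite /= mul1r exprVn.
(* The least n with 2^(-n-1) < t - s also satisfies t - s <= 2^(-n); the factor 2 in [K] pays for
   the gap between the two. *)
case: (ex_minnP ex) => n Pn nmin.
have Pn' : t - s <= 2 ^- n.
  case: n Pn nmin => [|n] Pn nmin.
    by apply: (le_trans ts); rewrite lef_pV2 ?posrE// expr0 exprn_ege1// ler1n.
  by rewrite leNgt; apply/negP => /nmin; rewrite ltnn.
have n1n : (n1 <= n)%N.
  rewrite -ltnS ltnNge; apply/negP => nn1; have := lt_le_trans Pn ts.
  by rewrite ltf_pV2 ?posrE// ltNge ler_eXn2l ?nn1 // ltr1n.
have := dyadic_modulus (leq_trans n1n0 n1n) s0 st tN Pn'.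
move=> h; have h2 : (f t - f s) ^+ 2 <= (3 / (1 - q) * q ^+ n) ^+ 2.
  by rewrite -[leLHS]real_normK ?num_real// lerXn2r// nnegrE (le_trans _ h).
apply: (le_trans h2); apply: (@le_trans _ _ (K * (2 * q ^+ 2) ^+ n * (t - s))); last first.
  by apply: ler_wpM2r; [exact: ltW|exact: Hn1].
apply: (@le_trans _ _ (K * (2 * q ^+ 2) ^+ n * 2 ^- n.+1)); last first.
  by apply: ler_wpM2l; [rewrite mulr_ge0 ?exprn_ge0// ltW|exact: ltW].
rewrite le_eqVlt; apply/orP; left; apply/eqP.
rewrite /K [(2 * _) ^+ n]exprMn [2 ^+ n.+1]exprS exprAC.
have u1 : 1 - q != 0 by rewrite subr_eq0 gt_eqF.
have u2 : 2 ^+ n != 0 :> R by rewrite gt_eqF.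
field.
by rewrite ?u1 ?u2.
Qed.

End dyadic.

Section fbm_quadratic.
Context d (T : measurableType d) (R : realType) (P : probability T R).
Context (H : R) (B : R -> {RV P >-> R}).
Hypotheses (H12 : 1 / 2 < H) (H1 : H < 1).
Hypothesis BH : fractional_brownian_motion H B.

Definition quadratic_modulus (f : R -> R) : Prop :=
  forall N : nat, forall e, 0 < e -> exists2 del, 0 < del &
  forall s t, 0 <= s -> s <= t -> t <= N%:R -> t - s <= del -> (f t - f s) ^+ 2 <= e * (t - s).

(** q is taken strictly between 2^(-H) and 2^(-1/2), which H > 1/2 allows: above 2^(-H), dyadic
    increments exceed q^n with summable probability; below 2^(-1/2), 2 q^2 < 1. *)
Lemma fbm_quadratic_modulus : {ae P, forall w, quadratic_modulus (B ^~ w)}.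
Proof.
have [_ _ _ cB] := BH.
pose r : R := 2 `^ (- H); pose r2 : R := 2 `^ (- (1 / 2)).
have r0 : 0 < r by exact: powR_gt0.
have r20 : 0 < r2 by exact: powR_gt0.
have rr2 : r < r2.
  rewrite /r /r2 !powRN ltf_pV2 ?posrE ?powR_gt0// /powR !gt_eqF// ltr_expR ltr_pM2r//.
  by rewrite ln_gt0// ltr1n.
have r2E : r2 ^+ 2 = 1 / 2.
  by rewrite /r2 -powR_mulrn ?powR_ge0// -powRrM (_ : - (1 / 2) * 2%:R = - 1) ?powR_inv1//; field.
pose q := (r + r2) / 2.
have rq : r < q by rewrite /q; lra.
have qr2 : q < r2 by rewrite /q; lra.
have q0 : 0 < q := lt_trans r0 rq.
have q2 : 2 * q ^+ 2 < 1.
  have : q ^+ 2 < r2 ^+ 2 by rewrite ltrXn2r// ltW.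
  by rewrite r2E; lra.
have q1 : q < 1 by have := sqr_ge0 (q - 1); nra.
pose th := q / r; have th1 : 1 < th by rewrite /th ltr_pdivlMr// mul1r.
(* The tail exp(- th^n) is weakened, by exp y >= y^(Q+1) / (Q+1)!, to a multiple of 4^(-n), which
   beats the N 2^n cells of level n. *)
have [Q HQ] : exists Q : nat, 4 <= th ^+ Q.+1.
  have : (th^-1) ^+ n @[n --> \oo] --> (0 : R).
    apply: cvg_expr; rewrite ger0_norm ?invr_ge0 ?(ltW (lt_trans ltr01 th1))//.
    by rewrite invf_lt1// (lt_trans ltr01).
  move=> /cvgr_le/(_ (1 / 4))[|n _ Hn]; first by lra.
  exists n; have := Hn n.+1 (leqnSn n) => /=; rewrite exprVn.
  have p : 0 < th ^+ n.+1 by rewrite exprn_gt0// (lt_trans ltr01).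
  by rewrite -[X in X <= _]div1r ler_pdivrMr//; lra.
pose A N n := \bigcup_(k in [set k | (k.+1 <= N * 2 ^ n)%N])
  [set w | (q ^+ n < `|B (k.+1%:R / 2 ^+ n) w - B (k%:R / 2 ^+ n) w|)%R].
have mA N n : measurable (A N n).
  by apply: bigcup_measurable => k _; apply: measurable_norm_gt; exact: measurable_funB.
have PA N n : (P (A N n) <= (N%:R * (4 * (Q.+1)`!%:R) * (1 / 2) ^+ n)%:E)%E.
  have one k : (P [set w | (q ^+ n < `|B (k.+1%:R / 2 ^+ n) w - B (k%:R / 2 ^+ n) w|)%R]
      <= (4 * (Q.+1)`!%:R * (1 / 4) ^+ n)%:E)%E.
    have pn : 0 < 2 ^+ n :> R by rewrite exprn_gt0.
    have kk : k%:R / 2 ^+ n < k.+1%:R / 2 ^+ n :> R by rewrite ltr_pM2r ?invr_gt0// ltr_nat.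
    have k0 : 0 <= k%:R / 2 ^+ n :> R by rewrite divr_ge0// ltW.
    apply: (le_trans (fbm_increment_tail H12 BH k0 kk (exprn_gt0 n q0))); rewrite lee_fin.
    have -> : (k.+1%:R / 2 ^+ n - k%:R / 2 ^+ n) `^ H = r ^+ n :> R.
      have -> : k.+1%:R / 2 ^+ n - k%:R / 2 ^+ n = 2 `^ (- n%:R) :> R.
        by rewrite -mulrBl -natrB// subSnn mul1r powR_invn.
      by rewrite -powRrM /r -powR_mulrn ?powR_ge0// -powRrM; congr (_ `^ _); ring.
    rewrite -mulrA ler_pM2l// -expr_div_n -/th.
    have thn0 : 0 <= th ^+ n by rewrite exprn_ge0// ltW// (lt_trans ltr01).
    have h1 := expR_ge1Dxn Q thn0.
    have f0 : 0 < (Q.+1)`!%:R :> R by rewrite ltr0n fact_gt0.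
    have h2 : 4 ^+ n <= (th ^+ n) ^+ Q.+1 by rewrite -exprM mulnC exprM lerXn2r// nnegrE// exprn_ge0// ltW// (lt_trans ltr01).
    have p4 : 0 < 4 ^+ n :> R by rewrite exprn_gt0.
    have h3 : 4 ^+ n / (Q.+1)`!%:R <= expR (th ^+ n).
      apply: le_trans h1; apply: (@le_trans _ _ ((th ^+ n) ^+ Q.+1 / (Q.+1)`!%:R)).
        by rewrite ler_pM2r ?invr_gt0.
      by rewrite lerDr.
    rewrite expRN; have -> : (Q.+1)`!%:R * (1 / 4) ^+ n = (4 ^+ n / (Q.+1)`!%:R)^-1 :> R.
      by rewrite invfM invrK expr_div_n expr1n mul1r mulrC.
    by rewrite lef_pV2 ?posrE ?expR_gt0// divr_gt0.
  apply: (@le_trans _ _ (\sum_(k < N * 2 ^ n)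
      P [set w | (q ^+ n < `|B (k.+1%:R / 2 ^+ n) w - B (k%:R / 2 ^+ n) w|)%R])%E).
    rewrite /A (bigcup_mkord (N * 2 ^ n)
      (fun k => [set w | (q ^+ n < `|B (k.+1%:R / 2 ^+ n) w - B (k%:R / 2 ^+ n) w|)%R])).
    apply: (@Boole_inequality _ _ _ P
      (fun k => [set w | (q ^+ n < `|B (k.+1%:R / 2 ^+ n) w - B (k%:R / 2 ^+ n) w|)%R])) => k _.
    apply: measurable_norm_gt; exact: measurable_funB.
  apply: (@le_trans _ _ (\sum_(k < N * 2 ^ n) (4 * (Q.+1)`!%:R * (1 / 4) ^+ n)%:E)%E).
    by apply: lee_sum => k _; exact: one.
  rewrite sumEFin lee_fin sumr_const card_ord. rewrite -[leLHS]mulr_natl natrM natrX.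
  have -> : (1 / 2) ^+ n = 2 ^+ n * (1 / 4) ^+ n :> R.
    by rewrite -exprMn; congr (_ ^+ _); field.
  by rewrite le_eqVlt; apply/orP; left; apply/eqP; ring.
have sub N : {ae P, forall w, exists n0, forall n, (n0 <= n)%N -> ~ A N n w}.
  exists (lim_sup_set (A N)); split.
  - apply: bigcap_measurable => // k _; apply: bigcup_measurable => // k' _; exact: mA.
  - apply: lim_sup_set_cvg0 => //.
    pose C := N%:R * (4 * (Q.+1)`!%:R) : R.
    have C0 : 0 <= C by rewrite !mulr_ge0.
    have le n : (P (A N n) <= ((2 * C) / (2 ^ (n + 1))%:R)%:E)%E.
      apply: (le_trans (PA N n)); rewrite lee_fin -/C addn1 natrX exprS.
      rewrite le_eqVlt; apply/orP; left; apply/eqP; rewrite expr_div_n expr1n; field.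
      by rewrite expf_neq0.
    apply: (@le_lt_trans _ _ (\big[+%E/0%R]_(0 <= n <oo) ((2 * C) / (2 ^ (n + 1))%:R)%:E)%E).
      by apply: lee_nneseries => n *; [exact: measure_ge0|exact: le].
    by rewrite (cvg_lim _ (@cvg_geometric_eseries_half R (2 * C) 0)) ?ltry.
  - move=> w /= Hw n _; apply: contrapT => nex; apply: Hw; exists n => m nm Am.
    by apply: nex; exists m.
have /ae_foralln sub' := sub.
apply: filterS2 cB sub' => w cw Hw N e e0.
have [n0 Hn0] := Hw N.
apply: (@dyadic_quadratic_modulus _ (B ^~ w) N n0 q) => //.
move=> n k nn kn; rewrite leNgt; apply/negP => lt.
by apply: (Hn0 n nn); exists k.
Qed.

End fbm_quadratic.

Lemma powR_exprn (R : realType) (a q : R) n : 0 <= a -> (a ^+ n) `^ q = (a `^ q) ^+ n.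
Proof.
move=> a0; elim: n => [|n IH]; first by rewrite !expr0 powR1.
by rewrite !exprS powRM ?exprn_ge0// IH.
Qed.

(** * Uniform continuity, and the kernel |u - v|^(q - 1) *)

Section compactness.
Context {R : realType}.

(** Only x is confined to the segment: y may lie outside, which lets the discrete approximations of
    a path leave its range. *)
Lemma heine_cantor (psi : R -> R) (a b e : R) : continuous psi -> 0 < e ->
  exists2 del, 0 < del & forall x y, a <= x <= b -> `|x - y| <= del -> `|psi x - psi y| <= e.
Proof.
move=> cpsi e0.
have e20 : 0 < e / 2 by rewrite divr_gt0.
have /compact_near_coveringP ncov := @segment_compact R a b.
have := ncov R (0^'+) (fun del x => forall y, `|x - y| <= del -> `|psi x - psi y| <= e) _.
case=> [x _|].
  have /cvgrPdist_le/(_ _ e20)[r /= r0 Hr] := cpsi x.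
  exists (ball x (r / 2), [set del | del < r / 2]) => /=.
    split; first by apply: nbhsx_ballx; rewrite divr_gt0.
    by apply: nbhs_right_lt; rewrite divr_gt0.
  move=> [x' del] /= [xx' dr] y xy.
  have h1 : `|psi x - psi x'| <= e / 2.
    by apply: Hr; apply: (lt_trans xx'); lra.
  have h2 : `|psi x - psi y| <= e / 2.
    apply: Hr => /=; have -> : x - y = (x - x') + (x' - y) by ring.
    by apply: (le_lt_trans (ler_normD _ _)); move: xx'; rewrite /ball/=; lra.
  have -> : psi x' - psi y = - (psi x - psi x') + (psi x - psi y) by ring.
  by apply: (le_trans (ler_normD _ _)); rewrite normrN; lra.
move=> r /= r0 Hr; exists (r / 2); first by rewrite divr_gt0.
move=> x y xab; apply: (Hr (r / 2)) => //=.
- by rewrite sub0r normrN gtr0_norm; lra.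
- by rewrite divr_gt0.
Qed.

Lemma le_bound_segment (psi : R -> R) (a b : R) : continuous psi ->
  exists2 A, 0 < A & forall x, a <= x <= b -> `|psi x| <= A.
Proof.
move=> cpsi; have [ba|ab] := ltP b a.
  by exists 1 => // x /andP[ax xb]; have := le_trans ax xb; lra.
have cn : {within `[a, b], continuous (fun x => `|psi x|)}.
  apply: continuous_subspaceT => x; apply: continuous_comp (cpsi x) _.
  exact: norm_continuous.
have [c cab Hc] := EVT_max ab cn.
exists (`|psi c| + 1); first by rewrite ltr_wpDl.
by move=> x xab; rewrite (le_trans (Hc x _))// lerDl.
Qed.

End compactness.

Section power_kernel.
Context {R : realType} (q : R).
Hypothesis q0 : 0 < q.
Local Notation mu := (@lebesgue_measure R).

(** The antiderivative of z^(q-1), hence the mass of the kernel over the stretch of length z before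
    u. *)
Definition wpow (z : R) := z `^ q / q.

Lemma wpow0 : wpow 0 = 0.
Proof. by rewrite /wpow powR0 ?gt_eqF// mul0r. Qed.

Lemma wpow_ge0 z : 0 <= wpow z.
Proof. by rewrite /wpow divr_ge0 ?powR_ge0// ltW. Qed.

Lemma le_wpow y z : 0 <= y -> y <= z -> wpow y <= wpow z.
Proof.
move=> y0 yz; rewrite /wpow ler_pM2r ?invr_gt0//.
by apply: ge0_ler_powR; rewrite ?nnegrE// ?(ltW q0)// (le_trans y0).
Qed.

Lemma wpow_small e : 0 < e -> exists2 del, 0 < del & forall z, 0 <= z -> z <= del -> wpow z <= e.
Proof.
move=> e0; exists ((e * q) `^ q^-1); first by rewrite powR_gt0// mulr_gt0.
move=> z z0 zd; rewrite /wpow ler_pdivrMr//.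
have eq0 : 0 <= e * q by rewrite mulr_ge0// ltW.
rewrite -[leRHS](powRr1 eq0) -(mulVf (lt0r_neq0 q0)) powRrM.
by apply: ge0_ler_powR; rewrite ?nnegrE ?powR_ge0// ltW.
Qed.

Definition kerW (u v : R) := `|u - v| `^ (q - 1).

Lemma measurable_kerW u (D : set R) : measurable_fun D (kerW u).
Proof.
apply: measurable_funS (measurableT) _ _ => //.
apply: (measurableT_comp (measurable_powR _)).
apply: measurableT_comp => //; exact: measurable_funB.
Qed.

Lemma is_derive_powR_sub (r u v : R) : v < u ->
  is_derive v 1 (fun v => (u - v) `^ r) (- (r * (u - v) `^ (r - 1))).
Proof.
move=> vu; have uv0 : 0 < u - v by rewrite subr_gt0.
have d1 : is_derive v 1 (fun v => u - v) (- 1).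
  by apply: is_derive_eq; rewrite /GRing.scale/=; ring.
have := @is_derive1_comp _ (fun z => z `^ r) (fun v => u - v) v _ _ (is_derive1_powR r uv0) d1.
by rewrite mulrN1.
Qed.

Lemma integral_kerW_left a c u : a < c -> c < u ->
  (\int[mu]_(v in `[a, c]) (kerW u v)%:E = (wpow (u - a) - wpow (u - c))%:E)%E.
Proof.
move=> ac cu.
pose F v := - wpow (u - v).
have dF v : v < u -> is_derive v 1 F (kerW u v).
  move=> vu; have uv0 : 0 < u - v by rewrite subr_gt0.
  have d3 := is_derive_powR_sub q vu.
  have -> : F = (fun v => - q^-1 * (u - v) `^ q).
    by apply/funext => y; rewrite /F /wpow/= mulNr mulrC.
  apply: is_derive_eq; rewrite /kerW gtr0_norm// /GRing.scale/=; field.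
  exact: lt0r_neq0.
have cW : {within `[a, c], continuous (kerW u)}.
  apply: continuous_in_subspaceT => v; rewrite inE/= in_itv/= => /andP[_ vc].
  have uv0 : 0 < u - v by rewrite subr_gt0 (le_lt_trans vc).
  have d3 := is_derive_powR_sub (q - 1) (le_lt_trans vc cu).
  have cc : {for v, continuous (fun v => (u - v) `^ (q - 1))}.
    by apply: differentiable_continuous; apply/derivable1_diffP; case: d3.
  rewrite /prop_for /continuous_at {2}/kerW gtr0_norm//.
  apply: cvg_trans cc; apply: near_eq_cvg; near=> z.
  rewrite /= /kerW gtr0_norm// subr_gt0.
  by near: z; apply: lt_nbhsl; rewrite -subr_gt0.
have dFF v : v < u -> F x @[x --> v] --> F v.
  move=> vu; apply: differentiable_continuous; apply/derivable1_diffP.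
  by case: (dF v vu).
rewrite (@continuous_FTC2 R (kerW u) F a c ac cW).
- by rewrite -EFinB /F opprK addrC.
- split.
  + by move=> v; rewrite in_itv/= => /andP[_ vc]; case: (dF v (lt_trans vc cu)).
  + by apply: cvg_at_right_filter; apply: dFF; exact: lt_trans cu.
  + by apply: cvg_at_left_filter; apply: dFF.
- move=> v; rewrite in_itv/= => /andP[_ vc]; rewrite derive1E.
  by have := dF v (lt_trans vc cu) => ?; rewrite derive_val.
Unshelve. all: by end_near. Qed.

(** The kernel is unbounded near v = u when q < 1, so [a, u[ is exhausted by the segments [a, c n],
    whose distance to u decreases geometrically. *)
Lemma integral_kerW a u : a <= u ->
  (\int[mu]_(v in `[a, u]) (kerW u v)%:E = (wpow (u - a))%:E)%E.
Proof.
rewrite le_eqVlt => /predU1P[->|au].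
  by rewrite set_itv1 integral_set1 subrr wpow0.
pose c n := u - (u - a) * (1 / 2) ^+ n.+1.
have ua0 : 0 < u - a by rewrite subr_gt0.
have hp n : 0 < (1 / 2) ^+ n :> R by rewrite exprn_gt0.
have cu n : c n < u by rewrite /c ltrBlDr ltrDl mulr_gt0.
have ac n : a < c n.
  rewrite /c ltrBrDr -ltrBrDl gtr_pMr//.
  by rewrite exprn_ilt1//; lra.
have mW D : measurable_fun D (fun v => (kerW u v)%:E).
  by apply/measurable_EFinP; exact: measurable_kerW.
rewrite -integral_itv_bndo_bndc//.
have -> : `[a, u[%classic = \bigcup_n `[a, c n]%classic.
  apply/seteqP; split => v /=; last first.
    move=> [n _]; rewrite /= !in_itv/= => /andP[-> vc]; exact: le_lt_trans (cu n).
  rewrite in_itv/= => /andP[av vu].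
  have h0 : (1 / 2) ^+ n @[n --> \oo] --> (0 : R).
    by apply: cvg_expr; rewrite ger0_norm; lra.
  have d0 : 0 < (u - v) / (u - a) by rewrite divr_gt0// subr_gt0.
  have [n _ /(_ n.+1 (leqnSn n))/= Hn] := cvgr_le _ h0 _ d0.
  exists n => //=; rewrite in_itv/= av /c lerBrDr -lerBrDl mulrC -ler_pdivlMr//.
have cv : (\int[mu]_(v in `[a, c n]) (kerW u v)%:E)%E @[n --> \oo] -->
    (\int[mu]_(v in \bigcup_n `[a, c n]%classic) (kerW u v)%:E)%E.
  apply: ge0_nondecreasing_set_cvg_integral.
  2: by [].
  2: by move=> n; exact: mW.
  2: by move=> n v _; rewrite lee_fin powR_ge0.
  move=> n m nm; rewrite subsetEset => v /=; rewrite !in_itv/= => /andP[-> h]/=.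
  apply: (le_trans h); rewrite /c lerD2l lerN2 ler_pM2l//.
  by rewrite ler_wiXn2l//; lra.
rewrite -(cvg_lim _ cv)//; apply: cvg_lim => //.
have -> : (fun n => \int[mu]_(v in `[a, c n]) (kerW u v)%:E)%E =
  (fun n => (wpow (u - a) - (wpow (u - a) * (1 / 2) `^ q) * ((1 / 2) `^ q) ^+ n)%:E).
  apply/funext => n; rewrite integral_kerW_left//; congr (_ - _)%:E.
  rewrite /c opprB addrC subrK /wpow powRM ?(ltW ua0) ?(ltW (hp _))//.
  have -> : ((1 / 2) ^+ n.+1) `^ q = ((1 / 2) `^ q) ^+ n.+1 :> R.
    by rewrite powR_exprn// divr_ge0.
  by rewrite exprS; ring.
apply: cvg_EFin; first by apply: nearW.
have r1 : (1 / 2) `^ q < 1 :> R.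
  rewrite /powR gt_eqF; last by lra.
  rewrite expR_lt1 pmulr_rlt0//; apply: ln_lt0; lra.
have : ((1 / 2) `^ q) ^+ n @[n --> \oo] --> (0 : R).
  by apply: cvg_expr; rewrite ger0_norm ?powR_ge0.
move=> h; rewrite -[X in _ --> X]subr0; apply: cvgB; first exact: cvg_cst.
by rewrite -(mulr0 (wpow (u - a) * (1 / 2) `^ q)); exact: cvgMl_tmp.
Qed.

Lemma integrable_kerW a u : mu.-integrable `[a, u] (EFin \o kerW u).
Proof.
have [ua|au] := ltP u a.
  by rewrite set_itv_ge ?bnd_simp ?leNgt ?ua//; exact: integrable_set0.
apply/integrableP; split; first by apply/measurable_EFinP; exact: measurable_kerW.
under eq_integral => v _ do rewrite /= ger0_norm ?powR_ge0//.
by rewrite integral_kerW// ltry.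
Qed.

Lemma Rintegral_kerW a c u : a <= c -> c <= u ->
  \int[mu]_(v in `[a, c]) kerW u v = wpow (u - a) - wpow (u - c).
Proof.
move=> ac cu; have au := le_trans ac cu.
have h x : x <= u -> \int[mu]_(v in `[x, u]) kerW u v = wpow (u - x).
  by move=> xu; rewrite /Rintegral integral_kerW.
have := @Rintegral_itvB R (kerW u) (BLeft a) (BRight u) c (integrable_kerW a u).
rewrite !bnd_simp => /(_ ac cu); rewrite Rintegral_itv_obnd_cbnd; last first.
  apply: integrableS (integrable_kerW a u) => //; apply: subset_itvr.
  by rewrite bnd_simp.
by rewrite !h// => <-; ring.
Qed.

End power_kernel.

(** * Riemann and Volterra sums along a path *)

Section path_calculus.
Context {R : realType} (T : R).
Hypothesis T0 : 0 < T.
Local Notation mu := (@lebesgue_measure R).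
Implicit Types (phi psi W : R -> R).

Definition clamp (t : R) : R := Num.max 0 (Num.min t T).

Lemma clamp_itv t : 0 <= clamp t <= T.
Proof. by rewrite /clamp le_max lexx/= ge_max (ltW T0) ge_min lexx orbT. Qed.

Lemma clampE t : 0 <= t <= T -> clamp t = t.
Proof. by move=> /andP[t0 tT]; rewrite /clamp min_l// max_r. Qed.

Lemma clamp_le s t : s <= t -> clamp s <= clamp t /\ clamp t - clamp s <= t - s.
Proof.
have c z : [\/ z <= 0 /\ clamp z = 0, (0 <= z /\ z <= T) /\ clamp z = z | T <= z /\ clamp z = T].
  case: (lerP z 0) => [z0|/ltW z0].
    by apply: Or31; split=> //; rewrite /clamp min_l ?(le_trans z0 (ltW T0))// max_l.
  case: (lerP z T) => [zT|/ltW zT]; first by apply: Or32; rewrite clampE ?z0.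
  by apply: Or33; rewrite /clamp min_r// max_r// ltW.
case: (c s) => [[h ->]|[[h1 h2] ->]|[h ->]]; case: (c t) => [[h' ->]|[[h1' h2'] ->]|[h' ->]] st; have T0' := T0; split; lra.
Qed.

(* Continuity on [0, T], expressed through the retraction of the line onto [0, T]. *)
Definition cont phi := continuous (fun t => phi (clamp t)).

Lemma cont_bound phi : cont phi -> exists2 A, 0 < A & forall t, 0 <= t <= T -> `|phi t| <= A.
Proof.
move=> /(le_bound_segment 0 T)[A A0 HA]; exists A => // t tT.
by have := HA t tT; rewrite clampE.
Qed.

Lemma cont_unif phi : cont phi -> forall e, 0 < e -> exists2 del, 0 < del &
  forall x y, 0 <= x <= T -> 0 <= y <= T -> `|x - y| <= del -> `|phi x - phi y| <= e.
Proof.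
move=> cphi e e0; have [del del0 H] := heine_cantor 0 T cphi e0; exists del => // x y xT yT xy.
by have := H x y xT xy; rewrite !clampE.
Qed.

Lemma unif_cont phi : (forall e, 0 < e -> exists2 del, 0 < del &
  forall x y, 0 <= x -> x <= y -> y <= T -> y - x <= del -> `|phi x - phi y| <= e) -> cont phi.
Proof.
move=> H t; apply/cvgrPdist_le => e /H[del del0 {}H].
exists del => //= s ts.
have [st|/ltW st] := leP s t; have [h1 h2] := clamp_le st.
  rewrite distrC; have /andP[a1 _] := clamp_itv s; have /andP[_ a2] := clamp_itv t.
  by apply: H => //; apply: (le_trans h2); rewrite -(ger0_norm (x := t - s)) ?subr_ge0// ltW.
have /andP[a1 _] := clamp_itv t; have /andP[_ a2] := clamp_itv s.
by apply: H => //; apply: (le_trans h2); rewrite -(ger0_norm (x := s - t)) ?subr_ge0// distrC ltW.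
Qed.

Lemma cont_measurable phi : cont phi -> measurable_fun `[0, T] phi.
Proof.
move=> cphi; apply: (eq_measurable_fun (fun t => phi (clamp t))).
  by move=> t; rewrite inE/= in_itv/= => tT; rewrite clampE.
apply: measurable_funS (continuous_measurable_fun cphi) => //.
Qed.

Lemma integrable_cont_mul phi W a b : cont phi -> 0 <= a -> b <= T ->
  mu.-integrable `[a, b] (EFin \o W) -> mu.-integrable `[a, b] (EFin \o (fun t => phi t * W t)).
Proof.
move=> cphi a0 bT iW; have [A A0 HA] := cont_bound cphi.
have sub : `[a, b] `<=` `[0, T] by apply: subset_itv; rewrite bnd_simp.
apply: (@le_integrable _ _ _ mu _ _ _ (EFin \o (fun t => A * W t))) => //.
- apply/measurable_EFinP; apply: measurable_funM.
    exact: measurable_funS (cont_measurable cphi).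
  by apply/measurable_EFinP; exact: (measurable_int mu).
- move=> t /= tab; rewrite lee_fin !normrM ler_wpM2r//.
  by rewrite (gtr0_norm A0) HA//; have := sub _ tab; rewrite /= in_itv/=.
- have -> : EFin \o (fun t => A * W t) = (fun t => A%:E * (EFin \o W) t)%E by [].
  exact: integrableZl.
Qed.

Lemma integrable_cst_itv a b (c : R) : mu.-integrable `[a, b] (EFin \o (fun=> c)).
Proof.
apply: continuous_compact_integrable; first exact: segment_compact.
by apply: continuous_subspaceT => x; exact: cvg_cst.
Qed.

Lemma integrable_cont phi a b : cont phi -> 0 <= a -> b <= T ->
  mu.-integrable `[a, b] (EFin \o phi).
Proof.
move=> cphi a0 bT; have := integrable_cont_mul cphi a0 bT (integrable_cst_itv a b 1).
by congr (_.-integrable _ _); apply/funext => t /=; rewrite mulr1.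
Qed.

Lemma Rint_split phi a b c : mu.-integrable `[a, c] (EFin \o phi) -> a <= b -> b <= c ->
  \int[mu]_(t in `[a, c]) phi t = \int[mu]_(t in `[a, b]) phi t + \int[mu]_(t in `[b, c]) phi t.
Proof.
move=> iphi ab bc; have := @Rintegral_itvB R phi (BLeft a) (BRight c) b iphi.
rewrite !bnd_simp => /(_ ab bc); rewrite Rintegral_itv_obnd_cbnd; last first.
  by apply: integrableS iphi => //; apply: subset_itvr; rewrite bnd_simp.
by move=> <-; rewrite addrC subrK.
Qed.

Lemma integrable_sub (I J : interval R) phi : (J <= I)%O ->
  mu.-integrable [set` I] (EFin \o phi) -> mu.-integrable [set` J] (EFin \o phi).
Proof. by move=> JI; apply: integrableS => //; exact: subitvP. Qed.

Lemma integrable_itvB (I : interval R) phi W : mu.-integrable [set` I] (EFin \o phi) ->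
  mu.-integrable [set` I] (EFin \o W) -> mu.-integrable [set` I] (EFin \o (fun t => phi t - W t)).
Proof.
move=> h1 h2.
have -> : EFin \o (fun t => phi t - W t) = ((EFin \o phi) \- (EFin \o W))%E by [].
exact: integrableB.
Qed.

Lemma integrable_itvZ (I : interval R) phi c : mu.-integrable [set` I] (EFin \o phi) ->
  mu.-integrable [set` I] (EFin \o (fun t => c * phi t)).
Proof. by move=> h; exact: (integrableZl _ c h). Qed.

Lemma le_norm_Rint (D : interval R) phi W : mu.-integrable [set` D] (EFin \o phi) ->
  mu.-integrable [set` D] (EFin \o W) -> (forall t, t \in D -> `|phi t| <= W t) ->
  `|\int[mu]_(t in [set` D]) phi t| <= \int[mu]_(t in [set` D]) W t.
Proof.
move=> iphi iW H.
apply: (@le_trans _ _ (\int[mu]_(t in [set` D]) `|phi t|)).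
  by apply: le_normr_Rintegral.
apply: le_Rintegral => //.
exact: (integrable_norm iphi).
Qed.

Lemma Rint_cst a b (c : R) : a <= b -> \int[mu]_(t in `[a, b]) c = c * (b - a).
Proof.
move=> ab; rewrite /Rintegral integral_cst//= lebesgue_measure_itv/= lte_fin.
case: ltP => [_|ba]; first by rewrite -EFinB -EFinM.
by rewrite mule0/= (le_anti (introT andP (conj ab ba))) subrr mulr0.
Qed.

(** phi is frozen to c j on each cell while the weight is integrated exactly, so a singular weight
    does no harm. It is used with W = 1 and with the kernel. *)
Lemma riemann_weighted phi W (tau c : nat -> R) eta m :
  (forall j, tau j <= tau j.+1) ->
  mu.-integrable `[tau 0, tau m] (EFin \o W) ->
  mu.-integrable `[tau 0, tau m] (EFin \o (fun t => phi t * W t)) ->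
  (forall t, 0 <= W t) ->
  (forall j t, (j < m)%N -> tau j <= t <= tau j.+1 -> `|phi t - c j| <= eta) ->
  `|\int[mu]_(t in `[tau 0, tau m]) (phi t * W t) -
    \sum_(j < m) c j * \int[mu]_(t in `[tau j, tau j.+1]) W t| <=
  eta * \int[mu]_(t in `[tau 0, tau m]) W t.
Proof.
move=> mono; have mon j k : (j <= k)%N -> tau j <= tau k.
  by apply: (homo_leq (@lexx _ _) (@le_trans _ _)).
elim: m => [|m IH] iW ipW W0 H.
  by rewrite big_ord0 !set_itv1 !Rintegral_set1 subrr normr0 mulr0.
have t0m := mon _ _ (leq0n m); have tm := mono m.
have sl : (`[tau 0, tau m] <= `[tau 0, tau m.+1])%O by rewrite subitvE !bnd_simp ?lexx ?tm.
have sr : (`[tau m, tau m.+1] <= `[tau 0, tau m.+1])%O by rewrite subitvE !bnd_simp ?lexx ?t0m.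
have iWr := integrable_sub sr iW; have ipWr := integrable_sub sr ipW.
have {}IH := IH (integrable_sub sl iW) (integrable_sub sl ipW) W0
  (fun j t jm => H j t (ltnW jm)).
rewrite (Rint_split ipW t0m tm) (Rint_split iW t0m tm) big_ord_recr/= mulrDr.
set A := \int[mu]_(t in _) _ in IH *; set S := \sum_(j < m) _ in IH *.
have cE : \int[mu]_(t in `[tau m, tau m.+1]) (phi t * W t) -
    c m * \int[mu]_(t in `[tau m, tau m.+1]) W t =
  \int[mu]_(t in `[tau m, tau m.+1]) ((phi t - c m) * W t).
  rewrite -RintegralZl// -RintegralB//; last first.
    have -> : EFin \o (fun t => c m * W t) = (fun t => (c m)%:E * (EFin \o W) t)%E by [].
    exact: integrableZl.
  by apply: eq_Rintegral => t _; rewrite mulrBl.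
have -> : A + \int[mu]_(t in `[tau m, tau m.+1]) (phi t * W t) -
    (S + c m * \int[mu]_(t in `[tau m, tau m.+1]) W t) =
  (A - S) + \int[mu]_(t in `[tau m, tau m.+1]) ((phi t - c m) * W t) by rewrite -cE; ring.
apply: (le_trans (ler_normD _ _)); apply: lerD IH _.
rewrite -RintegralZl//; apply: le_norm_Rint => //.
- have -> : EFin \o (fun t => (phi t - c m) * W t) =
    (fun t => (EFin \o (fun t => (phi t * W t)%R)) t - (c m)%:E * (EFin \o W) t)%E.
    by apply/funext => t /=; rewrite mulrBl.
  by apply: integrableB => //; exact: integrableZl.
- have -> : EFin \o (fun t => eta * W t) = (fun t => eta%:E * (EFin \o W) t)%E by [].
  exact: integrableZl.
- move=> t; rewrite in_itv/= => tin; rewrite normrM (ger0_norm (W0 t)) ler_wpM2r//.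
  exact: H tin.
Qed.

Definition prim phi (t : R) := \int[mu]_(s in `[0, t]) phi s.

Lemma prim0 phi : prim phi 0 = 0.
Proof. by rewrite /prim set_itv1 Rintegral_set1. Qed.

Lemma primB phi s t : cont phi -> 0 <= s -> s <= t -> t <= T ->
  prim phi t - prim phi s = \int[mu]_(r in `[s, t]) phi r.
Proof.
move=> cphi s0 st tT; rewrite /prim (Rint_split (b := s))//; last exact: integrable_cont.
by rewrite addrC addKr.
Qed.

Lemma prim_lip phi A s t : cont phi -> (forall r, 0 <= r <= T -> `|phi r| <= A) ->
  0 <= s -> s <= t -> t <= T -> `|prim phi t - prim phi s| <= A * (t - s).
Proof.
move=> cphi HA s0 st tT; rewrite primB// -Rint_cst//.
apply: (@le_norm_Rint (`[s, t])) => //; [exact: integrable_cont|exact: integrable_cst_itv|].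
by move=> r; rewrite in_itv/= => /andP[sr rt]; apply: HA; rewrite (le_trans s0)// (le_trans rt).
Qed.

Lemma prim_cont phi : cont phi -> cont (prim phi).
Proof.
move=> cphi; have [A A0 HA] := cont_bound cphi.
apply: unif_cont => e e0; exists (e / A); first by rewrite divr_gt0.
move=> x y x0 xy yT xye; rewrite distrC (le_trans (prim_lip cphi HA x0 xy yT))//.
by rewrite mulrC -ler_pdivlMr.
Qed.

Local Notation D n := (T / n%:R).

Lemma mesh_small del : 0 < del -> exists N, forall n, (N < n)%N -> 0 < D n /\ D n <= del.
Proof.
move=> del0; exists (Num.truncn (T / del)) => n Nn.
have n0 : 0 < n%:R :> R by rewrite ltr0n (leq_ltn_trans _ Nn).
split; first by rewrite divr_gt0.
rewrite ler_pdivrMr// mulrC -ler_pdivrMr// ltW//.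
have /andP[_ h] := truncn_itv (ltW (divr_gt0 T0 del0)).
by rewrite (lt_le_trans h)// ler_nat.
Qed.

Lemma grid_le n k : (0 < n)%N -> (k <= n)%N -> 0 <= k%:R * D n <= T.
Proof.
move=> n0 kn; rewrite mulr_ge0 ?divr_ge0 ?(ltW T0)//= mulrCA ler_piMr ?(ltW T0)//.
by rewrite ler_pdivrMr ?ltr0n// mul1r ler_nat.
Qed.

Lemma grid_cell n k u : (k < n)%N -> k%:R * D n <= u <= k.+1%:R * D n ->
  0 <= u <= T /\ `|k%:R * D n - u| <= D n.
Proof.
move=> kn /andP[h1 h2]; have n0 : (0 < n)%N := leq_ltn_trans (leq0n k) kn.
have /andP[a1 _] := grid_le n0 (ltnW kn); have /andP[_ a2] := grid_le n0 kn.
split; first by rewrite (le_trans a1)// (le_trans h2).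
rewrite distrC ger0_norm ?subr_ge0// lerBlDl (le_trans h2)//.
by rewrite -natr1 mulrDl mul1r.
Qed.

(** Uniformity over whole cells, rather than at grid points, lets the convergence survive
    composition, products, integration and evaluation anywhere in a cell. *)
Definition grid_cvg (a : nat -> nat -> R) phi := forall e, 0 < e -> exists N, forall n k u,
  (N < n)%N -> (k < n)%N -> k%:R * D n <= u <= k.+1%:R * D n -> `|a n k - phi u| <= e.

Lemma grid_cvg_near a phi : cont phi ->
  (forall e, 0 < e -> exists N, forall n k, (N < n)%N -> (k < n)%N ->
     `|a n k - phi (k%:R * D n)| <= e) -> grid_cvg a phi.
Proof.
move=> cphi H e e0; have e20 : 0 < e / 2 by rewrite divr_gt0.
have [N1 H1] := H _ e20; have [del del0 Hd] := cont_unif cphi e20.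
have [N2 H2] := mesh_small del0; exists (maxn N1 N2) => n k u; rewrite gtn_max => /andP[n1 n2] kn ku.
have n0 : (0 < n)%N := leq_ltn_trans (leq0n k) kn.
have [uT d] := grid_cell kn ku.
have -> : a n k - phi u = (a n k - phi (k%:R * D n)) + (phi (k%:R * D n) - phi u) by ring.
rewrite (le_trans (ler_normD _ _))// [leRHS](splitr e) lerD ?H1// Hd ?grid_le// 1?ltnW//.
by rewrite (le_trans d)//; case: (H2 n n2).
Qed.

Lemma grid_cvg_comp psi a phi : continuous psi -> cont phi -> grid_cvg a phi ->
  grid_cvg (fun n k => psi (a n k)) (fun t => psi (phi t)).
Proof.
move=> cpsi cphi H e e0; have [A A0 HA] := cont_bound cphi.
have [del del0 Hd] := heine_cantor (- A) A cpsi e0; have [N HN] := H _ del0.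
exists N => n k u Nn kn ku; have [uT _] := grid_cell kn ku.
by rewrite distrC; apply: Hd; [rewrite -ler_norml HA|rewrite distrC; exact: HN].
Qed.

Lemma grid_cvg_mul a phi c psi : cont phi -> cont psi -> grid_cvg a phi -> grid_cvg c psi ->
  grid_cvg (fun n k => a n k * c n k) (fun t => phi t * psi t).
Proof.
move=> cphi cpsi Ha Hc e e0.
have [A A0 HA] := cont_bound cphi; have [C C0 HC] := cont_bound cpsi.
pose e' := Num.min 1 (e / (1 + A + C)).
have S0 : 0 < 1 + A + C by rewrite !addr_gt0.
have e'0 : 0 < e' by rewrite lt_min ltr01 divr_gt0.
have [N1 H1] := Ha _ e'0; have [N2 H2] := Hc _ e'0.
exists (maxn N1 N2) => n k u; rewrite gtn_max => /andP[n1 n2] kn ku.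
have [uT _] := grid_cell kn ku; have {}H1 := H1 n k u n1 kn ku; have {}H2 := H2 n k u n2 kn ku.
have -> : a n k * c n k - phi u * psi u = (a n k - phi u) * (c n k - psi u) +
  phi u * (c n k - psi u) + (a n k - phi u) * psi u by ring.
apply: (@le_trans _ _ (e' * 1 + A * e' + e' * C)).
  apply: (le_trans (ler_normD _ _)); apply: lerD; last by rewrite normrM ler_pM ?HC.
  apply: (le_trans (ler_normD _ _)); apply: lerD; last by rewrite normrM ler_pM ?HA.
  by rewrite normrM ler_pM// (le_trans H2)// ge_min lexx.
have -> : e' * 1 + A * e' + e' * C = e' * (1 + A + C) by ring.
by rewrite -ler_pdivlMr// ge_min lexx orbT.
Qed.

Lemma grid_sum a phi : cont phi -> grid_cvg a phi -> forall e, 0 < e -> exists N, forall n l,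
  (N < n)%N -> (l <= n)%N -> `|\sum_(j < l) a n j * D n - prim phi (l%:R * D n)| <= e.
Proof.
move=> cphi H e e0; have eT0 : 0 < e / T by rewrite divr_gt0.
have [N HN] := H _ eT0; exists N => n l Nn ln; rewrite distrC.
have n0 : (0 < n)%N := leq_ltn_trans (leq0n N) Nn.
have /andP[l0 lT] := grid_le n0 ln.
have Dn0 : 0 <= D n by rewrite divr_ge0// ltW.
pose tau (j : nat) : R := j%:R * D n.
have tau0 : tau 0%N = 0 by rewrite /tau mul0r.
have mono j : tau j <= tau j.+1 by rewrite /tau ler_wpM2r// ler_nat.
have i1 := integrable_cst_itv (tau 0%N) (tau l) 1.
have i2 : mu.-integrable `[tau 0%N, tau l] (EFin \o (fun t => phi t * 1)).
  by apply: integrable_cont_mul; rewrite ?tau0//; exact: integrable_cst_itv.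
have i3 j t : (j < l)%N -> tau j <= t <= tau j.+1 -> `|phi t - a n j| <= e / T.
  by move=> jl jt; rewrite distrC; apply: HN => //; exact: leq_trans ln.
have := @riemann_weighted phi (fun=> 1) tau (a n) (e / T) l mono i1 i2 (fun=> ler01) i3.
rewrite tau0 Rint_cst// subr0 mul1r => h.
apply: (@le_trans _ _ (e / T * tau l)); last first.
  by rewrite mulrAC ler_pdivrMr// ler_pM2l.
apply: le_trans h; rewrite le_eqVlt; apply/orP; left; apply/eqP; congr `|_ - _|.
  by rewrite /prim; apply: eq_Rintegral => t _; rewrite mulr1.
by apply: eq_bigr => j _; rewrite Rint_cst// /tau -mulrBl -natrB// subSnn !mul1r.
Qed.

(** The flag s decides whether cell k is included. Both versions are wanted, for the products p at m
    and at l + 1 in [euler_diffE]. *)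
Lemma grid_cvg_prim (s : bool) a phi : cont phi -> grid_cvg a phi ->
  grid_cvg (fun n k => \sum_(j < s + k) a n j * D n) (prim phi).
Proof.
move=> cphi H; have cP := prim_cont cphi; move=> e e0; have e20 : 0 < e / 2 by rewrite divr_gt0.
have [N1 H1] := grid_sum cphi H e20; have [del del0 Hd] := cont_unif cP e20.
have [N2 H2] := mesh_small del0; exists (maxn N1 N2) => n k u; rewrite gtn_max => /andP[n1 n2] kn ku.
have n0 : (0 < n)%N := leq_ltn_trans (leq0n k) kn.
have [uT d] := grid_cell kn ku.
have skn : (s + k <= n)%N by case: s => //; rewrite ltnW.
rewrite -(subrK (prim phi ((s + k)%:R * D n)) (\sum_(j < s + k) _)) -addrA.
rewrite (le_trans (ler_normD _ _))// [leRHS](splitr e) lerD ?H1// Hd ?grid_le//.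
case: (H2 n n2) => Dn0 Dnd; apply: le_trans Dnd.
case: (s) => //; rewrite add1n; move/andP: ku => [k1 k2].
rewrite ger0_norm ?subr_ge0//; apply: (@le_trans _ _ (k.+1%:R * D n - k%:R * D n)).
  by rewrite lerB.
by rewrite -mulrBl -natrB// subSnn mul1r.
Qed.

Lemma riemann_limit a phi : cont phi -> grid_cvg a phi ->
  (\sum_(j < n) a n j * D n) @[n --> \oo] --> prim phi T.
Proof.
move=> cphi H; apply/cvgrPdist_le => e e0; have [N HN] := grid_sum cphi H e0.
exists N.+1 => // n /= Nn; have := HN n n Nn (leqnn n); rewrite distrC.
by rewrite mulrC divfK// pnatr_eq0 -lt0n (leq_ltn_trans _ Nn).
Qed.

Section volterra.
Context (q : R).
Hypotheses (q0 : 0 < q) (q1 : q < 1).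

Definition volterra (g : R -> R) (u : R) := \int[mu]_(v in `[0, u]) (g v * kerW q u v).

Lemma integrable_volterra g a b u : cont g -> 0 <= a -> b <= u -> u <= T ->
  mu.-integrable `[a, b] (EFin \o (fun v => g v * kerW q u v)).
Proof.
move=> cg a0 bu uT; apply: integrable_cont_mul => //; first exact: le_trans bu uT.
apply: (@integrable_sub (`[a, u])); last exact: integrable_kerW.
by rewrite subitvE !bnd_simp ?lexx.
Qed.

Lemma volterra_le g A a b u : cont g -> (forall t, 0 <= t <= T -> `|g t| <= A) ->
  0 <= a -> a <= b -> b <= u -> u <= T ->
  `|\int[mu]_(v in `[a, b]) (g v * kerW q u v)| <= A * (wpow q (u - a) - wpow q (u - b)).
Proof.
move=> cg HA a0 ab bu uT.
have ik : mu.-integrable `[a, b] (EFin \o kerW q u).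
  apply: (@integrable_sub (`[a, u])); last exact: integrable_kerW.
  by rewrite subitvE !bnd_simp ?lexx.
rewrite -(Rintegral_kerW q0 ab bu) -RintegralZl//.
apply: (@le_norm_Rint (`[a, b])); first exact: integrable_volterra.
  have -> : EFin \o (fun t => A * kerW q u t) = (fun t => A%:E * (EFin \o kerW q u) t)%E by [].
  exact: integrableZl.
move=> t; rewrite in_itv/= => /andP[at_ tb].
rewrite normrM (ger0_norm (powR_ge0 _ _)) ler_wpM2r ?powR_ge0// HA//.
by rewrite (le_trans a0)//= (le_trans tb)// (le_trans bu).
Qed.

(** For v < u the kernel decreases when u moves to u', so its loss over [0, u] is at most the mass
    near u'; the stretch [u, u'] contributes the same bound, hence the 2. *)
Lemma volterra_holder g A u u' : cont g -> (forall t, 0 <= t <= T -> `|g t| <= A) ->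
  0 <= u -> u <= u' -> u' <= T -> `|volterra g u' - volterra g u| <= 2 * A * wpow q (u' - u).
Proof.
move=> cg HA u0 uu' u'T; have uT := le_trans uu' u'T.
have A0 : 0 <= A by apply: (le_trans (normr_ge0 (g 0))); rewrite HA// lexx ltW.
rewrite /volterra (Rint_split (integrable_volterra cg (lexx 0) (lexx u') u'T) u0 uu').
rewrite addrAC; have i' := integrable_volterra cg (lexx 0) uu' u'T.
have i := integrable_volterra cg (lexx 0) (lexx u) uT.
have ik' : mu.-integrable `[0, u] (EFin \o kerW q u').
  apply: (@integrable_sub (`[0, u'])); last exact: integrable_kerW.
  by rewrite subitvE !bnd_simp ?lexx.
have ik := integrable_kerW q0 0 u.
have s1 : (`[0, u[ <= `[0, u])%O by rewrite subitvE !bnd_simp ?lexx.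
rewrite -RintegralB//.
have iB : mu.-integrable `[0, u[ (EFin \o (fun v => g v * kerW q u' v - g v * kerW q u v)).
  by apply: (integrable_sub s1); exact: integrable_itvB.
have iK : mu.-integrable `[0, u[ (EFin \o (fun v => A * (kerW q u v - kerW q u' v))).
  apply: (integrable_sub s1).
  by apply: integrable_itvZ; exact: integrable_itvB.
rewrite -(Rintegral_itv_bndo_bndc iB).
have h1 : `|\int[mu]_(v in `[0, u[) (g v * kerW q u' v - g v * kerW q u v)| <=
    A * (wpow q u - (wpow q u' - wpow q (u' - u))).
  apply: (@le_trans _ _ (\int[mu]_(v in `[0, u[) (A * (kerW q u v - kerW q u' v)))).
    apply: (@le_norm_Rint (`[0, u[)) => // v; rewrite in_itv/= => /andP[v0 vu].
    rewrite -mulrBr normrM ler_pM// ?HA ?v0 ?(le_trans (ltW vu))//.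
    have uv0 : 0 < u - v by rewrite subr_gt0.
    have uv0' : 0 < u' - v by rewrite subr_gt0 (lt_le_trans vu).
    have kk : kerW q u' v <= kerW q u v.
      rewrite /kerW !gtr0_norm// /powR !gt_eqF// ler_expR; apply: ler_wnM2l; first by rewrite subr_le0 ltW.
      by rewrite ler_ln ?posrE// lerB.
    by rewrite distrC ger0_norm ?subr_ge0.
  rewrite (Rintegral_itv_bndo_bndc iK) RintegralZl//; last exact: integrable_itvB.
  by rewrite RintegralB// !Rintegral_kerW// !subr0 subrr wpow0// subr0.
have h2 := volterra_le cg HA u0 uu' (lexx u') u'T; rewrite subrr wpow0// subr0 in h2.
apply: (le_trans (ler_normD _ _)); apply: (le_trans (lerD h1 h2)).
have h3 : A * wpow q u <= A * wpow q u' by rewrite ler_wpM2l// le_wpow.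
lra.
Qed.

Lemma volterra_cont g : cont g -> cont (volterra g).
Proof.
move=> cg; have [A A0 HA] := cont_bound cg; apply: unif_cont => e e0.
have e'0 : 0 < e / (2 * A) by rewrite divr_gt0// mulr_gt0.
have [del del0 Hd] := wpow_small q0 e'0; exists del => // x y x0 xy yT xyd.
rewrite distrC (le_trans (volterra_holder cg HA x0 xy yT))//.
by rewrite -ler_pdivlMl ?mulr_gt0// mulrC Hd// subr_ge0.
Qed.

Lemma is_derive_sum_ord n (f df : nat -> R -> R) (x : R) :
  (forall l, (l < n)%N -> is_derive x 1 (f l) (df l x)) ->
  is_derive x 1 (fun y => \sum_(l < n) f l y) (\sum_(l < n) df l x).
Proof.
elim: n => [|n IH] H.
  under eq_fun do rewrite big_ord0.
  by rewrite big_ord0; exact: is_derive_cst.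
under eq_fun do rewrite big_ord_recr/=.
rewrite big_ord_recr/=; apply: is_deriveD; last exact: H.
by apply: IH => l ln; apply: H; exact: leqW.
Qed.

Local Notation C n := (@fgn_cov R (q + 1) (D n)).
Local Notation alpha := ((q + 1) * q / 2).

Let is_derive_wpow_sub (t u : R) : t < u ->
  is_derive u 1 (fun u => (u - t) `^ (q + 1) / 2) (alpha * wpow q (u - t)).
Proof.
move=> tu; have tu0 : 0 < u - t by rewrite subr_gt0.
have d1 : is_derive u 1 (fun u => u - t) 1.
  by apply: is_derive_eq; rewrite /GRing.scale/=; ring.
have d3 := @is_derive1_comp _ (fun z => z `^ (q + 1)) (fun u => u - t) u _ _ (is_derive1_powR (q + 1) tu0) d1.
have -> : (fun u => (u - t) `^ (q + 1) / 2) =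
    (fun u => 2^-1 * (((fun z => z `^ (q + 1)) \o (fun u => u - t)) u)).
  by apply/funext => z; rewrite mulrC.
by apply: is_derive_eq; rewrite /GRing.scale/= /wpow addrK; field; exact: lt0r_neq0.
Qed.

(** The covariance of cells l and k becomes the increment over cell k of a function of u; l + 1 < k
    keeps its bases positive, where the power is differentiable. *)
Lemma fgn_cov_second_diff Delta k l : 0 < Delta -> (l.+1 < k)%N ->
  let f u := (u - l%:R * Delta) `^ (q + 1) / 2 - (u - l.+1%:R * Delta) `^ (q + 1) / 2 in
  f (k.+1%:R * Delta) - f (k%:R * Delta) = fgn_cov (q + 1) Delta l k.
Proof.
move=> De0 lk /=; have [m ->] : exists m, k = (l + m.+2)%N.
  by exists (k - l.+2)%N; rewrite addnS addnS -!addSn subnKC.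
rewrite /fgn_cov (_ : (l - (l + m.+2) + (l + m.+2 - l))%N = m.+2); last first.
  by rewrite addKn (eqP (leq_addr _ _ : l - (l + m.+2) == 0)%N).
have E (i j : nat) : (i + j)%:R * Delta - i%:R * Delta = j%:R * Delta.
  by rewrite -mulrBl natrD addrC addKr.
have -> : (l + m.+2).+1%:R * Delta - l%:R * Delta = m.+3%:R * Delta by rewrite -addnS E.
have -> : (l + m.+2).+1%:R * Delta - l.+1%:R * Delta = m.+2%:R * Delta by rewrite -addSn E.
have -> : (l + m.+2)%:R * Delta - l%:R * Delta = m.+2%:R * Delta by rewrite E.
have -> : (l + m.+2)%:R * Delta - l.+1%:R * Delta = m.+1%:R * Delta by rewrite addnS -addSn E.
by rewrite /= !powRM ?(ltW De0)//; field.
Qed.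

Lemma fgn_cov_near Delta l : 0 < Delta -> fgn_cov (q + 1) Delta l l.+1 <= 2 * Delta * (q * wpow q Delta).
Proof.
move=> De0; rewrite /fgn_cov (_ : (l - l.+1 + (l.+1 - l))%N = 1%N) /=; last first.
  by rewrite subSnn (eqP (leqnSn l : l - l.+1 == 0)%N).
rewrite !powR1 powR0 ?gt_eqF ?addr_gt0// subr0.
have h2 : 2 `^ (q + 1) <= 4 :> R.
  rewrite (_ : 4 = 2 `^ 2%:R); last by rewrite powR_mulrn//; ring.
  by have q1' := q1; apply: ler_powR; [rewrite ler1n|lra].
have -> : 2 * Delta * (q * wpow q Delta) = 2 * (Delta `^ q * Delta).
  by rewrite /wpow; field; exact: lt0r_neq0.
have hD : 0 <= Delta `^ q * Delta by rewrite mulr_ge0 ?powR_ge0// ltW.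
rewrite powRD ?powRr1 ?(ltW De0)//; last by rewrite implybE gt_eqF ?orbT// addr_gt0.
nra.
Qed.

(** Away from the adjacent cell, the sum is the increment over cell k of one function F, so its
    quotient by the mesh is F'(c) by the mean value theorem, and F'(c) is alpha times a Riemann sum
    of the Volterra integral at c. The adjacent cell is bounded apart. With q = 2H - 1, alpha is
    [alpha_H]. *)
Lemma volterra_cell g ga : cont g -> grid_cvg ga g ->
  grid_cvg (fun n k => (\sum_(l < k) ga n l * C n l k) / D n) (fun u => alpha * volterra g u).
Proof.
move=> cg Hg e e0; have [A A0 HA] := cont_bound cg.
have al0 : 0 < alpha by rewrite divr_gt0// mulr_gt0// addr_gt0.
have wT0 := wpow_ge0 q0 T.
(* Adds up the coefficients of e' in the final estimate. *)
pose Kc := 2 * q * (A + 1) + alpha * wpow q T + alpha * A + alpha + 1.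
have Kc0 : 0 < Kc.
  have Q1 : 0 < 2 * q * (A + 1) by rewrite !mulr_gt0// addr_gt0.
  have Q2 : 0 <= alpha * wpow q T by rewrite mulr_ge0// ltW.
  have Q3 : 0 < alpha * A by rewrite mulr_gt0.
  by rewrite /Kc; lra.
pose e' := Num.min 1 (e / Kc).
have e'0 : 0 < e' by rewrite lt_min ltr01 divr_gt0.
have e'1 : e' <= 1 by rewrite ge_min lexx.
have e'K : e' * Kc <= e by rewrite -ler_pdivlMr// ge_min lexx orbT.
have [N1 H1] := Hg _ e'0.
have [d1 d10 Hd1] := wpow_small q0 e'0.
have [d2 d20 Hd2] := cont_unif (volterra_cont cg) e'0.
have dd0 : 0 < Num.min (d1 / 2) d2 by rewrite lt_min divr_gt0.
have [N2 H2] := mesh_small dd0.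
exists (maxn N1 N2) => n k u; rewrite gtn_max => /andP[n1 n2] kn ku.
have n0 : (0 < n)%N := leq_ltn_trans (leq0n k) kn.
have [Dn0] := H2 n n2; rewrite le_min => /andP[Dd1 Dd2].
have [/andP[u0 uT] ud] := grid_cell kn ku.
have gaA l : (l < n)%N -> `|ga n l| <= A + 1.
  move=> ln; have h := H1 n l (l%:R * D n) n1 ln.
  have hh : l%:R * D n <= l%:R * D n <= l.+1%:R * D n by rewrite lexx ler_wpM2r ?ler_nat// ltW.
  have -> : ga n l = g (l%:R * D n) + (ga n l - g (l%:R * D n)) by ring.
  by rewrite (le_trans (ler_normD _ _))// lerD ?HA ?grid_le// ?(ltnW ln)// (le_trans (h hh)).
have small z : 0 <= z -> z <= 2 * D n -> wpow q z <= e'.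
  by move=> z0 zD; apply: Hd1 => //; apply: (le_trans zD); rewrite mulrC -ler_pdivlMr.
(* On the first cell the sum is empty and the integral itself is small. *)
case: k kn ku ud => [|k] kn ku ud.
  rewrite big_ord0 mul0r sub0r normrN normrM gtr0_norm//.
  have := volterra_le cg HA (lexx 0) u0 (lexx u) uT; rewrite subrr wpow0// !subr0 -/(volterra g u) => h.
  apply: le_trans e'K; apply: (@le_trans _ _ (alpha * (A * e'))).
    rewrite ler_pM2l// (le_trans h)// ler_pM2l// small//.
    by move: ku => /andP[_]; rewrite mul1r => h1; apply: (le_trans h1); lra.
  have Q1 : 0 <= 2 * q * (A + 1) by rewrite !mulr_ge0 ?addr_ge0// ltW.
  have Q2 : 0 <= alpha * wpow q T by rewrite mulr_ge0// ltW.
  rewrite (_ : alpha * (A * e') = e' * (alpha * A)); last by ring.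
  by rewrite ler_pM2l// /Kc; lra.
pose tau (l : nat) : R := l%:R * D n.
have tau0 : tau 0%N = 0 by rewrite /tau mul0r.
have mono j : tau j <= tau j.+1 by rewrite /tau ler_wpM2r ?ler_nat// ltW.
have tauS j : tau j.+1 = tau j + D n by rewrite /tau -natr1 mulrDl mul1r.
have tlt i j : (i < j)%N -> tau i < tau j by move=> ij; rewrite /tau ltr_pM2r// ltr_nat.
have tle i j : (i <= j)%N -> tau i <= tau j by move=> ij; rewrite /tau ler_pM2r// ler_nat.
(* The index k is now one less than the cell, so F collects the cells l < k and leaves out the
   adjacent one, l = k. *)
pose F y := \sum_(l < k) ga n l * ((y - tau l) `^ (q + 1) / 2 - (y - tau l.+1) `^ (q + 1) / 2).
pose dF y := \sum_(l < k) ga n l * (alpha * wpow q (y - tau l) - alpha * wpow q (y - tau l.+1)).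
have FdF y : tau k.+1 <= y -> is_derive y 1 F (dF y).
  move=> ky; apply: (@is_derive_sum_ord k
    (fun l y => ga n l * ((y - tau l) `^ (q + 1) / 2 - (y - tau l.+1) `^ (q + 1) / 2))
    (fun l y => ga n l * (alpha * wpow q (y - tau l) - alpha * wpow q (y - tau l.+1)))) => l lk.
  have y1 : tau l < y by apply: lt_le_trans ky; apply: tlt; exact: ltnW.
  have y2 : tau l.+1 < y by apply: lt_le_trans ky; apply: tlt.
  have i1 := is_derive_wpow_sub y1; have i2 := is_derive_wpow_sub y2.
  by apply: is_derive_eq; rewrite /GRing.scale/=; ring.
have cF : {within `[tau k.+1, tau k.+2], continuous F}.
  apply: derivable_within_continuous => y; rewrite in_itv/= => /andP[ky _].
  by case: (FdF y ky).
have dFF y : y \in `]tau k.+1, tau k.+2[ -> is_derive y 1 F (dF y).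
  by rewrite in_itv/= => /andP[ky _]; apply: FdF; exact: ltW.
have [c] := MVT_segment (mono k.+1) dFF cF; rewrite in_itv/= => /andP[c1 c2] E.
have FE : F (tau k.+2) - F (tau k.+1) = \sum_(l < k) ga n l * C n l k.+1.
  rewrite /F -sumrB; apply: eq_bigr => l _; rewrite -mulrBr; congr (_ * _).
  by rewrite -(@fgn_cov_second_diff (D n) k.+1 l Dn0 _)// ltnS.
pose S := \sum_(l < k) ga n l * (wpow q (c - tau l) - wpow q (c - tau l.+1)).
have dFE : dF c = alpha * S.
  by rewrite /dF /S mulr_sumr; apply: eq_bigr => l _; ring.
have cT : c <= T by rewrite (le_trans c2)//; have /andP[] := grid_le n0 kn.
have t0 j : 0 <= tau j by rewrite -tau0 tle.
have c0 : 0 <= c by rewrite (le_trans (t0 _) c1).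
have kc : tau k <= c by rewrite (le_trans (mono k)).
pose I1 := \int[mu]_(v in `[0, tau k]) (g v * kerW q c v).
pose I2 := \int[mu]_(v in `[tau k, c]) (g v * kerW q c v).
have GE : volterra g c = I1 + I2.
  by rewrite /volterra (Rint_split (integrable_volterra cg (lexx 0) (lexx c) cT) (t0 k) kc).
have I1S : `|I1 - S| <= e' * wpow q T.
  have i1 : mu.-integrable `[tau 0%N, tau k] (EFin \o kerW q c).
    rewrite tau0; apply: (@integrable_sub (`[0, c])); last exact: integrable_kerW.
    by rewrite subitvE !bnd_simp ?lexx.
  have i2 : mu.-integrable `[tau 0%N, tau k] (EFin \o (fun t => g t * kerW q c t)).
    by rewrite tau0; exact: integrable_volterra.
  have i3 j t : (j < k)%N -> tau j <= t <= tau j.+1 -> `|g t - ga n j| <= e'.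
    move=> jk jt; rewrite distrC; apply: H1 => //; apply: ltn_trans jk _.
    by apply: ltn_trans kn; rewrite ltnS.
  have := @riemann_weighted g (kerW q c) tau (ga n) e' k mono i1 i2 (fun t => powR_ge0 _ _) i3.
  rewrite tau0 Rintegral_kerW// ?subr0 => h.
  rewrite /S (eq_bigr (fun j : 'I_k => ga n j * \int[mu]_(t in `[tau j, tau j.+1]) kerW q c t)); last first.
    by move=> j _; rewrite Rintegral_kerW// (le_trans _ kc)// tle.
  apply: (le_trans h); rewrite ler_pM2l//; have := wpow_ge0 q0 (c - tau k).
  by have := le_wpow q0 c0 cT; lra.
have I2S : `|I2| <= A * e'.
  have := volterra_le cg HA (t0 k) kc (lexx c) cT; rewrite subrr wpow0// subr0 => h.
  rewrite (le_trans h)// ler_pM2l// small ?subr_ge0//.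
  by rewrite lerBlDr (le_trans c2)// !tauS; lra.
have GcGu : `|volterra g c - volterra g u| <= e'.
  apply: Hd2; rewrite ?c0 ?u0//; apply: le_trans Dd2.
  move: ku => /andP[k1 k2]; rewrite -/(tau _) in k1; rewrite -/(tau _) in k2.
  by rewrite ler_norml; have := tauS k.+1; lra.
have CS : `|ga n k * C n k k.+1 / D n| <= 2 * q * (A + 1) * e'.
  have Ck : 0 <= C n k k.+1 / D n by rewrite divr_ge0 ?(ltW Dn0)// fgn_cov_ge0// ?ltrDr// -ltrBrDr (_ : 2 - 1 = 1) //; ring.
  have kn' : (k < n)%N by apply: ltn_trans kn; rewrite ltnS.
  rewrite -mulrA normrM (ger0_norm Ck).
  have h : C n k k.+1 / D n <= 2 * q * e'.
    rewrite ler_pdivrMr//; apply: (le_trans (fgn_cov_near k Dn0)).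
    have : wpow q (D n) <= e' by apply: small; lra.
    rewrite (_ : 2 * D n * (q * wpow q (D n)) = 2 * q * D n * wpow q (D n)); last by ring.
    rewrite (_ : 2 * q * e' * D n = 2 * q * D n * e'); last by ring.
    have P : 0 < 2 * q * D n by apply: mulr_gt0 => //; apply: mulr_gt0.
    by rewrite ler_pM2l.
  have := ler_pM (normr_ge0 _) Ck (gaA k kn') h.
  by rewrite (_ : (A + 1) * (2 * q * e') = 2 * q * (A + 1) * e')//; ring.
have -> : (\sum_(l < k.+1) ga n l * C n l k.+1) / D n - alpha * volterra g u =
    ga n k * C n k k.+1 / D n - alpha * (I1 - S) - alpha * I2 +
    alpha * (volterra g c - volterra g u).
  rewrite big_ord_recr/= -FE E dFE GE tauS [tau k.+1 + _ - _]addrAC subrr add0r.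
  have nz : n%:R != 0 :> R by rewrite pnatr_eq0 -lt0n.
  have Tz : T != 0 := lt0r_neq0 T0.
  by field; rewrite ?nz ?Tz.
apply: le_trans e'K.
apply: (@le_trans _ _ (2 * q * (A + 1) * e' + alpha * (e' * wpow q T) + alpha * (A * e') + alpha * e')).
  apply: (le_trans (ler_normD _ _)); apply: lerD; last by rewrite normrM gtr0_norm// ler_pM2l.
  apply: (le_trans (ler_normB _ _)); apply: lerD; last by rewrite normrM gtr0_norm// ler_pM2l.
  apply: (le_trans (ler_normB _ _)); apply: lerD => //.
  by rewrite normrM gtr0_norm// ler_pM2l.
rewrite -subr_ge0 (_ : _ - _ = e'); first exact: ltW.
by rewrite /Kc; ring.
Qed.

Lemma volterra_limit f g fa ga : cont f -> cont g -> grid_cvg fa f -> grid_cvg ga g ->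
  (\sum_(k < n) fa n k * \sum_(l < k) ga n l * C n l k) @[n --> \oo] -->
  \int[mu]_(u in `[0, T]) (f u * (alpha * volterra g u)).
Proof.
move=> cf cg Hf Hg.
have cV : cont (fun u => alpha * volterra g u).
  move=> t; apply: cvgM; first exact: cvg_cst.
  exact: (volterra_cont cg).
have cfV : cont (fun u => f u * (alpha * volterra g u)).
  by move=> t; apply: cvgM; [exact: cf|exact: cV].
have := riemann_limit cfV (grid_cvg_mul cf cV Hf (volterra_cell cg Hg)).
rewrite /prim; apply: cvg_trans; apply: near_eq_cvg.
exists 1%N => // n /= n0; apply: eq_bigr => k _; rewrite -mulrA divfK//.
by rewrite mulf_neq0 ?lt0r_neq0// invr_gt0 ltr0n.
Qed.

End volterra.

End path_calculus.

(** * Pathwise limits of the Euler sums and the Young integral *)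

Section path_limits.
Context {R : realType} (T : R).
Hypothesis T0 : 0 < T.
Local Notation mu := (@lebesgue_measure R).
Local Notation D n := (T / n%:R).
Lemma cont_comp (psi phi : R -> R) : continuous psi -> cont T phi -> cont T (psi \o phi).
Proof.
move=> cpsi cphi t; apply: (@continuous_comp _ _ _ (fun t => phi (clamp T t)) psi).
  exact: cphi.
exact: cpsi.
Qed.

Context (b db k dk F : R -> R) (M L M1 : R).
Hypothesis bdb : forall y : R, is_derive y 1 b (db y).
Hypothesis dbM : forall y, - L <= db y <= - M.
Hypothesis cdb : continuous db.
Hypothesis M0 : 0 < M.
Hypothesis kdk : forall y : R, is_derive y 1 k (dk y).
Hypothesis cdk : continuous dk.
Hypothesis dkM1 : forall y, `|dk y| <= M1.
Hypothesis Fk : forall y : R, is_derive y 1 F (k y).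

Lemma mean_value (f df : R -> R) x y : (forall z : R, is_derive z 1 f (df z)) ->
  exists2 c, `|c - x| <= `|y - x| & f y - f x = df c * (y - x).
Proof.
move=> fdf; have cf (u v : R) : {within `[u, v], continuous f}.
  by apply: derivable_within_continuous => z _; case: (fdf z).
have [xy|/ltW yx] := leP x y.
  have [c] := MVT_segment xy (fun z _ => fdf z) (cf x y); rewrite in_itv/= => /andP[xc cy] E.
  by exists c => //; rewrite !ger0_norm ?subr_ge0// lerB.
have [c] := MVT_segment yx (fun z _ => fdf z) (cf y x); rewrite in_itv/= => /andP[yc cx] E.
exists c; last by rewrite -opprB E; ring.
by rewrite [leLHS]distrC [leRHS]distrC !ger0_norm ?subr_ge0// lerB.
Qed.

Lemma drift_diff x y : exists2 th, - L <= th <= - M & b y - b x = th * (y - x).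
Proof. by have [c _ E] := mean_value x y bdb; exists (db c). Qed.

Let L0 : 0 < L.
Proof. by have /andP[h1 h2] := dbM 0; have h3 := M0; lra. Qed.

Lemma drift_lip x y : `|b y - b x| <= L * `|y - x|.
Proof.
have [th /andP[t1 t2] ->] := drift_diff x y; rewrite normrM ler_wpM2r//.
by have h := M0; have h' := L0; rewrite ler0_norm; lra.
Qed.

(** L Delta <= 1 makes the factor 1 + th Delta nonnegative, and th <= - M bounds it above. *)
Lemma drift_contract Delta x y : 0 < Delta -> L * Delta <= 1 ->
  `|x + b x * Delta - (y + b y * Delta)| <= (1 - M * Delta) * `|x - y|.
Proof.
move=> De0 LD; have [th /andP[t1 t2] E] := drift_diff y x.
have -> : x + b x * Delta - (y + b y * Delta) = (1 + th * Delta) * (x - y).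
  by rewrite [RHS]mulrDl mul1r mulrAC -E; ring.
have h1 : - L * Delta <= th * Delta by rewrite ler_pM2r.
have h2 : th * Delta <= - M * Delta by rewrite ler_pM2r.
by rewrite normrM ler_wpM2r// ger0_norm; lra.
Qed.

Context (sigma y0 q : R) (beta xi : R -> R).
Hypotheses (q0 : 0 < q) (q1 : q < 1).
Hypothesis cxi : cont T xi.
Hypothesis xiE : forall t, 0 <= t <= T -> xi t = y0 + prim (b \o xi) t + sigma * beta t.
Hypothesis beta0 : beta 0 = 0.
Hypothesis beta_mod : forall e, 0 < e -> exists2 del, 0 < del & forall s t,
  0 <= s -> s <= t -> t <= T -> t - s <= del -> (beta t - beta s) ^+ 2 <= e * (t - s).

Let g n (i : nat) := beta (i.+1%:R * D n) - beta (i%:R * D n).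
Let X n := euler b (D n) sigma y0 (g n).

Let cb : continuous b. Proof. exact: is_derive_continuous bdb. Qed.
Let ck : continuous k. Proof. exact: is_derive_continuous kdk. Qed.
Let cF : continuous F. Proof. exact: is_derive_continuous Fk. Qed.

Let ccomp (psi : R -> R) : continuous psi -> cont T (psi \o xi).
Proof. by move=> cpsi; exact: cont_comp. Qed.

Let xi_step s t : 0 <= s -> s <= t -> t <= T ->
  xi t - xi s = \int[mu]_(r in `[s, t]) b (xi r) + sigma * (beta t - beta s).
Proof.
move=> s0 st tT; rewrite !xiE ?s0 ?(le_trans st)// ?(le_trans s0)//.
by rewrite -(primB (ccomp cb) s0 st tT); ring.
Qed.

Let xi0 : xi 0 = y0.
Proof. by rewrite xiE ?lexx ?(ltW T0)// prim0// beta0; ring. Qed.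

(** Over one step the drift of xi deviates from its frozen value by at most M e Delta, and the
    contraction absorbs exactly this: (1 - M Delta) e + M e Delta = e. *)
Lemma euler_close e : 0 < e -> exists N, forall n m, (N < n)%N -> (m <= n)%N ->
  `|X n m - xi (m%:R * D n)| <= e.
Proof.
move=> e0; have w0 : 0 < e * M / L by rewrite divr_gt0// mulr_gt0.
have [del del0 Hd] := cont_unif cxi w0.
have dd : 0 < Num.min del L^-1 by rewrite lt_min del0 invr_gt0.
have [N HN] := mesh_small T0 dd; exists N => n m Nn.
have [Dn0] := HN n Nn; rewrite le_min => /andP[Dd DL].
have n0 : (0 < n)%N := leq_ltn_trans (leq0n N) Nn.
have LD : L * D n <= 1 by rewrite mulrC -ler_pdivlMr// mul1r.
elim: m => [|m IH] mn; first by rewrite mul0r xi0 subrr normr0 ltW.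
have {}IH := IH (ltnW mn).
have /andP[m0 mT] := grid_le T0 n0 (ltnW mn); have /andP[m0' mT'] := grid_le T0 n0 mn.
have mm : m%:R * D n <= m.+1%:R * D n by rewrite ler_pM2r// ler_nat.
have mD : m.+1%:R * D n - m%:R * D n = D n by rewrite -mulrBl -natrB// subSnn mul1r.
have st := xi_step m0 mm mT'.
pose J := \int[mu]_(r in `[m%:R * D n, m.+1%:R * D n]) (b (xi r) - b (xi (m%:R * D n))).
have JE : \int[mu]_(r in `[m%:R * D n, m.+1%:R * D n]) b (xi r) = J + b (xi (m%:R * D n)) * D n.
  rewrite /J RintegralB//; last exact: integrable_cst_itv.
    by rewrite Rint_cst// mD subrK.
  exact: (integrable_cont (ccomp cb)).
have Jb : `|J| <= M * e * D n.
  rewrite -[in leRHS]mD -Rint_cst//; apply: (@le_norm_Rint _ (`[m%:R * D n, m.+1%:R * D n])).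
  - apply: integrable_itvB; last exact: integrable_cst_itv.
    exact: (integrable_cont (ccomp cb)).
  - exact: integrable_cst_itv.
  - move=> r; rewrite in_itv/= => mr; have [rT rd] := grid_cell T0 mn mr.
    apply: (le_trans (drift_lip _ _)).
    have : `|xi r - xi (m%:R * D n)| <= e * M / L.
      by apply: Hd; rewrite ?m0//; rewrite distrC (le_trans rd).
    by rewrite ler_pdivlMr// mulrC [e * M]mulrC.
have -> : X n m.+1 - xi (m.+1%:R * D n) =
    (X n m + b (X n m) * D n - (xi (m%:R * D n) + b (xi (m%:R * D n)) * D n)) - J.
  rewrite -(subrK (xi (m%:R * D n)) (xi (m.+1%:R * D n))) st JE /X /=.
  by rewrite -/(g n m); ring.
apply: (le_trans (ler_normB _ _)).
apply: (@le_trans _ _ ((1 - M * D n) * e + M * e * D n)); last by rewrite le_eqVlt; apply/orP; left; apply/eqP; ring.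
apply: lerD Jb; apply: (le_trans (drift_contract _ _ Dn0 LD)).
apply: ler_wpM2l IH; rewrite subr_ge0 (le_trans _ LD)// ler_wpM2r ?(ltW Dn0)//.
by have /andP[h1 h2] := dbM 0; lra.
Qed.

Let gX : grid_cvg T X xi.
Proof.
apply: grid_cvg_near => // e e0; have [N HN] := euler_close e0.
by exists N => n m Nn mn; apply: HN => //; exact: ltnW.
Qed.

Lemma taylor_antiderivative x y : `|F y - F x - k x * (y - x)| <= M1 * (y - x) ^+ 2.
Proof.
have [c cx ->] := mean_value x y Fk; have [c' _ E] := mean_value x c kdk.
rewrite -mulrBl normrM E normrM -[(y - x) ^+ 2]real_normK ?num_real// expr2 [leRHS]mulrA.
by rewrite ler_wpM2r// ler_pM.
Qed.

(** F(X_j) telescopes, and each Taylor remainder is at most M1 (X_(j+1) - X_j)^2, which is o(Delta)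
    uniformly by [beta_mod], so no second-order term survives. *)
Lemma increments_sum : (\sum_(j < n) k (X n j) * (X n j.+1 - X n j)) @[n --> \oo] --> F (xi T) - F (xi 0).
Proof.
have M10 : 0 <= M1 := le_trans (normr_ge0 _) (dkM1 0).
have gF : F (X n n) @[n --> \oo] --> F (xi T).
  suff XT : X n n @[n --> \oo] --> xi T by apply: (@cvg_comp _ _ _ (fun n => X n n) F _ _ _ XT); exact: cF.
  apply/cvgrPdist_le => e e0; have [N HN] := euler_close e0.
  exists N.+1 => // n /= Nn; have := HN n n Nn (leqnn n); rewrite distrC.
  by rewrite mulrC divfK// pnatr_eq0 -lt0n (leq_ltn_trans _ Nn).
rewrite xi0; have err : (F (X n n) - F y0 - \sum_(j < n) k (X n j) * (X n j.+1 - X n j)) @[n --> \oo] --> (0 : R).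
  have [A A0 HA] := cont_bound (ccomp cb).
  have gb := grid_cvg_comp T0 cb cxi gX; have [N1 H1] := gb 1 ltr01.
  apply/cvgrPdist_le => e e0.
  pose Kc := 2 * (M1 + 1) * T * (1 + sigma ^+ 2).
  have s1 : 0 < 1 + sigma ^+ 2 by rewrite ltr_pwDl// sqr_ge0.
  have m1 : 0 < M1 + 1 by rewrite ltr_wpDl.
  have Kc0 : 0 < Kc by rewrite !mulr_gt0.
  pose e' := e / Kc; have e'0 : 0 < e' by rewrite divr_gt0.
  have [del del0 Hd] := beta_mod e'0.
  have dd : 0 < Num.min del (e' / (A + 1) ^+ 2) by rewrite lt_min del0 divr_gt0// exprn_gt0// addr_gt0.
  have [N2 H2] := mesh_small T0 dd.
  exists (maxn N1 N2).+1 => // n /=; rewrite gtn_max => /andP[n1 n2].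
  have [Dn0] := H2 n n2; rewrite le_min => /andP[Dd DA].
  have n0 : (0 < n)%N := leq_ltn_trans (leq0n _) n1.
  have tele m : F (X n m) - F y0 = \sum_(j < m) (F (X n j.+1) - F (X n j)).
    elim: m => [|m IH]; first by rewrite big_ord0 subrr.
    by rewrite big_ord_recr/= -IH; ring.
  rewrite sub0r normrN tele -sumrB; apply: (le_trans (ler_norm_sum _ _ _)).
  apply: (@le_trans _ _ (\sum_(j < n) (2 * M1 * (1 + sigma ^+ 2) * e' * D n))); last first.
    rewrite sumr_const card_ord -[leLHS]mulr_natr.
    rewrite (_ : _ * n%:R = 2 * M1 * (1 + sigma ^+ 2) * e' * T); last by field; rewrite pnatr_eq0 -lt0n.
    rewrite -[leRHS](divfK (lt0r_neq0 Kc0)) -/e' /Kc.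
    rewrite (_ : e' * _ = 2 * M1 * (1 + sigma ^+ 2) * e' * T + e' * (2 * T * (1 + sigma ^+ 2))); last by ring.
    rewrite lerDl; apply: mulr_ge0; first exact: ltW.
    by rewrite !mulr_ge0 ?addr_ge0 ?sqr_ge0// ltW.
  apply: ler_sum => j _; have jn := ltn_ord j.
  apply: (le_trans (taylor_antiderivative _ _)).
  have /andP[j0 jT] := grid_le T0 n0 (ltnW jn); have /andP[j0' jT'] := grid_le T0 n0 jn.
  have jj : j%:R * D n <= j.+1%:R * D n by rewrite ler_pM2r// ler_nat.
  have jD : j.+1%:R * D n - j%:R * D n = D n by rewrite -mulrBl -natrB// subSnn mul1r.
  have h1 : (g n j) ^+ 2 <= e' * D n.
    by rewrite -[in leRHS]jD; apply: Hd => //; rewrite jD.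
  have h2 : `|b (X n j)| <= A + 1.
    have hj := H1 n j (j%:R * D n) n1 jn; rewrite lexx jj in hj.
    have hA := HA (j%:R * D n); rewrite j0 jT in hA.
    have -> : b (X n j) = b (xi (j%:R * D n)) + (b (X n j) - b (xi (j%:R * D n))) by ring.
    by apply: (le_trans (ler_normD _ _)); apply: lerD; [exact: hA|exact: hj].
  have h3 : (b (X n j) * D n) ^+ 2 <= e' * D n.
    rewrite (_ : (b (X n j) * D n) ^+ 2 = b (X n j) ^+ 2 * D n * D n); last by ring.
    rewrite ler_pM2r//.
    apply: (@le_trans _ _ ((A + 1) ^+ 2 * D n)).
      by rewrite ler_pM2r// -[leLHS]real_normK ?num_real// lerXn2r// nnegrE// addr_ge0// ltW.
    by rewrite mulrC -ler_pdivlMr// exprn_gt0// addr_gt0.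
  have -> : X n j.+1 - X n j = b (X n j) * D n + sigma * g n j by rewrite /X /=; ring.
  rewrite (_ : 2 * M1 * (1 + sigma ^+ 2) * e' * D n = M1 * (2 * (e' * D n + sigma ^+ 2 * (e' * D n)))); last by ring.
  apply: ler_wpM2l => //.
  have h4 : (sigma * g n j) ^+ 2 <= sigma ^+ 2 * (e' * D n) by rewrite exprMn ler_wpM2l// sqr_ge0.
  set u := b (X n j) * D n in h3 *; set v := sigma * g n j in h4 *.
  have h5 : 0 <= (u - v) ^+ 2 by exact: sqr_ge0.
  apply: (@le_trans _ _ (2 * (u ^+ 2 + v ^+ 2))); last by rewrite ler_pM2l// lerD.
  rewrite -subr_ge0 (_ : _ - _ = (u - v) ^+ 2)//; ring.
have -> : (fun n => \sum_(j < n) k (X n j) * (X n j.+1 - X n j)) =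
    (fun n => F (X n n) - F y0 - (F (X n n) - F y0 - \sum_(j < n) k (X n j) * (X n j.+1 - X n j))).
  by apply/funext => n; rewrite opprB addrC subrK.
rewrite -[X in _ --> X]subr0; apply: cvgB err; apply: cvgB gF _; exact: cvg_cst.
Qed.

(** The derivative of the solution with respect to its starting point. *)
Definition flow (t : R) := expR (prim (db \o xi) t).

Let cp : cont T (prim (db \o xi)). Proof. by apply: prim_cont => //; exact: ccomp. Qed.

Lemma le_norm_ln1D (z : R) : `|z| <= 1 / 2 -> `|ln (1 + z) - z| <= 2 * z ^+ 2.
Proof.
rewrite ler_norml => /andP[z1 z2]; have z0 : 0 < 1 + z by lra.
have h1 : ln (1 + z) <= z by apply: le_ln1Dx; lra.
have h2 : ln (1 + z) >= z / (1 + z).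
  have i0 : 0 < (1 + z)^-1 by rewrite invr_gt0.
  have : ln (1 + ((1 + z)^-1 - 1)) <= (1 + z)^-1 - 1 by apply: le_ln1Dx; lra.
  rewrite addrC subrK lnV ?posrE// => h.
  have -> : z / (1 + z) = 1 - (1 + z)^-1 by field; exact: lt0r_neq0.
  lra.
have h3 : z / (1 + z) >= z - 2 * z ^+ 2.
  by rewrite ler_pdivlMr//; have : 0 <= z ^+ 2 * (1 + 2 * z); [rewrite mulr_ge0 ?sqr_ge0//; lra|nra].
by rewrite ler_norml; apply/andP; split; have := sqr_ge0 z; lra.
Qed.

(** Logarithms turn the products of 1 + db Delta into sums covered by [grid_cvg_prim], at the cost
    of a total error O(Delta). *)
Let gln (s : bool) : grid_cvg T (fun n m => \sum_(j < s + m) ln (1 + db (X n j) * D n)) (prim (db \o xi)).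
Proof.
move=> e e0; have e20 : 0 < e / 2 by rewrite divr_gt0.
have [N1 H1] := grid_cvg_prim T0 s (ccomp cdb) (grid_cvg_comp T0 cdb cxi gX) e20.
have dd : 0 < Num.min ((L * 2)^-1) (e / 2 / (2 * L ^+ 2 * T)).
  rewrite lt_min; apply/andP; split; first by rewrite invr_gt0 mulr_gt0.
  by apply: divr_gt0 e20 _; apply: mulr_gt0 => //; apply: mulr_gt0 => //; apply: exprn_gt0.
have [N2 H2] := mesh_small T0 dd.
exists (maxn N1 N2) => n m u; rewrite gtn_max => /andP[n1 n2] mn mu_.
have [Dn0] := H2 n n2; rewrite le_min => /andP[DL De].
have n0 : (0 < n)%N := leq_ltn_trans (leq0n _) n1.
have smn : (s + m <= n)%N by case: (s) => //; rewrite ltnW.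
rewrite -(subrK (\sum_(j < s + m) db (X n j) * D n) (\sum_(j < s + m) ln _)) -addrA.
apply: (le_trans (ler_normD _ _)); rewrite [leRHS](splitr e); apply: lerD; last exact: H1.
rewrite -sumrB; apply: (le_trans (ler_norm_sum _ _ _)).
apply: (@le_trans _ _ (\sum_(j < s + m) (2 * L ^+ 2 * D n * D n))).
  apply: ler_sum => j _; have /andP[d1 d2] := dbM (X n j).
  have dL : `|db (X n j)| <= L by rewrite ler_norml d1/=; have := M0; have := L0; lra.
  have LD2 : L * D n <= 1 / 2.
    by move: DL; rewrite -[(L * 2)^-1]mul1r ler_pdivlMr ?mulr_gt0//; lra.
  apply: (le_trans (le_norm_ln1D _)).
    by rewrite normrM (gtr0_norm Dn0) (le_trans _ LD2)// ler_wpM2r// ltW.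
  rewrite (_ : 2 * L ^+ 2 * D n * D n = 2 * (L ^+ 2 * D n ^+ 2)); last by ring.
  rewrite exprMn ler_pM2l// ler_wpM2r ?sqr_ge0//.
  by rewrite -[leLHS]real_normK ?num_real// lerXn2r// nnegrE// ltW.
rewrite sumr_const card_ord -[leLHS]mulr_natl.
apply: (@le_trans _ _ (n%:R * (2 * L ^+ 2 * D n * D n))).
  by rewrite ler_wpM2r ?ler_nat// !mulr_ge0 ?sqr_ge0// ltW.
rewrite (_ : n%:R * _ = D n * (2 * L ^+ 2 * T)); last by field; rewrite pnatr_eq0 -lt0n.
by rewrite -ler_pdivlMr// !mulr_gt0// exprn_gt0.
Qed.

(** By [euler_diffE] the derivative is p_m times the sum of C_lm / p_(l+1) over l < m, so the whole
    is a double sum of the form of [volterra_limit]. *)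
Lemma trace_limit : (\sum_(m < n) dk (X n m) *
    euler_diff b db (D n) sigma y0 (g n) (fun j => fgn_cov (q + 1) (D n) j m) m) @[n --> \oo] -->
  \int[mu]_(u in `[0, T]) (dk (xi u) * flow u *
     ((q + 1) * q / 2 * volterra q (fun v => (flow v)^-1) u)).
Proof.
have cexp : continuous (expR (R := R)) by exact: continuous_expR.
have cf : cont T (fun u => dk (xi u) * flow u).
  by move=> t; apply: cvgM; [exact: (ccomp cdk)|exact: (cont_comp cexp cp)].
have cexpN : continuous (fun x : R => expR (- x)).
  by move=> x; apply: continuous_comp; [exact: opp_continuous|exact: cexp].
have cg : cont T (fun v => (flow v)^-1).
  rewrite (_ : (fun v => _) = (fun v => expR (- prim (db \o xi) v))); last first.
    by apply/funext => v; rewrite expRN.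
  by move=> t; exact: (cont_comp cexpN cp).
have Hf : grid_cvg T (fun n m => dk (X n m) * expR (\sum_(j < false + m) ln (1 + db (X n j) * D n)))
    (fun u => dk (xi u) * flow u).
  apply: grid_cvg_mul => //; [exact: ccomp|by move=> t; exact: (cont_comp cexp cp)| |].
    exact: grid_cvg_comp.
  exact: (grid_cvg_comp T0 cexp cp (gln false)).
have Hg : grid_cvg T (fun n m => expR (- \sum_(j < true + m) ln (1 + db (X n j) * D n)))
    (fun v => (flow v)^-1).
  rewrite (_ : (fun v => _) = (fun v => expR (- prim (db \o xi) v))); last first.
    by apply/funext => v; rewrite expRN.
  exact: (grid_cvg_comp T0 cexpN cp (gln true)).
have := volterra_limit T0 q0 q1 cf cg Hf Hg; apply: cvg_trans; apply: near_eq_cvg.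
have dd : 0 < (L * 2)^-1 by rewrite invr_gt0 mulr_gt0.
have [N2 H2] := mesh_small T0 dd; exists N2.+1 => // n /= n2.
have [Dn0 DL] := H2 n n2.
have f0 j : 0 < 1 + db (X n j) * D n.
  have /andP[d1 d2] := dbM (X n j).
  have LD2 : L * D n <= 1 / 2.
    by move: DL; rewrite -[(L * 2)^-1]mul1r ler_pdivlMr ?mulr_gt0//; lra.
  have : - L * D n <= db (X n j) * D n by rewrite ler_pM2r.
  lra.
have pE m : \prod_(j < m) (1 + db (X n j) * D n) = expR (\sum_(j < m) ln (1 + db (X n j) * D n)).
  rewrite expR_sum; apply: eq_bigr => j _; by rewrite lnK// posrE.
apply: eq_bigr => m _; rewrite add0n -mulrA; congr (_ * _).
rewrite euler_diffE; last by move=> i _; rewrite gt_eqF// f0.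
rewrite -/(X n) pE; congr (_ * _); apply: eq_bigr => l _.
by rewrite pE add1n mulrC expRN.
Qed.

(** The recursion gives sigma g_j = X_(j+1) - X_j - b(X_j) Delta, which splits the sum into three
    whose limits are known. *)
Lemma discrete_skorokhod_limit :
  (sigma * discrete_skorokhod b db (D n) sigma y0 k dk (fgn_cov (q + 1) (D n)) n (g n)) @[n --> \oo] -->
  F (xi T) - F (xi 0) - prim (fun s => k (xi s) * b (xi s)) T -
  sigma ^+ 2 * \int[mu]_(u in `[0, T]) (dk (xi u) * flow u *
     ((q + 1) * q / 2 * volterra q (fun v => (flow v)^-1) u)).
Proof.
have ckb : cont T (fun s => k (xi s) * b (xi s)).
  by move=> t; apply: cvgM; [exact: (ccomp ck)|exact: (ccomp cb)].
have XS n j : X n j.+1 = X n j + b (X n j) * D n + sigma * g n j by [].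
have s2 : (\sum_(j < n) k (X n j) * b (X n j) * D n) @[n --> \oo] --> prim (fun s => k (xi s) * b (xi s)) T.
  have Hkb : grid_cvg T (fun n j => k (X n j) * b (X n j)) (fun s => k (xi s) * b (xi s)).
    apply: (@grid_cvg_mul _ _ T0 (fun n j => k (X n j)) (fun s => k (xi s)) (fun n j => b (X n j)) (fun s => b (xi s))).
    - exact: (ccomp ck).
    - exact: (ccomp cb).
    - exact: grid_cvg_comp.
    - exact: grid_cvg_comp.
  exact: (riemann_limit T0 ckb Hkb).
have -> : (fun n => sigma * discrete_skorokhod b db (D n) sigma y0 k dk (fgn_cov (q + 1) (D n)) n (g n)) =
    (fun n => \sum_(j < n) k (X n j) * (X n j.+1 - X n j) - \sum_(j < n) k (X n j) * b (X n j) * D n -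
      sigma ^+ 2 * \sum_(m < n) dk (X n m) *
        euler_diff b db (D n) sigma y0 (g n) (fun j => fgn_cov (q + 1) (D n) j m) m).
  apply/funext => n; rewrite /discrete_skorokhod !mulr_sumr -!sumrB.
  by apply: eq_bigr => j _; rewrite -/(X n) XS; ring.
apply: cvgB; first by apply: cvgB s2; exact: increments_sum.
by apply: cvgMl_tmp; exact: trace_limit.
Qed.

Lemma path_modulus e : 0 < e -> exists2 del, 0 < del & forall s t,
  0 <= s -> s <= t -> t <= T -> t - s <= del -> (xi t - xi s) ^+ 2 <= e * (t - s).
Proof.
move=> e0; have [A A0 HA] := cont_bound (ccomp cb).
pose e' := e / (2 * (1 + sigma ^+ 2)).
have s1 : 0 < 1 + sigma ^+ 2 by rewrite ltr_pwDl// sqr_ge0.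
have e'0 : 0 < e' by rewrite divr_gt0// mulr_gt0.
have [del del0 Hd] := beta_mod e'0.
exists (Num.min del (e' / A ^+ 2)); first by rewrite lt_min del0 divr_gt0// exprn_gt0.
move=> s t s0 st tT; rewrite le_min => /andP[d1 d2].
have ts0 : 0 <= t - s by rewrite subr_ge0.
rewrite (xi_step s0 st tT).
have h1 : (sigma * (beta t - beta s)) ^+ 2 <= sigma ^+ 2 * (e' * (t - s)).
  by rewrite exprMn ler_wpM2l ?sqr_ge0// Hd.
have h2 : (\int[mu]_(r in `[s, t]) b (xi r)) ^+ 2 <= e' * (t - s).
  have h : `|\int[mu]_(r in `[s, t]) b (xi r)| <= A * (t - s).
    by rewrite -(primB (ccomp cb) s0 st tT); exact: (prim_lip (ccomp cb) HA).
  rewrite -[leLHS]real_normK ?num_real//; apply: (@le_trans _ _ ((A * (t - s)) ^+ 2)).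
    by rewrite lerXn2r// nnegrE mulr_ge0// ltW.
  rewrite (_ : (A * (t - s)) ^+ 2 = (t - s) * A ^+ 2 * (t - s)); last by ring.
  by rewrite ler_wpM2r// -ler_pdivlMr// exprn_gt0.
set u := \int[mu]_(r in _) _ in h2 *; set v := sigma * _ in h1 *.
have h5 : 0 <= (u - v) ^+ 2 by exact: sqr_ge0.
apply: (@le_trans _ _ (2 * (u ^+ 2 + v ^+ 2))).
  by rewrite -subr_ge0 (_ : _ - _ = (u - v) ^+ 2)//; ring.
apply: (@le_trans _ _ (2 * (e' * (t - s) + sigma ^+ 2 * (e' * (t - s))))).
  by rewrite ler_pM2l// lerD.
rewrite le_eqVlt; apply/orP; left; apply/eqP; rewrite /e'; field.
exact: lt0r_neq0.
Qed.

(** Induction on the partition peels off the first cell, whose Taylor remainder is at most M1 e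
    times its length. *)
Lemma left_riemann_sum_taylor e del : (forall s t,
    0 <= s -> s <= t -> t <= T -> t - s <= del -> (xi t - xi s) ^+ 2 <= e * (t - s)) ->
  forall (s : seq R) a, path <%R a s -> 0 <= a -> last a s <= T -> mesh_lt a s del ->
  `|left_riemann_sum a (k \o xi) xi s - (F (xi (last a s)) - F (xi a))| <= M1 * e * (last a s - a).
Proof.
move=> He; have M10 : 0 <= M1 := le_trans (normr_ge0 _) (dkM1 0).
elim=> [|x s IH] a /=; first by move=> *; rewrite /left_riemann_sum big_nil !subrr normr0 mulr0.
move=> /andP[ax xs] a0 lT mesh.
have x0 : 0 <= x by rewrite (le_trans a0)// ltW.
have xl : x <= last x s.
  elim: (s) (x) xs => [|y r IHr] z //= /andP[zy yr]; rewrite (le_trans (ltW zy))//; exact: IHr.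
have nthE j : (j <= size s)%N -> nth a [:: a, x & s] j.+1 = nth x (x :: s) j.
  by move=> js /=; apply: set_nth_default.
have mesh' : mesh_lt x s del.
  by move=> i iS; have := mesh i.+1 iS; rewrite !nthE// ltnW.
have {}IH := IH x xs x0 lT mesh'.
have E : left_riemann_sum a (k \o xi) xi (x :: s) =
    k (xi a) * (xi x - xi a) + left_riemann_sum x (k \o xi) xi s.
  rewrite /left_riemann_sum [size (x :: s)]/= big_nat_recl//; congr (_ + _).
  rewrite big_nat [in RHS]big_nat; apply: eq_bigr => i /andP[_ iS].
  by rewrite !nthE// ltnW.
have t1 := taylor_antiderivative (xi a) (xi x).
have t2 : (xi x - xi a) ^+ 2 <= e * (x - a).
  by apply: He => //; [exact: ltW|exact: le_trans lT|have := mesh 0%N isT => /= /ltW].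
have -> : left_riemann_sum a (k \o xi) xi (x :: s) - (F (xi (last x s)) - F (xi a)) =
  (left_riemann_sum x (k \o xi) xi s - (F (xi (last x s)) - F (xi x))) -
  (F (xi x) - F (xi a) - k (xi a) * (xi x - xi a)) by rewrite E; ring.
apply: (le_trans (ler_normB _ _)).
have -> : M1 * e * (last x s - a) = M1 * e * (last x s - x) + M1 * (e * (x - a)) by ring.
apply: lerD IH _; apply: (le_trans t1); exact: ler_wpM2l.
Qed.

Lemma uniform_partition n : (0 < n)%N ->
  let s := [seq i%:R * D n | i <- iota 1 n] in
  itv_partition 0 T s /\ forall del, D n < del -> mesh_lt 0 s del.
Proof.
move=> n0 s; have Dn0 : 0 < D n by rewrite divr_gt0// ltr0n.
have E j : (j <= n)%N -> nth 0 (0 :: s) j = j%:R * D n.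
  case: j => [|j] jn /=; first by rewrite mul0r.
  by rewrite (nth_map 0%N) ?size_iota// nth_iota// add1n.
split; first split.
- apply/(pathP 0) => i; rewrite size_map size_iota => iN.
  by rewrite E ?(ltnW iN)//; have /= -> := E i.+1 iN; rewrite ltr_pM2r// ltr_nat.
- by rewrite (last_nth 0) size_map size_iota E// mulrC divfK// pnatr_eq0 -lt0n.
- move=> del Dd i; rewrite size_map size_iota => iN.
  by rewrite !E ?(ltnW iN)// -mulrBl -natrB// subSnn mul1r.
Qed.

(** [young_integral] is a choice by [get], so the limit of the Riemann sums must also be unique: a
    fine uniform partition meets both mesh conditions and separates two candidates. *)
Lemma young_integral_path : young_integral 0 T (k \o xi) xi = F (xi T) - F (xi 0).
Proof.
have M10 : 0 <= M1 := le_trans (normr_ge0 _) (dkM1 0).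
have yI : is_young_integral 0 T (k \o xi) xi (F (xi T) - F (xi 0)).
  move=> e e0; have e'0 : 0 < e / (2 * (M1 + 1) * T).
    by rewrite divr_gt0//; apply: mulr_gt0 => //; rewrite mulr_gt0// ltr_wpDl.
  have [del del0 Hd] := path_modulus e'0; exists del => // s [ps ls] mesh.
  have := left_riemann_sum_taylor Hd ps (lexx 0); rewrite (eqP ls) lexx => /(_ isT mesh).
  move=> /le_lt_trans; apply; rewrite subr0.
  have m1 : 0 < M1 + 1 by rewrite ltr_wpDl.
  rewrite (_ : M1 * _ * T = e * (M1 / (2 * (M1 + 1)))); last by field; rewrite !lt0r_neq0.
  rewrite gtr_pMr// ltr_pdivrMr ?mulr_gt0// mul1r; lra.
have uniq I : is_young_integral 0 T (k \o xi) xi I -> I = F (xi T) - F (xi 0).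
  move=> yI'; apply/eqP; rewrite -subr_eq0; apply/negPn/negP => neq.
  have e0 : 0 < `|I - (F (xi T) - F (xi 0))| / 2 by rewrite divr_gt0// normr_gt0.
  have [d1 d10 H1] := yI _ e0; have [d2 d20 H2] := yI' _ e0.
  have dd : 0 < Num.min d1 d2 / 2 by rewrite divr_gt0// lt_min d10.
  have [N HN] := mesh_small T0 dd; have [Dn0 Dd] := HN N.+1 (ltnSn N).
  have [pt ms] := uniform_partition (ltn0Sn N).
  have Dlt : D N.+1 < Num.min d1 d2.
    by apply: (le_lt_trans Dd); rewrite ltr_pdivrMr// ltr_pMr ?ltr1n// lt_min d10.
  move: Dlt; rewrite lt_min => /andP[D1 D2].
  have h1 := H1 _ pt (ms _ D1); have h2 := H2 _ pt (ms _ D2).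
  set S := left_riemann_sum _ _ _ _ in h1 h2.
  have : `|I - (F (xi T) - F (xi 0))| <= `|S - (F (xi T) - F (xi 0))| + `|S - I|.
    rewrite (_ : I - _ = (S - (F (xi T) - F (xi 0))) - (S - I)); last by ring.
    exact: ler_normB.
  by lra.
have := @getPex _ [set I : R | is_young_integral 0 T (k \o xi) xi I] (ex_intro _ _ yI).
exact: uniq.
Qed.

End path_limits.

(** * Comparison of solutions from two starting points *)

Section differentiation.
Context {R : realType} (T : R).
Hypothesis T0 : 0 < T.
Local Notation mu := (@lebesgue_measure R).

(** The integrand is extended by [clamp] and the primitive started at -1, so that Phi has a
    two-sided derivative also at the endpoints 0 and T. *)
Lemma is_derive_prim (phi : R -> R) : cont T phi -> exists2 Phi : R -> R,
  forall t : R, -1 < t -> is_derive t 1 Phi (phi (clamp T t)) &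
  forall t, 0 <= t <= T -> Phi t = prim phi t.
Proof.
move=> cphi; pose psi t := phi (clamp T t).
have ipsi (u v : R) : mu.-integrable `[u, v] (EFin \o psi).
  by apply: continuous_compact_integrable; [exact: segment_compact|exact: continuous_subspaceT].
pose J t := \int[mu]_(s in `[(-1), t]) psi s.
exists (fun t => J t - J 0).
  move=> t t1; have tt : t < t + 1 by rewrite ltrDl.
  have [dJ vJ] := continuous_FTC1_closed tt (ipsi (-1) (t + 1)) t1 (cphi t).
  have iJ : is_derive t 1 J (psi t) by apply: DeriveDef; [exact: dJ|rewrite -derive1E; exact: vJ].
  by apply: is_derive_eq; rewrite subr0.
move=> t /andP[t0 tT]; rewrite /J (Rint_split (ipsi (-1) t) _ t0) ?lerN10// addrC addKr.
by apply: eq_Rintegral => s; rewrite inE/= in_itv/= => /andP[s0 st]; rewrite /psi clampE// s0 (le_trans st).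
Qed.

Lemma derive_le (f df : R -> R) (a b : R) : a <= b ->
  (forall z : R, a <= z <= b -> is_derive z 1 f (df z)) ->
  (forall z, a <= z <= b -> df z <= 0) -> f b <= f a.
Proof.
move=> ab fdf df0.
have cf : {within `[a, b], continuous f}.
  by apply: derivable_within_continuous => z; rewrite in_itv/= => /fdf[].
have fdf' z : z \in `]a, b[ -> is_derive z 1 f (df z).
  by rewrite in_itv/= => /andP[az zb]; apply: fdf; rewrite !ltW.
have [c] := MVT_segment ab fdf' cf; rewrite in_itv/= => cab E.
by rewrite -subr_le0 E mulr_le0_ge0 ?subr_ge0 ?df0.
Qed.

Lemma expR_lip (a b c : R) : a <= c -> b <= c -> `|expR a - expR b| <= `|a - b| * expR c.
Proof.
have H x y : x <= y -> y <= c -> expR y - expR x <= (y - x) * expR c.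
  move=> xy yc; apply: (@le_trans _ _ ((y - x) * expR y)).
    have h := expR_ge1Dx (x - y).
    have -> : expR x = expR (x - y) * expR y by rewrite -expRD subrK.
    by rewrite -[X in X - _]mul1r -mulrBl ler_wpM2r ?expR_ge0//; lra.
  by rewrite ler_wpM2l ?subr_ge0// ler_expR.
have [ab|/ltW ba] := leP a b => ac bc.
  by rewrite distrC [`|a - b|]distrC !ger0_norm ?subr_ge0 ?ler_expR//; exact: H.
by rewrite !ger0_norm ?subr_ge0 ?ler_expR//; exact: H.
Qed.

Context (b db : R -> R) (M L Lam : R).
Hypothesis bdb : forall y : R, is_derive y 1 b (db y).
Hypothesis dbM : forall y : R, - L <= db y <= - M.
Hypothesis M0 : 0 < M.
Hypothesis db_lip : forall y z : R, `|db y - db z| <= Lam * `|y - z|.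
Context (y0 sigma eps : R) (beta xi xe : R -> R).
Hypotheses (eps0 : 0 < eps) (cxi : cont T xi) (cxe : cont T xe).
Hypothesis xiE : forall t, 0 <= t <= T -> xi t = y0 + prim (b \o xi) t + sigma * beta t.
Hypothesis xeE : forall t, 0 <= t <= T -> xe t = y0 + eps + prim (b \o xe) t + sigma * beta t.

Let cb : continuous b. Proof. exact: is_derive_continuous bdb. Qed.
Let cdb : continuous db.
Proof.
have L1 : 0 < `|Lam| + 1 by rewrite ltr_wpDl.
move=> y; apply/cvgrPdist_le => e e0; exists (e / (`|Lam| + 1)); first by rewrite /= divr_gt0.
move=> z /= yz; apply: (le_trans (db_lip y z)).
apply: (@le_trans _ _ ((`|Lam| + 1) * `|y - z|)).
  by rewrite ler_wpM2r// (le_trans (ler_norm _))// lerDl.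
by rewrite mulrC -ler_pdivlMr// ltW.
Qed.

Lemma cont_diff_path (phi psi : R -> R) : cont T phi -> cont T psi -> cont T (fun t => phi t - psi t).
Proof. by move=> c1 c2 t; apply: cvgB; [exact: c1|exact: c2]. Qed.

Let diff_facts : exists E P : R -> R,
  [/\ forall t : R, 0 <= t <= T -> is_derive t 1 E (b (xe t) - b (xi t)),
      forall t, 0 <= t <= T -> E t = xe t - xi t,
      E 0 = eps,
      forall t : R, 0 <= t <= T -> is_derive t 1 P (db (xi t)) &
      forall t, 0 <= t <= T -> P t = prim (db \o xi) t].
Proof.
have c1 : cont T (b \o xe) by exact: cont_comp. have c2 : cont T (b \o xi) by exact: cont_comp.
have c3 : cont T (db \o xi) by exact: cont_comp.
have [E1 dE1 vE1] := is_derive_prim c1; have [E2 dE2 vE2] := is_derive_prim c2.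
have [P dP vP] := is_derive_prim c3.
have t1 t : 0 <= t <= T -> -1 < t by move=> /andP[t0 _]; rewrite (lt_le_trans _ t0)// ltrN10.
exists (fun t => eps + (E1 t - E2 t)), P; split => //.
- move=> t tT; have := dE1 t (t1 t tT); have := dE2 t (t1 t tT); rewrite /= !clampE// => i2 i1.
  by apply: is_derive_eq; rewrite /=; ring.
- by move=> t tT; rewrite xiE// xeE// vE1// vE2//; ring.
- by rewrite vE1 ?vE2 ?lexx ?(ltW T0)// !prim0 subrr addr0.
- by move=> t tT; have := dP t (t1 t tT); rewrite /= clampE.
Qed.

Let L0 : 0 < L.
Proof. by have /andP[h1 h2] := dbM 0; have h3 := M0; lra. Qed.

(** E^2 exp(2 L r) is nondecreasing because the slopes of b are at least - L, so the gap cannot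
    vanish; the intermediate value theorem then keeps its sign. *)
Lemma path_gap_gt0 t : 0 <= t <= T -> 0 < xe t - xi t.
Proof.
have [E [P [dE vE E0 _ _]]] := diff_facts.
have nz s : 0 <= s <= T -> E s != 0.
  move=> /andP[s0 sT]; apply/negP => /eqP Es.
  have : - ((E 0) ^+ 2 * expR (2 * L * 0)) >= - ((E s) ^+ 2 * expR (2 * L * s)).
    apply: (@derive_le (fun r => - ((E r) ^+ 2 * expR (2 * L * r)))
      (fun r => - (2 * (E r * (b (xe r) - b (xi r)) + L * E r ^+ 2) * expR (2 * L * r))) 0 s s0).
      move=> z /andP[z0 zs]; have zT : 0 <= z <= T by rewrite z0 (le_trans zs).
      have i1 := dE z zT.
      by apply: is_derive_eq; rewrite /GRing.scale/=; ring.
    move=> z /andP[z0 zs]; have zT : 0 <= z <= T by rewrite z0 (le_trans zs).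
    rewrite oppr_le0 mulr_ge0 ?expR_ge0// mulr_ge0//.
    have [th /andP[h1 h2] ->] := drift_diff bdb dbM (xi z) (xe z).
    rewrite -vE// (_ : _ + _ = (th + L) * E z ^+ 2); last by ring.
    by rewrite mulr_ge0 ?sqr_ge0//; lra.
  rewrite Es E0 expr0n/= mul0r mulr0 expR0 mulr1 oppr0 oppr_ge0.
  by rewrite leNgt exprn_gt0.
move=> tT; rewrite -vE//; rewrite lt_neqAle eq_sym nz//=; rewrite leNgt; apply/negP => Et.
have /andP[t0 tT'] := tT.
have cE : {within `[0, t], continuous E}.
  apply: derivable_within_continuous => z; rewrite in_itv/= => /andP[z0 zt].
  have zT : 0 <= z <= T by rewrite z0 (le_trans zt).
  by case: (dE z zT).
have [|c] := @IVT R E 0 t 0 t0 cE.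
  by rewrite E0 ge_min (ltW Et) orbT le_max (ltW eps0).
rewrite in_itv/= => /andP[c0 ct] Ec; have := nz c; rewrite Ec eqxx c0 (le_trans ct tT').
by move=> /(_ isT).
Qed.

(** th = (b(xe) - b(xi)) / E is the logarithmic derivative of the gap E and equals db at a point
    within E of xi. As E <= eps exp(- M r), ln E - P varies on [v, u] by O(eps exp(- M v)). Both
    ratios are at most exp(- M (u - v)), and the product is of order exp(- M u). *)
Lemma kernel_ratio_close v u : 0 <= v -> v <= u -> u <= T ->
  `|(xe u - xi u) / (xe v - xi v) - flow db xi u / flow db xi v| <=
  Lam * eps / M * expR (- M * u).
Proof.
move=> v0 vu uT; have [E [P [dE vE E0 dP vP]]] := diff_facts.
have inT z : v <= z <= u -> 0 <= z <= T.
  by move=> /andP[vz zu]; rewrite (le_trans v0)// (le_trans zu).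
have inT0 s z : s <= T -> 0 <= z <= s -> 0 <= z <= T.
  by move=> sT /andP[-> zs]; rewrite (le_trans zs).
have Ep z : 0 <= z <= T -> 0 < E z by move=> zT; rewrite vE// path_gap_gt0.
have uT' : 0 <= u <= T by rewrite (le_trans v0).
have vT' : 0 <= v <= T by rewrite v0 (le_trans vu).
pose th z := (b (xe z) - b (xi z)) / E z.
have thE z : 0 <= z <= T -> exists2 c, `|c - xi z| <= E z & th z = db c.
  move=> zT; have [c cx Ec] := mean_value (xi z) (xe z) bdb.
  exists c; first by rewrite -(gtr0_norm (Ep z zT)) vE.
  by rewrite /th Ec -vE// mulfK// gt_eqF// Ep.
have dl z : 0 <= z <= T -> is_derive z 1 (fun r => ln (E r)) (th z).
  move=> zT; have i1 := dE z zT; have i2 := is_derive1_ln (Ep z zT).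
  have := @is_derive1_comp _ (@ln R) E z _ _ i2 i1.
  by rewrite /th mulrC.
have thM z : 0 <= z <= T -> th z <= - M by move=> zT; have [c _ ->] := thE z zT; have /andP[] := dbM c.
have gap w z : 0 <= w -> w <= z -> z <= T -> ln (E z) - ln (E w) <= - M * (z - w).
  move=> w0 wz zT.
  have : ln (E z) + M * z <= ln (E w) + M * w.
    apply: (@derive_le (fun r => ln (E r) + M * r) (fun r => th r + M) w z wz).
      move=> r /andP[wr rz]; have rT : 0 <= r <= T by rewrite (le_trans w0) ?(le_trans rz).
      by have i1 := dl r rT; apply: is_derive_eq; rewrite /GRing.scale/=; ring.
    move=> r /andP[wr rz]; have rT : 0 <= r <= T by rewrite (le_trans w0) ?(le_trans rz).
    by rewrite -lerBrDr sub0r thM.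
  by lra.
have Ebound z : 0 <= z <= T -> E z <= eps * expR (- M * z).
  move=> zT; have /andP[z0 zT'] := zT; have := gap 0 z (lexx 0) z0 zT'.
  rewrite E0 subr0 lerBlDl => h.
  by rewrite -(lnK (Ep z zT)) -[X in X * _](lnK eps0) -expRD ler_expR.
pose C := Lam * eps / M.
have Lam0 : 0 <= Lam.
  have := db_lip 1 0; rewrite subr0 normr1 mulr1; exact: le_trans.
have dexp (z : R) : is_derive z 1 (fun r => C * expR (- M * r)) (- (Lam * eps * expR (- M * z))).
  by apply: is_derive_eq; rewrite /GRing.scale/= /C; field; exact: lt0r_neq0.
have Qd z : 0 <= z <= T -> `|th z - db (xi z)| <= Lam * eps * expR (- M * z).
  move=> zT; have [c cx ->] := thE z zT; apply: (le_trans (db_lip _ _)).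
  by rewrite -mulrA ler_wpM2l// (le_trans cx)// Ebound.
(* Adding C exp(- M r), whose derivative cancels the bound [Qd], makes both ln E - P and its
   opposite nonincreasing. *)
have Q1 : (ln (E u) - P u) + C * expR (- M * u) <= (ln (E v) - P v) + C * expR (- M * v).
  apply: (@derive_le (fun r => (ln (E r) - P r) + C * expR (- M * r))
    (fun r => (th r - db (xi r)) - Lam * eps * expR (- M * r)) v u vu).
    by move=> r /inT rT; have i1 := dl r rT; have i2 := dP r rT; have i3 := dexp r; apply: is_derive_eq.
  by move=> r /inT rT; have := Qd r rT; rewrite ler_norml => /andP[_]; rewrite subr_le0.
have Q2 : - (ln (E u) - P u) + C * expR (- M * u) <= - (ln (E v) - P v) + C * expR (- M * v).
  apply: (@derive_le (fun r => - (ln (E r) - P r) + C * expR (- M * r))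
    (fun r => - (th r - db (xi r)) - Lam * eps * expR (- M * r)) v u vu).
    by move=> r /inT rT; have i1 := dl r rT; have i2 := dP r rT; have i3 := dexp r; apply: is_derive_eq.
  by move=> r /inT rT; have := Qd r rT; rewrite ler_norml => /andP[h _]; rewrite subr_le0 lerNl.
have C0 : 0 <= C by rewrite divr_ge0 ?(ltW M0)// mulr_ge0// ltW.
have cu0 : 0 <= C * expR (- M * u) by rewrite mulr_ge0// expR_ge0.
have Pgap : P u - P v <= - M * (u - v).
  have : P u + M * u <= P v + M * v.
    apply: (@derive_le (fun r => P r + M * r) (fun r => db (xi r) + M) v u vu).
      by move=> r /inT rT; have i1 := dP r rT; apply: is_derive_eq; rewrite /GRing.scale/=; ring.
    by move=> r _; rewrite -lerBrDr sub0r; have /andP[] := dbM (xi r).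
  by lra.
rewrite -!vE// /flow -!vP// -expRB.
have -> : E u / E v = expR (ln (E u) - ln (E v)) by rewrite expRB !lnK// posrE Ep.
apply: (le_trans (expR_lip (gap v u v0 vu uT) Pgap)).
have -> : Lam * eps / M * expR (- M * u) = C * expR (- M * v) * expR (- M * (u - v)).
  by rewrite -[RHS]mulrA -expRD; congr (_ * expR _); ring.
rewrite ler_wpM2r ?expR_ge0// ler_norml; apply/andP; split; lra.
Qed.

(** The factor exp(- M u) balances the kernel mass u^q / q: their product stays below (1 + 1 / M) /
    q, so the error grows only linearly in T. *)
Lemma ratio_kernel_close (dk : R -> R) (M1 q : R) : 0 < q -> q < 1 ->
  continuous dk -> (forall y, `|dk y| <= M1) ->
  `|\int[mu]_(u in `[0, T]) \int[mu]_(v in `[0, u])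
       (dk (xi u) * ((xe u - xi u) / (xe v - xi v)) * kerW q u v) -
    \int[mu]_(u in `[0, T]) (dk (xi u) * flow db xi u * volterra q (fun v => (flow db xi v)^-1) u)| <=
  M1 * (Lam * eps / M * ((1 + M^-1) / q)) * T.
Proof.
move=> q0 q1 cdk dkM1.
have M10 : 0 <= M1 := le_trans (normr_ge0 _) (dkM1 0).
have Lam0 : 0 <= Lam.
  have := db_lip 1 0; rewrite subr0 normr1 mulr1; exact: le_trans.
have cE : cont T (fun t => xe t - xi t) by exact: cont_diff_path.
have cEV : cont T (fun t => (xe t - xi t)^-1).
  move=> t; apply: cvgV; last exact: cE.
  by rewrite gt_eqF// path_gap_gt0// clamp_itv.
have cp : cont T (prim (db \o xi)) by apply: prim_cont => //; exact: cont_comp.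
have cP : cont T (flow db xi) by exact: (cont_comp (@continuous_expR R) cp).
have cPV : cont T (fun t => (flow db xi t)^-1).
  move=> t; apply: cvgV; last exact: cP.
  by rewrite gt_eqF// expR_gt0.
have cd : cont T (dk \o xi) by exact: cont_comp.
have c1 : cont T (fun u => dk (xi u) * (xe u - xi u) * volterra q (fun v => (xe v - xi v)^-1) u).
  move=> t; apply: cvgM; last exact: (volterra_cont T0 q0 q1 cEV).
  by apply: cvgM; [exact: cd|exact: cE].
have c2 : cont T (fun u => dk (xi u) * flow db xi u * volterra q (fun v => (flow db xi v)^-1) u).
  move=> t; apply: cvgM; last exact: (volterra_cont T0 q0 q1 cPV).
  by apply: cvgM; [exact: cd|exact: cP].
have inner u : u \in `[0, T] -> \int[mu]_(v in `[0, u])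
    (dk (xi u) * ((xe u - xi u) / (xe v - xi v)) * kerW q u v) =
    dk (xi u) * (xe u - xi u) * volterra q (fun v => (xe v - xi v)^-1) u.
  rewrite in_itv/= => /andP[u0 uT].
  rewrite /volterra -RintegralZl//; last exact: (integrable_volterra q0 cEV).
  by apply: eq_Rintegral => v _; ring.
have -> : \int[mu]_(u in `[0, T]) \int[mu]_(v in `[0, u])
    (dk (xi u) * ((xe u - xi u) / (xe v - xi v)) * kerW q u v) =
  \int[mu]_(u in `[0, T]) (dk (xi u) * (xe u - xi u) * volterra q (fun v => (xe v - xi v)^-1) u).
  by apply: eq_Rintegral => u; rewrite inE/= => uT; exact: inner.
have i1 := integrable_cont c1 (lexx 0) (lexx T); have i2 := integrable_cont c2 (lexx 0) (lexx T).
rewrite -RintegralB// -[X in _ <= _ * X](subr0 T) -Rint_cst ?(ltW T0)//.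
apply: (@le_norm_Rint _ (`[0, T])); [exact: integrable_itvB|exact: integrable_cst_itv|].
move=> u; rewrite in_itv/= => /andP[u0 uT].
rewrite -!mulrA -mulrBr normrM; apply: ler_pM => //; rewrite ?normr_ge0 ?dkM1//.
rewrite /volterra -!RintegralZl//; [|exact: (integrable_volterra q0 cPV)|exact: (integrable_volterra q0 cEV)].
rewrite -RintegralB//; last 2 first.
- by apply: integrable_itvZ; exact: (integrable_volterra q0 cEV).
- by apply: integrable_itvZ; exact: (integrable_volterra q0 cPV).
have ik := integrable_kerW q0 0 u.
apply: (@le_trans _ _ (\int[mu]_(v in `[0, u]) (Lam * eps / M * expR (- M * u) * kerW q u v))).
  apply: (@le_norm_Rint _ (`[0, u])).
  - apply: integrable_itvB; apply: integrable_itvZ.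
      exact: (integrable_volterra q0 cEV).
    exact: (integrable_volterra q0 cPV).
  - exact: integrable_itvZ.
  - move=> v; rewrite in_itv/= => /andP[v0 vu].
    rewrite !mulrA -mulrBl normrM [`|kerW _ _ _|]ger0_norm ?powR_ge0// ler_wpM2r ?powR_ge0//.
    exact: kernel_ratio_close.
rewrite RintegralZl// Rintegral_kerW// subr0 subrr wpow0// subr0 -!mulrA.
have C0 : 0 <= Lam * eps by rewrite mulr_ge0// ltW.
apply: ler_wpM2l => //; apply: ler_wpM2l; first exact: ltW.
apply: ler_wpM2l; first by rewrite invr_ge0 ltW.
rewrite /wpow mulrA ler_wpM2r ?invr_ge0 ?(ltW q0)//.
have h1 : u `^ q <= 1 + u.
  have [ule|/ltW ule] := leP u 1.
    apply: (@le_trans _ _ (1 `^ q)); last by rewrite powR1 lerDl.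
    by apply: ge0_ler_powR; rewrite ?nnegrE// ltW.
  apply: (@le_trans _ _ (u `^ 1)); last by rewrite powRr1// lerDr.
  by apply: ler_powR; rewrite // ltW.
have e0 := expR_gt0 (- M * u).
have e1 : expR (- M * u) <= 1 by rewrite expR_le1 mulNr oppr_le0 mulr_ge0// ltW.
have e2 : M * u * expR (- M * u) <= 1.
  rewrite mulNr expRN ler_pdivrMr ?expR_gt0// mul1r.
  by have := expR_ge1Dx (M * u); lra.
apply: (@le_trans _ _ (expR (- M * u) * (1 + u))); first by rewrite ler_pM2l.
rewrite mulrDr mulr1 lerD// -[leRHS]mul1r ler_pdivlMr//.
by have -> : expR (- M * u) * u * M = M * u * expR (- M * u) by ring.
Qed.

End differentiation.

(** * Error of the estimator along one path *)

Section kernel_facts.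
Context {R : realType}.
Local Notation mu := (@lebesgue_measure R).

Lemma is_derive_derive1 (f : R -> R) : (forall z, derivable f z 1) ->
  forall z : R, is_derive z 1 f (derive1 f z).
Proof. by move=> df z; apply: DeriveDef; [exact: df|rewrite derive1E]. Qed.

Lemma bounded_fun_le (f : R -> R) : bounded_fun f -> exists2 C, 0 < C & forall z, `|f z| <= C.
Proof.
move=> [C0 [_ HC]]; exists (`|C0| + 1); first by rewrite ltr_wpDl.
by move=> z; apply: (HC (`|C0| + 1)) => //; rewrite (le_lt_trans (ler_norm _))// ltrDl.
Qed.

Lemma kernel_support (K : R -> R) : kernel_assumption K -> forall z, K z != 0 -> `|z| <= 1.
Proof.
move=> [_ _ _ sK _] z Kz; have : closure [set z | K z != 0] z by exact: subset_closure.
by rewrite sK /= in_itv/= ler_norml.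
Qed.

Lemma kernel_antiderivative (K : R -> R) : kernel_assumption K ->
  exists G : R -> R, forall z : R, is_derive z 1 G (K z).
Proof.
move=> [K0 [dK cdK] _ _ iK].
have cK : continuous K by exact: is_derive_continuous (is_derive_derive1 dK).
have iKT : mu.-integrable setT (EFin \o K).
  apply/integrableP; split; first by apply/measurable_EFinP; exact: continuous_measurable_fun.
  under eq_integral => z _ do rewrite /= ger0_norm//.
  by rewrite iK ltry.
exists (fun z => \int[mu]_(s in `]-oo, z]) K s) => z.
have zz : z < z + 1 by rewrite ltrDl.
have iz : mu.-integrable [set` `]-oo, z + 1]] (EFin \o K) by apply: integrableS iKT.
have [|dG vG] := @continuous_FTC1 R K -oo%O z (z + 1) zz iz _ (cK z); first by rewrite ltNyr.
by apply: DeriveDef; [exact: dG|rewrite -derive1E; exact: vG].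
Qed.

End kernel_facts.

Lemma quotient_error {R : realType} (y y0 Z dev dJ c den e C : R) : 0 < den -> 0 <= c ->
  `|dev| <= e * den -> `|dJ| <= C -> y - y0 = (Z + dev - c * dJ) / den ->
  `|y - y0| <= e + (`|Z| + c * C) / den.
Proof.
move=> den0 c0 h1 h2 ->; rewrite normrM normfV (gtr0_norm den0) ler_pdivrMr// mulrDl divfK ?lt0r_neq0//.
apply: (le_trans (ler_normB _ _)).
have h3 : `|c * dJ| <= c * C by rewrite normrM (ger0_norm c0) ler_wpM2l.
have := ler_normD Z dev; lra.
Qed.

Section estimator.
Context {R : realType} (K G b db : R -> R) (M L Lam K1 H sigma x : R).
Hypothesis KA : kernel_assumption K.
Hypothesis GK : forall z : R, is_derive z 1 G (K z).
Hypothesis K1b : forall z, `|derive1 K z| <= K1.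
Hypothesis bdb : forall y : R, is_derive y 1 b (db y).
Hypothesis dbM : forall y : R, - L <= db y <= - M.
Hypothesis M0 : 0 < M.
Hypothesis db_lip : forall y z : R, `|db y - db z| <= Lam * `|y - z|.
Hypotheses (H12 : 1 / 2 < H) (H1 : H < 1).
Local Notation mu := (@lebesgue_measure R).

Definition rescaled h (y : R) := K ((y - x) / h).
Definition rescaled_derive h (y : R) := derive1 K ((y - x) / h) / h.
Definition rescaled_primitive h (y : R) := h * G ((y - x) / h).

Let affine h y : is_derive (y : R) 1 (fun y => (y - x) / h) h^-1.
Proof. by apply: is_derive_eq; rewrite /GRing.scale/=; ring. Qed.

Let Kd : forall z : R, is_derive z 1 K (derive1 K z).
Proof. by have [_ [dK _] _ _ _] := KA; exact: is_derive_derive1. Qed.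

Lemma is_derive_rescaled h y : is_derive (y : R) 1 (rescaled h) (rescaled_derive h y).
Proof. exact: (@is_derive1_comp _ K (fun y => (y - x) / h) y _ _ (Kd _) (affine h y)). Qed.

Lemma is_derive_rescaled_primitive h y : h != 0 ->
  is_derive (y : R) 1 (rescaled_primitive h) (rescaled h y).
Proof.
move=> h0; have i1 := @is_derive1_comp _ G (fun y => (y - x) / h) y _ _ (GK _) (affine h y).
have -> : rescaled_primitive h = (fun y => h * ((G \o (fun y => (y - x) / h)) y)) by [].
by apply: is_derive_eq; rewrite /GRing.scale/= /rescaled; field.
Qed.

Let caff h : continuous (fun y : R => (y - x) / h).
Proof. exact: is_derive_continuous (affine h). Qed.

Let cdK h : continuous (fun y : R => derive1 K ((y - x) / h)).
Proof.
have [_ [_ c] _ _ _] := KA.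
by move=> y; apply: (@continuous_comp _ _ _ (fun y : R => (y - x) / h) (derive1 K)); [exact: caff|exact: c].
Qed.

Lemma continuous_rescaled_derive h : continuous (rescaled_derive h).
Proof. by move=> y; apply: cvgMr_tmp; exact: cdK. Qed.

Lemma rescaled_derive_le h y : 0 < h -> `|rescaled_derive h y| <= K1 / h.
Proof. by move=> h0; rewrite normrM normfV (gtr0_norm h0) ler_pM2r ?invr_gt0. Qed.

(* The divergence term of the Euler sums in the limit; it is sigma times a
   Skorokhod integral, but only its tail matters here. *)
Definition fluctuation T h (xi : R -> R) := rescaled_primitive h (xi T) - rescaled_primitive h (xi 0)
  - prim (fun s => rescaled h (xi s) * b (xi s)) T
  - sigma ^+ 2 * \int[mu]_(u in `[0, T]) (rescaled_derive h (xi u) * flow db xi u *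
     (((2 * H - 1) + 1) * (2 * H - 1) / 2 * volterra (2 * H - 1) (fun v => (flow db xi v)^-1) u)).

(** The Young integral is the sum of the fluctuation, the integral of K b(xi) and the trace with the
    exact kernel; subtracting b(x) times the denominator leaves the fluctuation, the bias and the
    change of kernel. *)
Lemma estimator_error T h y0 eps (beta xi xe : R -> R) :
  0 < T -> 0 < h -> 0 < eps -> cont T xi -> cont T xe ->
  (forall t, 0 <= t <= T -> xi t = y0 + prim (b \o xi) t + sigma * beta t) ->
  (forall t, 0 <= t <= T -> xe t = y0 + eps + prim (b \o xe) t + sigma * beta t) ->
  (forall e, 0 < e -> exists2 del, 0 < del & forall s t,
    0 <= s -> s <= t -> t <= T -> t - s <= del -> (beta t - beta s) ^+ 2 <= e * (t - s)) ->
  0 < f_hat K T h x xi ->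
  `|b_hat H sigma K T h x xi xe - b x| <= L * h +
    (`|fluctuation T h xi| + alpha_H H * sigma ^+ 2 * (K1 * (Lam / M * ((1 + M^-1) / (2 * H - 1)))) * (eps * T / h))
    / (T * h * f_hat K T h x xi).
Proof.
move=> T0 h0 eps0 cxi cxe xiE xeE bmod f0.
pose q := 2 * H - 1.
have q0 : 0 < q by rewrite /q; have := H12; lra.
have q1 : q < 1 by rewrite /q; have := H1; lra.
have h0' : h != 0 by exact: lt0r_neq0.
have cb : continuous b by exact: is_derive_continuous bdb.
have ck : continuous (rescaled h) by exact: is_derive_continuous (is_derive_rescaled h).
have Y := young_integral_path T0 bdb (is_derive_rescaled h) (fun y => rescaled_derive_le y h0)
  (fun y => is_derive_rescaled_primitive y h0') cxi xiE bmod.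
have J := ratio_kernel_close T0 bdb dbM M0 db_lip eps0 cxi cxe xiE xeE q0 q1 (cdK (h := h)) (fun y => K1b _).
set J1 := \int[mu]_(u in _) \int[mu]_(v in _) _ in J; set J0 := \int[mu]_(u in _) _ in J.
pose den := \int[mu]_(s in `[0, T]) rescaled h (xi s).
have den_f : den = T * h * f_hat K T h x xi.
  by rewrite /f_hat /den /rescaled; field; rewrite h0' lt0r_neq0.
have den0 : 0 < den by rewrite den_f mulr_gt0// mulr_gt0.
rewrite -den_f.
pose Ikb := prim (fun s => rescaled h (xi s) * b (xi s)) T.
have cc : cont T (rescaled h \o xi) by exact: cont_comp.
have ccb : cont T (fun s => rescaled h (xi s) * b (xi s)).
  by move=> t; apply: cvgM; [exact: (cont_comp ck cxi)|exact: (cont_comp cb cxi)].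
have i1 := integrable_cont ccb (lexx 0) (lexx T).
have i2 := integrable_cont cc (lexx 0) (lexx T).
(* Where K((xi - x) / h) is nonzero, xi lies within h of x, so b(xi) is within L h of b(x). *)
have bias : `|Ikb - b x * den| <= L * h * den.
  rewrite /Ikb /prim /den -!RintegralZl// -RintegralB//; last exact: (integrable_itvZ (b x) i2).
  apply: (@le_norm_Rint _ (`[0, T])).
  - by apply: integrable_itvB => //; exact: (integrable_itvZ (b x) i2).
  - exact: (integrable_itvZ (L * h) i2).
  - move=> s _; rewrite [X in `|X - _|]mulrC -mulrBl normrM.
    have K0 : 0 <= rescaled h (xi s) by have [K0 _ _ _ _] := KA; exact: K0.
    rewrite (ger0_norm K0); have [->|Kn0] := eqVneq (rescaled h (xi s)) 0; first by rewrite !mulr0.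
    rewrite ler_wpM2r//; apply: (le_trans (drift_lip bdb dbM M0 _ _)).
    have L0 : 0 < L by have /andP[a1 a2] := dbM 0; have := M0; lra.
    rewrite ler_pM2l// -[leRHS]mul1r -ler_pdivrMr// -[X in _ / X](gtr0_norm h0).
    by rewrite -normf_div; exact: (kernel_support KA Kn0).
(* (q + 1) q / 2 is [alpha_H H], and 1 / h is the chain-rule factor inside [rescaled_derive]. *)
have trE : \int[mu]_(u in `[0, T]) (rescaled_derive h (xi u) * flow db xi u *
     ((q + 1) * q / 2 * volterra q (fun v => (flow db xi v)^-1) u)) = alpha_H H / h * J0.
  have cp : cont T (prim (db \o xi)).
    apply: prim_cont => //; apply: cont_comp => //.
    move=> y; apply/cvgrPdist_le => e e0.
    have L1 : 0 < `|Lam| + 1 by rewrite ltr_wpDl.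
    exists (e / (`|Lam| + 1)); first by rewrite /= divr_gt0.
    move=> z /= yz; apply: (le_trans (db_lip y z)).
    apply: (@le_trans _ _ ((`|Lam| + 1) * `|y - z|)).
      by rewrite ler_wpM2r// (le_trans (ler_norm _))// lerDl.
    by rewrite mulrC -ler_pdivlMr// ltW.
  have cP : cont T (flow db xi) by exact: (cont_comp (@continuous_expR R) cp).
  have cPV : cont T (fun t => (flow db xi t)^-1).
    by move=> t; apply: cvgV; [rewrite gt_eqF// expR_gt0|exact: cP].
  have c2 : cont T (fun u => derive1 K ((xi u - x) / h) * flow db xi u * volterra q (fun v => (flow db xi v)^-1) u).
    move=> t; apply: cvgM; last exact: (volterra_cont T0 q0 q1 cPV).
    by apply: cvgM; [exact: (cont_comp (cdK (h := h)) cxi)|exact: cP].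
  rewrite /J0 -RintegralZl//; last exact: (integrable_cont c2 (lexx 0) (lexx T)).
  by apply: eq_Rintegral => u _; rewrite /rescaled_derive /alpha_H /q; field.
have bE : b_hat H sigma K T h x xi xe =
    (rescaled_primitive h (xi T) - rescaled_primitive h (xi 0) - alpha_H H * sigma ^+ 2 * (1 / h) * J1) / den.
  have YE : young_integral 0 T (fun s => K ((xi s - x) / h)) xi =
    rescaled_primitive h (xi T) - rescaled_primitive h (xi 0) := Y.
  have JE : \int[mu]_(u in `[0, T]) \int[mu]_(v in `[0, u])
       (derive1 K ((xi u - x) / h) * ((xe u - xi u) / (xe v - xi v)) * `|u - v| `^ (2 * H - 2)) = J1.
    have qE : 2 * H - 2 = q - 1 by rewrite /q; ring.
    by apply: eq_Rintegral => u _; apply: eq_Rintegral => v _; rewrite qE.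
  by rewrite /b_hat YE JE.
have dE : b_hat H sigma K T h x xi xe - b x =
    (fluctuation T h xi + (Ikb - b x * den) - alpha_H H * sigma ^+ 2 / h * (J1 - J0)) / den.
  rewrite bE /fluctuation -/q trE -/Ikb; field; by rewrite h0' lt0r_neq0.
have al0 : 0 <= alpha_H H * sigma ^+ 2 / h.
  apply: divr_ge0; last exact: ltW.
  apply: mulr_ge0; last exact: sqr_ge0.
  apply: mulr_ge0; last exact: ltW.
  by have := H12; lra.
have E := quotient_error den0 al0 bias J dE.
have cE (al : R) : al / h * (K1 * (Lam * eps / M * ((1 + M^-1) / q)) * T) =
    al * (K1 * (Lam / M * ((1 + M^-1) / q))) * (eps * T / h) by ring.
by move: E; rewrite cE.
Qed.

End estimator.

(** * Tail of the fluctuation *)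

Section tail.
Context (d : measure_display) (Omega : measurableType d) (R : realType) (P : probability Omega R).

Lemma clamp_lip (T : R) : 0 < T -> forall s t, `|clamp T s - clamp T t| <= `|s - t|.
Proof.
move=> T0; have H s t : s <= t -> `|clamp T s - clamp T t| <= `|s - t|.
  move=> st; have [h1 h2] := clamp_le T0 st.
  by rewrite distrC [leRHS]distrC !ger0_norm ?subr_ge0.
by move=> s t; have [/H//|/ltW/H] := leP s t; rewrite distrC [leRHS]distrC.
Qed.

Lemma within_cont (T : R) (xi : R -> R) : 0 < T -> {within `[0, +oo[, continuous xi} -> cont T xi.
Proof.
move=> T0 /subspace_continuousP c t.
have D s : `[0, +oo[%classic (clamp T s) by rewrite /= in_itv/= andbT; have /andP[] := clamp_itv T0 s.
have /cvgrPdist_le H := c _ (D t).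
apply/cvgrPdist_le => e /H; rewrite /nbhs/= => -[r /= r0 Hr]; exists r => // s ts.
by apply: (Hr (clamp T s)) (D s); exact: le_lt_trans (clamp_lip T0 _ _) ts.
Qed.

Lemma quadratic_modulus_itv (f : R -> R) (T : R) : 0 < T -> quadratic_modulus f ->
  forall e, 0 < e -> exists2 del, 0 < del & forall s t,
    0 <= s -> s <= t -> t <= T -> t - s <= del -> (f t - f s) ^+ 2 <= e * (t - s).
Proof.
move=> T0 Hf e e0; have [del del0 Hd] := Hf (Num.truncn T).+1 e e0; exists del => // s t s0 st tT.
apply: Hd => //; apply: (le_trans tT).
by have /andP[_ /ltW] := truncn_itv (ltW T0).
Qed.

Lemma mu_ext_cvg0P (S : R -> set Omega) : mu_ext P (S T) @[T --> +oo] --> 0%E <->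
  (forall e : R, 0 < e -> \forall T \near +oo, (mu_ext P (S T) <= e%:E)%E).
Proof.
have ge0 T : (0 <= mu_ext P (S T))%E by exact: mu_ext_ge0.
split=> [/fine_cvgP[fin /cvgrPdist_le c] e e0|H].
  have := c e e0; apply: filterS2 fin => T fT; rewrite /= sub0r normrN ger0_norm ?fine_ge0// => h.
  by rewrite -(fineK fT) lee_fin.
have fin e T : (mu_ext P (S T) <= e%:E)%E -> mu_ext P (S T) \is a fin_num.
  by move=> h; rewrite ge0_fin_numE// (le_lt_trans h)// ltry.
apply/fine_cvgP; split; first by apply: filterS (H 1 ltr01) => T; exact: fin.
apply/cvgrPdist_le => e e0; apply: filterS (H e e0) => T h.
by rewrite /= sub0r normrN ger0_norm ?fine_ge0// -lee_fin fineK// (fin e).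
Qed.

Context (H sigma : R) (B : R -> {RV P >-> R}) (K G b db : R -> R) (M L K0 K1 x : R).
Hypotheses (H12 : 1 / 2 < H) (H1 : H < 1) (sigma0 : sigma != 0).
Hypothesis BH : fractional_brownian_motion H B.
Hypothesis KA : kernel_assumption K.
Hypothesis GK : forall z : R, is_derive z 1 G (K z).
Hypothesis K0b : forall z, `|K z| <= K0.
Hypothesis K1b : forall z, `|derive1 K z| <= K1.
Hypothesis bdb : forall y : R, is_derive y 1 b (db y).
Hypothesis dbM : forall y : R, - L <= db y <= - M.
Hypothesis cdb : continuous db.
Hypothesis M0 : 0 < M.
Context (y0 : R) (X : R -> {RV P >-> R}).
Hypothesis X_sol : sde_solution b sigma B y0 X.

Definition tail_constant := sigma ^+ 2 * (4 * K0 ^+ 2 + (K1 * `|sigma|) ^+ 2 * ((8 + 4 / M) * (2 / M))).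

(** T^(2H) is the order of the sums of covariances, and h^(-2) is the squared Lipschitz constant K1
    / h of the rescaled kernel. The bound for the Euler sums is uniform in the mesh and passes to
    their almost sure limit. *)
Lemma fluctuation_tail T h a : 0 < T -> 0 < h -> h < 1 -> 0 < a ->
  (mu_ext P [set w | (a < `|fluctuation K G b db H sigma x T h (fun t => X t w)|)%R] <=
   (tail_constant * T `^ (2 * H) / (h ^+ 2 * a ^+ 2))%:E)%E.
Proof.
move=> T0 h0 h1 a0; have h0' : h != 0 by exact: lt0r_neq0.
pose q := 2 * H - 1.
have q0 : 0 < q by rewrite /q; have := H12; lra.
have q1 : q < 1 by rewrite /q; have := H1; lra.
have pE : 2 * H = q + 1 by rewrite /q; ring.
have L0 : 0 < L by have /andP[a1 a2] := dbM 0; have := M0; lra.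
pose D n : R := T / n%:R.
have Dp n : 0 < D n.+1 by rewrite divr_gt0.
pose k := rescaled K x h. pose dk := rescaled_derive K x h.
have kdk : forall y : R, is_derive y 1 k (dk y) by exact: (is_derive_rescaled x KA).
pose Gam n i w := B (i.+1%:R * D n) w - B (i%:R * D n) w.
have GF n : gaussian_family P n.+1 (Gam n.+1) (fgn_cov (q + 1) (D n.+1)).
  by rewrite -pE; exact: (gaussian_family_grid H12 BH n.+1 (Dp n)).
pose Zn n w := discrete_skorokhod b db (D n) sigma y0 k dk (fgn_cov (q + 1) (D n)) n (Gam n ^~ w).
(* The discrete sums converge to the fluctuation divided by sigma, hence the threshold a /
   |sigma|. *)
pose Z w := sigma^-1 * fluctuation K G b db H sigma x T h (fun t => X t w).
have s0 : 0 < `|sigma| by rewrite normr_gt0.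
apply: (@le_trans _ _ (mu_ext P [set w | (a / `|sigma| < `|Z w|)%R])).
  apply: le_mu_ext => w /= aw.
  by rewrite normrM normfV [ltRHS]mulrC ltr_pM2r// invr_gt0.
(* 1/2 serves the covariance bound, 1 / L the contraction of an Euler step. *)
have dd : 0 < Num.min (1 / 2) L^-1 :> R by rewrite lt_min invr_gt0 L0 divr_gt0.
have [N HN] := mesh_small T0 dd.
(* The scheme has n + 1 cells, so that its mesh is always positive. *)
apply: (@mu_ext_le_limit _ _ _ P (fun n => Zn n.+1) Z _ _ N).
- by move=> n; exact: (measurable_discrete_skorokhod (GF n)).
- have := X_sol; have := fbm_start H12 BH; have := fbm_quadratic_modulus H12 BH.
  apply: filterS3 => w qm B0 [cX XE].
  have XE' t : 0 <= t <= T -> X t w = y0 + prim (b \o (fun t => X t w)) t + sigma * B t w.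
    by move=> /andP[t0 _]; rewrite XE.
  have lim := discrete_skorokhod_limit T0 bdb dbM cdb M0 kdk (@continuous_rescaled_derive _ K x KA h)
    (fun y => rescaled_derive_le x K1b y h0) (fun y => is_derive_rescaled_primitive x GK y h0')
    q0 q1 (within_cont T0 cX) XE' B0 (quadratic_modulus_itv T0 qm).
  have {}lim : sigma * Zn n w @[n --> \oo] --> fluctuation K G b db H sigma x T h (fun t => X t w) by exact: lim.
  have l2 : sigma^-1 * (sigma * Zn n w) @[n --> \oo] --> Z w by apply: cvgMl_tmp.
  have l3 : Zn n w @[n --> \oo] --> Z w.
    by move: l2; under eq_fun do rewrite mulKf//.
  by rewrite -[X in X --> _]/([sequence Zn n.+1 w]_n @ \oo) (cvg_shiftS (fun n => Zn n w)).
- move=> n Nn; have [_] := HN n.+1 Nn; rewrite le_min -/(D n.+1) => /andP[D2 DL].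
  have LD : L * D n.+1 <= 1 by rewrite mulrC -ler_pdivlMr// mul1r.
  have rho0 : 0 <= 1 - M * D n.+1.
    rewrite subr_ge0 (le_trans _ LD)// ler_wpM2r ?(ltW (Dp n))//.
    by have /andP[a1 a2] := dbM 0; lra.
  have K10 : 0 <= K1 := le_trans (normr_ge0 _) (K1b 0).
  have kb y : 0 <= k y <= K0.
    have [Kp _ _ _ _] := KA; rewrite /k /rescaled Kp/=.
    by rewrite (le_trans (ler_norm _)).
  have klip y z : `|k y - k z| <= K1 / h * `|y - z|.
    have [c _ ->] := mean_value z y kdk; rewrite normrM ler_wpM2r//.
    exact: rescaled_derive_le.
  have a'0 : 0 < a / `|sigma| by rewrite divr_gt0.
  have p1 : 1 < q + 1 by rewrite ltrDr.
  have p2 : q + 1 < 2 by have := q1; lra.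
  have := discrete_skorokhod_tail (GF n) (fun i j => fgn_cov_ge0 p1 (Dp n) i j)
    (fun i => fgn_cov_diag (q + 1) (Dp n) i) sigma y0 bdb kdk kb klip rho0
    (fun y z => drift_contract bdb dbM y z (Dp n) LD) a'0.
  move=> /le_trans; apply; rewrite lee_fin.
  have c0 : 0 <= K1 / h * `|sigma| by rewrite mulr_ge0// divr_ge0// ltW.
  have rE : 1 - (1 - M * D n.+1) = M * D n.+1 by ring.
  have := @skorokhod_bound_sum R (q + 1) (D n.+1) p1 p2 (Dp n) (1 - M * D n.+1) M M0 rho0 rE
    n.+1 K0 (K1 / h * `|sigma|) D2 c0.
  rewrite (_ : n.+1%:R * D n.+1 = T); last by rewrite /D mulrC divfK.
  move=> bnd; set S := \sum_(i < n.+1) _.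
  have {}bnd : S <= (4 * K0 ^+ 2 + (K1 / h * `|sigma|) ^+ 2 * ((8 + 4 / M) * (2 / M))) * T `^ (q + 1).
    apply: le_trans bnd; rewrite le_eqVlt; apply/orP; left; apply/eqP.
    by apply: eq_bigr => i _; apply: eq_bigr => j _; ring.
  rewrite pE ler_pdivrMr ?exprn_gt0//.
  apply: (le_trans bnd).
  have E : tail_constant * T `^ (q + 1) / (h ^+ 2 * a ^+ 2) * (a / `|sigma|) ^+ 2 =
      (4 * K0 ^+ 2 / h ^+ 2 + (K1 / h * `|sigma|) ^+ 2 * ((8 + 4 / M) * (2 / M))) * T `^ (q + 1).
    rewrite /tail_constant -[in sigma ^+ 2](real_normK (num_real sigma)).
    by field; rewrite !lt0r_neq0.
  (* h < 1 puts the K0 term, which carries no h^(-2), under the common factor h^(-2). *)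
  rewrite E ler_wpM2r ?powR_ge0// lerD2r ler_pdivlMr ?exprn_gt0//.
  apply: ler_piMr; first by apply: mulr_ge0 => //; exact: sqr_ge0.
  by apply: exprn_ile1; exact: ltW.
Qed.

End tail.

Lemma powR_sqr_exponent (R : realType) (a s : R) : (a `^ s) ^+ 2 = a `^ (2 * s).
Proof. by rewrite mulrC powRrM powR_mulrn ?powR_ge0. Qed.

(** * Convergence in probability and its rate *)

Section rate.
Context (d : measure_display) (Omega : measurableType d) (R : realType) (P : probability Omega R).
Context (H sigma : R) (H12 : 1 / 2 < H) (H1 : H < 1) (sigma0 : sigma != 0).
Context (B : R -> {RV P >-> R}) (BH : fractional_brownian_motion H B).
Context (b : R -> R) (b_Lip : Lip_b_infty b).
Context (M : R) (M0 : 0 < M) (bM : forall y, derive1 b y <= - M).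
Context (K : R -> R) (KA : kernel_assumption K).
Context (X : R -> R -> {RV P >-> R}) (X_sol : forall y, sde_solution b sigma B y (X y)).
Context (x0 x t0 : R) (h : R -> R) (h_range : forall T, t0 <= T -> 0 < h T < 1).
Context (eps : R -> R) (eps_gt0 : forall T, t0 <= T -> 0 < eps T).
Context (l : \bar R) (l_gt0 : (0%:E < l)%E).
Hypothesis f_hat_cvg : cvg_in_probability P
    (fun T w => f_hat K T (h T) x (fun s => X x0 s w)) l.

(** c is half of a finite limit; for l = +oo any constant serves, here 1. *)
Lemma f_hat_bounded_below : exists2 c, 0 < c & forall e, 0 < e -> \forall T \near +oo,
  (mu_ext P [set w | (f_hat K T (h T) x (fun s => X x0 s w) <= c)%R] <= e%:E)%E.
Proof.
case: l l_gt0 f_hat_cvg => [r|_|//].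
  rewrite lte_fin => r0 fr; have r20 : 0 < r / 2 by rewrite divr_gt0.
  exists (r / 2) => // e e0; have /mu_ext_cvg0P/(_ e e0) := fr _ r20.
  apply: filterS => T; apply: le_trans; apply: le_mu_ext => w /= fw.
  by rewrite distrC (le_trans _ (ler_norm _))//; lra.
by move=> fr; exists 1 => // e e0; have /mu_ext_cvg0P/(_ e e0) := fr 1.
Qed.

(** The rate r is 1 for consistency and T^gamma for the second claim. The three conditions make
    negligible, in turn, the bias L h, the fluctuation of order T^H / h over T h, and the change of
    kernel of order eps T / h over T h. *)
Lemma error_cvg (r : R -> R) : (\forall T \near +oo, 0 < r T) ->
  (forall e, 0 < e -> \forall T \near +oo, r T * h T <= e) ->
  (forall e, 0 < e -> \forall T \near +oo, r T * T `^ (H - 1) <= e * h T ^+ 2) ->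
  (forall e, 0 < e -> \forall T \near +oo, r T * eps T <= e * h T ^+ 2) ->
  forall e, 0 < e -> mu_ext P [set w | e <= r T * `|b_hat H sigma K T (h T) x
    (fun s => X x0 s w) (fun s => X (x0 + eps T) s w) - b x|] @[T --> +oo] --> 0%E.
Proof.
move=> r_gt0 rh rT re e e0; apply/mu_ext_cvg0P => eta eta0.
have [_ dbn _ bdn] := b_Lip (isT : (1 <= 2)%N).
have db0 z : derivable b z 1 by have := dbn 0%N isT z; rewrite derive1n0.
have db1 z : derivable (derive1 b) z 1 by have := dbn 1%N isT z; rewrite derive1n1.
have bdb := is_derive_derive1 db0; have dbd := is_derive_derive1 db1.
have cdb : continuous (derive1 b) by exact: is_derive_continuous dbd.
have [L L0 HL] : exists2 C, 0 < C & forall z, `|derive1 b z| <= C.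
  by apply: bounded_fun_le; have := bdn 1%N isT; rewrite derive1n1.
have [Lam Lam0 HLam] : exists2 C, 0 < C & forall z, `|derive1 (derive1 b) z| <= C.
  by apply: bounded_fun_le; have := bdn 2%N isT; rewrite derive1nS derive1n1.
have dbM y : - L <= derive1 b y <= - M by rewrite bM andbT; have := HL y; rewrite ler_norml => /andP[].
have db_lip y z : `|derive1 b y - derive1 b z| <= Lam * `|y - z|.
  by have [c _ ->] := mean_value z y dbd; rewrite normrM ler_wpM2r.
have [G GK] := kernel_antiderivative KA.
have [_ _ [bK bK'] _ _] := KA.
have [K0 K00 K0b] := bounded_fun_le bK; have [K1 K10 K1b] := bounded_fun_le bK'.
have [c c0 fc] := f_hat_bounded_below.
have eta20 : 0 < eta / 2 by rewrite divr_gt0.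
pose C1 := @tail_constant R sigma M K0 K1.
pose C2 := alpha_H H * sigma ^+ 2 * (K1 * (Lam / M * ((1 + M^-1) / (2 * H - 1)))).
have q0 : 0 < 2 * H - 1 by have := H12; lra.
have H0 : 0 < H by have := H12; lra.
have M'0 : 0 < M^-1 by rewrite invr_gt0.
have C20 : 0 < C2.
  apply: mulr_gt0; first by apply: mulr_gt0; [exact: mulr_gt0|rewrite exprn_even_gt0].
  apply: mulr_gt0 => //; apply: mulr_gt0; first exact: divr_gt0.
  by apply: divr_gt0 => //; apply: addr_gt0.
have C10 : 0 <= C1.
  rewrite /C1 /tail_constant mulr_ge0 ?sqr_ge0// addr_ge0//; first by rewrite mulr_ge0 ?sqr_ge0.
  apply: mulr_ge0; first exact: sqr_ge0.
  by apply: mulr_ge0; [apply: addr_ge0 => //|]; apply: divr_ge0 => //; exact: ltW.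
pose C3 := 16 * C1 / (e ^+ 2 * c ^+ 2).
have C30 : 0 <= C3.
  apply: divr_ge0; first by apply: mulr_ge0; [exact: ler0n|exact: C10].
  by apply: mulr_ge0; exact: sqr_ge0.
(* e2 <= 1 gives e2^2 <= e2, so that C3 e2^2 <= eta / 2. *)
pose e2 := Num.min 1 (eta / 2 / (C3 + 1)).
have C310 : 0 < C3 + 1 by rewrite ltr_wpDl.
have e20 : 0 < e2 by rewrite lt_min ltr01 divr_gt0.
have e2C : C3 * e2 ^+ 2 <= eta / 2.
  have h1 : e2 ^+ 2 <= e2 by rewrite expr2 ler_piMr ?(ltW e20)// ge_min lexx.
  have h2 : e2 * (C3 + 1) <= eta / 2 by rewrite -ler_pdivlMr// ge_min lexx orbT.
  apply: le_trans h2; rewrite mulrC; apply: ler_pM => //; first exact: sqr_ge0.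
  by rewrite lerDl.
have e10 : 0 < e / (4 * L) by rewrite divr_gt0// mulr_gt0.
have e30 : 0 < e * c / (4 * C2) by apply: divr_gt0; [exact: mulr_gt0|rewrite mulr_gt0].
have big : \forall T \near +oo, t0 <= T /\ 1 <= T.
  exact: filterI (nbhs_pinfty_ge (num_real t0)) (nbhs_pinfty_ge (num_real 1)).
have n1 : \forall T \near +oo, 0 < r T /\ r T * h T <= e / (4 * L).
  by apply: filterS2 r_gt0 (rh _ e10) => T.
have n2 : \forall T \near +oo, r T * T `^ (H - 1) <= e2 * h T ^+ 2 /\
    r T * eps T <= e * c / (4 * C2) * h T ^+ 2.
  by apply: filterS2 (rT _ e20) (re _ e30) => T.
have n3 : \forall T \near +oo, (t0 <= T /\ 1 <= T) /\
    (mu_ext P [set w | (f_hat K T (h T) x (fun s => X x0 s w) <= c)%R] <= (eta / 2)%:E)%E.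
  by apply: filterS2 big (fc _ eta20) => T.
apply: filterS3 n1 n2 n3 => T [rT0 rhT] [rTT reT] [[t0T T1] fT].
have T0 : 0 < T := lt_le_trans ltr01 T1.
have /andP[hT0 hT1] := h_range t0T; have epsT := eps_gt0 t0T.
(* The threshold at which the fluctuation term, with [f_hat] replaced by its lower bound c,
   contributes exactly e / 4. *)
pose a := e * (T * h T * c) / (4 * r T).
have ThcP : 0 < T * h T * c by rewrite !mulr_gt0.
have a0 : 0 < a by rewrite divr_gt0 ?mulr_gt0.
pose f w := f_hat K T (h T) x (fun s => X x0 s w).
pose fl w := fluctuation K G b (derive1 b) H sigma x T (h T) (fun t => X x0 t w).
have tail := fluctuation_tail x H12 H1 sigma0 BH KA GK K0b K1b bdb dbM cdb M0 (X_sol x0) T0 hT0 hT1 a0.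
have /= [N [mN PN subN]] : {ae P, forall w, f w > 0 -> `|b_hat H sigma K T (h T) x
    (fun s => X x0 s w) (fun s => X (x0 + eps T) s w) - b x| <=
    L * h T + (`|fl w| + C2 * (eps T * T / h T)) / (T * h T * f w)}.
  have qm := fbm_quadratic_modulus H12 BH.
  apply: filterS3 (X_sol x0) (X_sol (x0 + eps T)) qm => w [cX XE] [cXe XeE] qmw fw0.
  apply: (estimator_error (y0 := x0) (beta := fun t => B t w) KA GK K1b bdb dbM M0 db_lip H12 H1
    T0 hT0 epsT (within_cont T0 cX) (within_cont T0 cXe)) => //.
  - by move=> t /andP[t1 _]; rewrite XE.
  - by move=> t /andP[t1 _]; rewrite XeE.
  - exact: quadratic_modulus_itv.
(* Off the three exceptional sets each of the three error terms is at most e / 4, so their sum stays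
   below e. *)
have incl : [set w | e <= r T * `|b_hat H sigma K T (h T) x
    (fun s => X x0 s w) (fun s => X (x0 + eps T) s w) - b x|] `<=`
  [set w | f w <= c] `|` ([set w | (a < `|fl w|)%R] `|` N).
  move=> w /= ew; have [fw|fw] := leP (f w) c; first by left.
  right; have [aw|aw] := ltP a `|fl w|; first by left.
  right; apply: subN => /=; rewrite not_implyE; split; first exact: lt_trans fw.
  apply/negP; rewrite -ltNge -(ltr_pM2l rT0); apply: lt_le_trans ew.
  have f0 : 0 < f w := lt_trans c0 fw.
  have Th : 0 < T * h T by exact: mulr_gt0.
  have Thf : 0 < T * h T * f w by exact: mulr_gt0.
  have p1 : r T * (L * h T) <= e / 4.
    rewrite mulrCA -ler_pdivlMl// (le_trans rhT)// le_eqVlt; apply/orP; left; apply/eqP; field.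
    exact: lt0r_neq0.
  have cf : (T * h T * f w)^-1 <= (T * h T * c)^-1.
    by rewrite lef_pV2 ?posrE// ler_pM2l// ltW.
  have p2 : r T * (`|fl w| / (T * h T * f w)) <= e / 4.
    apply: (@le_trans _ _ (r T * (a / (T * h T * c)))).
      by rewrite ler_pM2l//; apply: ler_pM => //; rewrite invr_ge0 ltW.
    rewrite le_eqVlt; apply/orP; left; apply/eqP; rewrite /a; field.
    by rewrite !lt0r_neq0.
  have p3 : r T * (C2 * (eps T * T / h T) / (T * h T * f w)) <= e / 4.
    apply: (@le_trans _ _ (r T * (C2 * (eps T * T / h T) / (T * h T * c)))).
      rewrite ler_pM2l//; apply: ler_wpM2l => //.
      by rewrite mulr_ge0 ?(ltW C20)// divr_ge0 ?mulr_ge0// ltW.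
    rewrite (_ : r T * _ = (r T * eps T) * (C2 / (h T ^+ 2 * c))); last first.
      by field; rewrite !lt0r_neq0.
    apply: (@le_trans _ _ (e * c / (4 * C2) * h T ^+ 2 * (C2 / (h T ^+ 2 * c)))).
      by rewrite ler_wpM2r// divr_ge0 ?(ltW C20)// mulr_ge0 ?sqr_ge0// ltW.
    rewrite le_eqVlt; apply/orP; left; apply/eqP; field.
    by rewrite !lt0r_neq0.
  by rewrite mulrDr mulrDl mulrDr; lra.
have U2 (A1 A2 : set Omega) : (mu_ext P (A1 `|` A2) <= mu_ext P A1 + mu_ext P A2)%E.
  exact: outer_measureU2.
apply: le_trans; first by apply: le_mu_ext; exact: incl.
apply: (le_trans (U2 _ _)).
rewrite (_ : eta%:E = ((eta / 2)%:E + (eta / 2)%:E)%E); last by rewrite -EFinD -splitr.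
apply: leeD => //; apply: (le_trans (U2 _ _)).
have -> : mu_ext P N = 0%E by rewrite measurable_mu_extE.
rewrite adde0; apply: (le_trans tail); rewrite lee_fin; apply: le_trans e2C.
have TE : T `^ (2 * H) = (T * T `^ (H - 1)) ^+ 2.
  have -> : T * T `^ (H - 1) = T `^ H.
    by rewrite -[X in X * _](powRr1 (ltW T0)) -powRD; [congr (_ `^ _); ring|rewrite (gt_eqF T0) implybT].
  by rewrite powR_sqr_exponent.
have -> : tail_constant sigma M K0 K1 * T `^ (2 * H) / (h T ^+ 2 * a ^+ 2) =
    C3 * ((r T * T `^ (H - 1)) / h T ^+ 2) ^+ 2.
  rewrite TE -/C1 /a /C3; field; by rewrite !lt0r_neq0.
have Q0 : 0 <= r T * T `^ (H - 1) / h T ^+ 2.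
  exact: divr_ge0 (mulr_ge0 (ltW rT0) (powR_ge0 _ _)) (sqr_ge0 _).
have Q1 : r T * T `^ (H - 1) / h T ^+ 2 <= e2 by rewrite ler_pdivrMr// exprn_gt0.
by apply: ler_wpM2l => //; apply: lerXn2r; rewrite ?nnegrE// ltW.
Qed.

End rate.

(** h^(-2) u^2 = (u / h^2)^2 h^2, and u / h^2 tends to 0. The conditions on eps in both claims have
    this form. *)
Lemma bandwidth_gap (R : realType) (h r u eps : R -> R) (t0 : R) :
  (forall T, t0 <= T -> 0 < h T < 1) ->
  (forall e, 0 < e -> \forall T \near +oo, `|u T| <= e * h T ^+ 2) ->
  (\forall T \near +oo, r T * eps T <= h T ^- 2 * u T ^+ 2) ->
  forall e, 0 < e -> \forall T \near +oo, r T * eps T <= e * h T ^+ 2.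
Proof.
move=> h_range Hu Hre e e0.
have e'0 : 0 < Num.min 1 e by rewrite lt_min ltr01.
apply: filterS3 (nbhs_pinfty_ge (num_real t0)) (Hu _ e'0) Hre => T /h_range/andP[h0 _] uT reT.
have h20 : 0 < h T ^+ 2 by exact: exprn_gt0.
apply: (le_trans reT); rewrite -[u T ^+ 2]real_normK ?num_real//.
apply: (@le_trans _ _ (h T ^- 2 * (Num.min 1 e * h T ^+ 2) ^+ 2)).
  rewrite ler_pM2l ?invr_gt0//; apply: lerXn2r; rewrite ?nnegrE// mulr_ge0// ltW//.
have E (m : R) : h T ^- 2 * (m * h T ^+ 2) ^+ 2 = m ^+ 2 * h T ^+ 2.
  by field; exact: lt0r_neq0.
rewrite E.
rewrite ler_pM2r// expr2; apply: (@le_trans _ _ (1 * e)); last by rewrite mul1r.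
by apply: ler_pM; rewrite ?(ltW e'0)// ge_min lexx ?orbT.
Qed.

Theorem corollary3p7 (d : measure_display) (Omega : measurableType d)
  (R : realType) (P : probability Omega R)
  (H sigma : R) (H_gt : 1 / 2 < H) (H_lt : H < 1) (sigma_neq0 : sigma != 0)
  (B : R -> {RV P >-> R}) (B_fbm : fractional_brownian_motion H B)
  (b : R -> R) (b_Lip : Lip_b_infty b)
  (b_diss : exists2 M : R, 0 < M & forall y, derive1 b y <= - M)
  (K : R -> R) (K_kernel : kernel_assumption K)
  (X : R -> R -> {RV P >-> R})
  (X_sol : forall y, sde_solution b sigma B y (X y))
  (x0 x t0 : R) (t0_ge0 : 0 <= t0)
  (h : R -> R) (h_range : forall T, t0 <= T -> 0 < h T < 1)
  (h_decr : forall S T, t0 <= S -> S <= T -> h T <= h S)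
  (h_cvg0 : h T @[T --> +oo] --> 0)
  (Th_cvgy : T * h T @[T --> +oo] --> +oo)
  (eps : R -> R) (eps_gt0 : forall T, t0 <= T -> 0 < eps T)
  (eps_cvg0 : eps T @[T --> +oo] --> 0)
  (l : \bar R) (l_gt0 : (0%:E < l)%E)
  (f_hat_cvg : cvg_in_probability P
    (fun T w => f_hat K T (h T) x (fun s => X x0 s w)) l)
  (beta : R) (beta_gt0 : 0 < beta) (beta_lt : beta < 1 - H)
  (beta_h : (fun T => T `^ (- beta)) =o_pinfty (fun T => h T ^+ 2)) :
  let b_hat_T := fun T w =>
    b_hat H sigma K T (h T) x
      (fun s => X x0 s w) (fun s => X (x0 + eps T) s w) in
  (eps =o_pinfty (fun T => h T ^- 2 * T `^ (2 * H - 2)) ->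
   cvg_in_probability P b_hat_T (b x)%:E)
  /\
  (forall gamma : R, 0 < gamma -> gamma < beta ->
   h =o_pinfty (fun T => T `^ (- gamma)) ->
   (fun T => T `^ (H - 1 + gamma)) =o_pinfty (fun T => h T ^+ 2) ->
   eps =o_pinfty (fun T => h T ^- 2 * T `^ (2 * H - 2 + gamma)) ->
   cvg_in_probability P
     (fun T w => T `^ gamma * `|b_hat_T T w - b x|) 0%:E).
Proof.
move=> b_hat_T; have [M M0 bM] := b_diss.
have big e : \forall T \near +oo, e <= T :> R by exact: nbhs_pinfty_ge (num_real e).
split=> [/eqoP eps_o|gamma g0 gb /eqoP h_o /eqoP T_o /eqoP eps_o].
  (* As beta < 1 - H, T^(H-1) <= T^(-beta) for T >= 1, and the hypothesis on beta applies. *)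
  have u_o e : 0 < e -> \forall T \near +oo, `|T `^ (H - 1)| <= e * h T ^+ 2.
    move: beta_h => /eqoP bo e0; apply: filterS3 (big 1) (big t0) (bo e e0) => T T1 t0T.
    rewrite !ger0_norm ?powR_ge0 ?sqr_ge0//; apply: le_trans; apply: ler_powR => //.
    by have := beta_lt; lra.
  have main : forall e, 0 < e -> mu_ext P [set w | e <= 1 * `|b_hat_T T w - b x|] @[T --> +oo] --> 0%E.
    apply: (error_cvg H_gt H_lt sigma_neq0 B_fbm b_Lip M0 bM K_kernel X_sol h_range eps_gt0 l_gt0 f_hat_cvg).
    - by apply: nearW => T; exact: ltr01.
    - move=> e e0; move: h_cvg0 => /cvgr_le/(_ e e0); apply: filterS => T hT; by rewrite mul1r.
    - move=> e /u_o; apply: filterS => T; rewrite mul1r; exact: le_trans (ler_norm _).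
    - apply: (bandwidth_gap h_range u_o).
      apply: filterS3 (big 1) (big t0) (eps_o 1 ltr01) => T T1 t0T; rewrite !mul1r => eT.
      apply: (le_trans (ler_norm _)); apply: (le_trans eT).
      have T0 : 0 < T := lt_le_trans ltr01 T1.
      rewrite ger0_norm; last by rewrite mulr_ge0 ?powR_ge0// invr_ge0 sqr_ge0.
      rewrite powR_sqr_exponent.
      by rewrite (_ : 2 * (H - 1) = 2 * H - 2)//; ring.
  by move=> e e0; have := main e e0; under eq_fun do under eq_set do rewrite mul1r.
have main : forall e, 0 < e -> mu_ext P [set w | e <= T `^ gamma * `|b_hat_T T w - b x|] @[T --> +oo] --> 0%E.
  apply: (error_cvg H_gt H_lt sigma_neq0 B_fbm b_Lip M0 bM K_kernel X_sol h_range eps_gt0 l_gt0 f_hat_cvg).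
  - by apply: filterS (big 1) => T T1; rewrite powR_gt0// (lt_le_trans ltr01).
  - move=> e e0; apply: filterS2 (big 1) (h_o e e0) => T T1.
    have T0 : 0 < T := lt_le_trans ltr01 T1.
    rewrite [X in _ <= _ * X]ger0_norm ?powR_ge0// powRN ler_pdivlMr ?powR_gt0// => hT.
    by rewrite mulrC (le_trans _ hT)// ler_wpM2r ?powR_ge0// ler_norm.
  - move=> e e0; apply: filterS2 (big 1) (T_o e e0) => T T1.
    have T0 : 0 < T := lt_le_trans ltr01 T1.
    rewrite -powRD ?(gt_eqF T0) ?implybT// !ger0_norm ?powR_ge0 ?sqr_ge0//.
    by rewrite addrC.
  (* Here u^2 = T^gamma T^(2H-2+gamma): the rate times the bound on eps, without h^(-2), is a
     perfect square. *)
  - apply: (@bandwidth_gap _ h _ (fun T => T `^ (H - 1 + gamma)) eps t0 h_range).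
      move=> e e0; apply: filterS (T_o e e0) => T.
      by rewrite [X in _ <= _ * X]ger0_norm ?sqr_ge0.
    apply: filterS3 (big 1) (big t0) (eps_o 1 ltr01) => T T1 t0T; rewrite mul1r => eT.
    have T0 : 0 < T := lt_le_trans ltr01 T1.
    apply: (@le_trans _ _ (T `^ gamma * (h T ^- 2 * T `^ (2 * H - 2 + gamma)))).
      rewrite ler_wpM2l ?powR_ge0// (le_trans (ler_norm _))// (le_trans eT)//.
      by rewrite ger0_norm// mulr_ge0 ?powR_ge0// invr_ge0 sqr_ge0.
    rewrite mulrCA ler_wpM2l ?invr_ge0 ?sqr_ge0//.
    rewrite -powRD ?(gt_eqF T0) ?implybT// powR_sqr_exponent.
    by rewrite (_ : 2 * (H - 1 + gamma) = gamma + (2 * H - 2 + gamma))//; ring.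
move=> e e0; have := main e e0; apply: cvg_trans; apply: near_eq_cvg; apply: nearW => T.
congr (mu_ext P _); apply/seteqP; split=> w /=.
all: by rewrite subr0 (ger0_norm (mulr_ge0 (powR_ge0 _ _) (normr_ge0 _))).
Qed.
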